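(* For every $\beta>0$ there exist a smooth radial weight $\varphi$ on $\mathbb C$ satisfying $$\tfrac34 I_2\le\operatorname{Hess}_{\mathbb R}\varphi\le\tfrac94 I_2$$ and the positive radial symbol $f(z)=(1+|z|^2)^{-\beta/2}$ such that the sequence $j^{\beta/2}s_j(T_f)$ has two different positive subsequential limits, where $T_f$ is the Toeplitz operator on $F^2_\varphi$. Consequently there is no constant $C$ for which $N(t;T_f)\sim Ct^{-2/\beta}$ as $t\downarrow0$.
   Context: $F^2_\varphi=L^2_\varphi\cap\mathcal H(\mathbb C)$ with $L^2_\varphi=L^2(\mathbb C,e^{-2\varphi}dv)$, $dv$ Lebesgue measure, $\mathcal H(\mathbb C)$ the entire functions; $P$ is the orthogonal projection of $L^2_\varphi$ onto $F^2_\varphi$ and $T_fg=P(fg)$. $s_1(A)\ge s_2(A)\ge\cdots$ are the singular values of a compact operator $A$, $N(t;A)=\#\{k:s_k(A)>t\}$, and $\sim$ means that the ratio of the two sides tends to $1$. *)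

(* Defs.v *)
From HB Require Import structures.
From mathcomp Require Import all_boot all_order all_algebra.
From mathcomp Require Import finmap complex.
From mathcomp Require Import all_classical all_reals all_analysis.

Set Implicit Arguments.
Unset Strict Implicit.
Unset Printing Implicit Defensive.

Import Order.TTheory GRing.Theory Num.Theory.
Import numFieldNormedType.Exports.

Local Open Scope classical_set_scope.
Local Open Scope ring_scope.
Local Open Scope complex_scope.

Section Plane.
Context {R : realType}.
Implicit Types (g h : R[i] -> R[i]) (u : R * R -> R) (phi : R[i] -> R).

Definition cpx (p : R * R) : R[i] := p.1 +i* p.2.

Definition modulus (z : R[i]) : R := ComplexField.Normc.normc z.

Definition area : set (measurableTypeR R * measurableTypeR R) -> \bar R :=
  (@lebesgue_measure R \x @lebesgue_measure R)%E.

Definition cmeasurable g : Prop :=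
  measurable_fun [set: measurableTypeR R * measurableTypeR R]
    (fun p => complex.Re (g (cpx p))) /\
  measurable_fun [set: measurableTypeR R * measurableTypeR R]
    (fun p => complex.Im (g (cpx p))).

Definition cintegral h : R[i] :=
  Rintegral area setT (fun p => complex.Re (h (cpx p))) +i*
  Rintegral area setT (fun p => complex.Im (h (cpx p))).

Definition entire g : Prop := forall z : R[i], derivable (g : R[i]^o -> R[i]^o) z 1.

Definition evec (i : 'I_2) : R * R := if i == 0 then (1, 0) else (0, 1).

Definition partial (i : 'I_2) u : R * R -> R := fun p => 'D_(evec i) u p.

Fixpoint Ck (n : nat) u : Prop :=
  match n with
  | 0 => continuous u
  | m.+1 => [/\ continuous u, (forall i p, derivable u p (evec i))
              & forall i, Ck m (partial i u)]
  end.

Definition smooth phi : Prop := forall n, Ck n (phi \o cpx).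

Definition radial phi : Prop :=
  forall z w, modulus z = modulus w -> phi z = phi w.

Definition hessian phi (z : R[i]) : 'M[R]_2 :=
  \matrix_(i, j) partial i (partial j (phi \o cpx)) (complex.Re z, complex.Im z).

(* The Loewner order; it is only applied to symmetric matrices. *)
Definition loewner_le (A B : 'M[R]_2) : Prop :=
  forall v : 'cV[R]_2, (v^T *m A *m v) 0 0 <= (v^T *m B *m v) 0 0.

End Plane.

Section Fock.
Context {R : realType}.
Variable phi : R[i] -> R.
Implicit Types (f g h k : R[i] -> R[i]) (A B : (R[i] -> R[i]) -> R[i] -> R[i]).

Definition weight (z : R[i]) : R := expR (- (2 * phi z)).

Definition L2 g : Prop :=
  cmeasurable g /\
  (\int[area]_p ((modulus (g (cpx p)) ^+ 2 * weight (cpx p))%:E) < +oo)%E.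

Definition F2 : set (R[i] -> R[i]) := [set g | L2 g /\ entire g].

Definition inner g h : R[i] :=
  cintegral (fun z => g z * (h z)^* * (weight z)%:C).

Definition L2norm g : R :=
  Num.sqrt (Rintegral area setT (fun p => modulus (g (cpx p)) ^+ 2 * weight (cpx p))).

(* Elements of F2 are continuous, so the projection of a class in L2 is a
   single function, and F2 needs no quotient by almost-everywhere equality. *)
Definition projF2 g : R[i] -> R[i] :=
  xget (fun=> 0) [set h | F2 h /\
    forall k, F2 k -> inner (fun z => g z - h z) k = 0].

Definition toeplitz f g : R[i] -> R[i] := projF2 (fun z => f z * g z).

Definition linear_on_F2 A : Prop :=
  (forall g, F2 g -> F2 (A g)) /\
  (forall (c : R[i]) g h, F2 g -> F2 h ->
     A (fun z => c * g z + h z) = (fun z => c * A g z + A h z)).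

Definition compact_op A : Prop :=
  linear_on_F2 A /\
  forall u : nat -> R[i] -> R[i],
    (forall n, F2 (u n) /\ L2norm (u n) <= 1) ->
    exists (sigma : nat -> nat) (h : R[i] -> R[i]),
      [/\ {homo sigma : m n / (m < n)%N}, F2 h
        & (fun n => L2norm (fun z => A (u (sigma n)) z - h z)) @ \oo --> (0 : R)].

Definition adjoint A h : R[i] -> R[i] :=
  xget (fun=> 0) [set k | F2 k /\ forall g, F2 g -> inner (A g) h = inner g k].

Definition eigenspace A (a : R) : set (R[i] -> R[i]) :=
  [set g | F2 g /\ A g = (fun z => a%:C * g z)].

Definition has_dim (E : set (R[i] -> R[i])) (n : nat) : Prop :=
  exists b : 'I_n -> R[i] -> R[i],
    [/\ forall i, E (b i),
        forall c : 'I_n -> R[i],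
          (forall z, \sum_(i < n) c i * b i z = 0) -> forall i, c i = 0
      & forall g, E g ->
          exists c : 'I_n -> R[i], forall z, g z = \sum_(i < n) c i * b i z].

(* [s] lists the square roots of the eigenvalues of A^* A in nonincreasing order
   with multiplicity, padded by zeros if A has finite rank.  Indexing starts at
   0: s_j(A) is [s j.-1]. *)
Definition singular_values A (s : nat -> R) : Prop :=
  [/\ nonincreasing_seq s,
      forall m, 0 <= s m,
      s @ \oo --> (0 : R)
    & forall lam : R, 0 < lam -> exists n : nat,
        has_dim (eigenspace (fun g => adjoint A (A g)) (lam ^+ 2)) n /\
        ([set m | s m = lam] #= `I_n)%card].

End Fock.

Section Counting.
Context {R : realType}.

(* [fset_set] is meaningful on finite sets only; for s tending to 0 and t > 0
   the set is finite. *)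
Definition counting_fun (s : nat -> R) (t : R) : nat :=
  #|` fset_set [set k | t < s k] |%fset.

Definition subseq_limit (a : nat -> R) (l : R) : Prop :=
  exists sigma : nat -> nat,
    {homo sigma : m n / (m < n)%N} /\ a \o sigma @ \oo --> l.

Definition symbol (beta : R) (z : R[i]) : R :=
  (1 + modulus z ^+ 2) `^ (- (beta / 2)).

End Counting.

(* Main.v *)
(* Write s = |z|^2.  The weight is phi (z) = G (s) with
   2 G'(s) = 3/2 + sin (ln (1 + s) / 4) / 2, whose oscillation is slow enough for
   Hess phi = 2 G' I + 4 G'' z z^T to stay between 3/4 and 9/4.  Everything being
   radial, T_f is diagonal in the monomials, with eigenvalues
   lambda_n = <(1 + s)^(-beta/2)>_n, the mean over the probability density
   proportional to s^n exp (-2 G (s)).  They decrease strictly (Chebyshev's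
   correlation inequality), hence are the singular values.  Put
   q (s) = 2 s G'(s).  Integration by parts (Euler's identity in the plane) gives
   <q>_n = n + 1 and Var_n (q) = <s q'>_n = O (n); as q' >= 1/2, the density
   concentrates near the root s_n of q (s_n) = n + 1, so that
   lambda_n ~ (1 + s_n)^(-beta/2).  Where sin (ln (1 + s) / 4) equals 0,
   respectively 1, n / s_n is about 3/2, respectively 2, which yields the limits
   (3/2)^(beta/2) and 2^(beta/2); and N (lambda_n) = n turns a constant C into a
   common value of both limits to the power 2/beta.

   That an entire function is the sum of its power series is obtained from
   Goursat's bisection argument for a closed form A dx + B dy on the plane, and
   Cauchy's formula averaged over an annulus; the averages replace polar
   coordinates throughout, rotation invariance entering as
   int (x d_y F - y d_x F) rho (s) = 0. *)
Require Import Defs.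
From HB Require Import structures.
From mathcomp Require Import all_boot all_order all_algebra.
From mathcomp Require Import complex.
From mathcomp Require Import all_classical all_reals all_analysis.
From mathcomp Require Import measurable_realfun.
From mathcomp Require Import ring lra zify.
Set Implicit Arguments.
Unset Strict Implicit.
Unset Printing Implicit Defensive.
Import Order.TTheory GRing.Theory Num.Theory.
Import numFieldNormedType.Exports.
Local Open Scope classical_set_scope.
Local Open Scope ring_scope.
Local Open Scope complex_scope.

(** The sine is taken of a logarithm because a function of ln (1 + s) never settles, so that n / s_n
    keeps oscillating, while s times its derivative stays bounded. With frequency 1/4 and amplitude
    1/2, 2 G' ranges over [1, 2] and the radial term 4 s G'' over [-1/4, 1/4]; this is where 3/4 and
    9/4 come from. The delicate point of the concentration is that (1 + s)^(-beta/2) is of order 1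
    near s = 0, far above the expected n^(-beta/2), so for large beta a variance bound alone does
    not suffice; it is combined with bounds for negative moments of 1 + s, obtained by lowering n.
    Radial profiles are C^1 functions on the whole line, extended to s < 0 where necessary, so that
    one-variable calculus applies without boundary cases at s = 0. Projection and adjoint are
    selected by their defining properties, so existence and uniqueness have to be shown for each;
    this is done on Taylor coefficients, where F^2 is a weighted l^2 space and T_f multiplies the
    n-th coefficient by lambda_n. *)

(** * Measurability of continuous functions on the plane *)

Section PlaneMeasure.
Context {R : realType}.
Implicit Types u v : R * R -> R.

HB.instance Definition _ := Measure.copy (@area R)
  (@lebesgue_measure R \x @lebesgue_measure R)%E.

(** Continuity tested on squares: later estimates move along horizontal and vertical segments, with
    a separate bound for each coordinate. *)
Lemma continuous2P u p : {for p, continuous u} <->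
  forall e, 0 < e -> exists2 d, 0 < d &
    forall x y, `|x - p.1| < d -> `|y - p.2| < d -> `|u (x, y) - u p| < e.
Proof.
split => [/cvgrPdist_lt cu e e0|H].
  have [d /= d0 H] := (iffLR (@nbhs_ballP R (R * R)%type _ _) (cu e e0)).
  exists d => // x y xd yd; rewrite distrC; apply: (H (x, y)).
  by split; rewrite /ball/= distrC.
apply/cvgrPdist_lt => e e0; have [d d0 {}H] := H e e0.
apply/(@nbhs_ballP R (R * R)%type); exists d => // -[x y] [/= xd yd].
by rewrite distrC; apply: H; rewrite distrC.
Qed.

Let close_box (q p x e d : R) : q - e < x -> x < q + e -> p < q -> q < p + e ->
  e < d / 2 -> `|p - x| < d.
Proof. by move=> *; rewrite ltr_norml; apply/andP; split; lra. Qed.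

Let in_box (q p e : R) : p < q -> q < p + e -> (q - e < p) && (p < q + e).
Proof. by move=> *; apply/andP; split; lra. Qed.

(** The sigma-algebra is the product of two one-dimensional ones, so openness in the plane gives no
    measurability by itself. The preimage of an open interval is written as the union of the
    rational squares [B k] that it contains, a countable family of measurable boxes. *)
Lemma continuous2_measurable u : continuous u ->
  measurable_fun [set: measurableTypeR R * measurableTypeR R] u.
Proof.
move=> cu _; apply: (measurability _ (measurable_realfun.RGenOpens.measurableE R)) => //.
move=> _ [_ [a [b ->] <-]]; rewrite setTI.
pose B (k : rat * rat * nat) : set (measurableTypeR R * measurableTypeR R) :=
  `](ratr k.1.1 - k.2.+1%:R^-1), (ratr k.1.1 + k.2.+1%:R^-1)[ `*`
  `](ratr k.1.2 - k.2.+1%:R^-1), (ratr k.1.2 + k.2.+1%:R^-1)[.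
have mB k : measurable (B k) by apply: measurableX; exact: measurable_itv.
have oU : open (u @^-1` `]a, b[).
  by apply: open_comp; [move=> x _; exact: cu|exact: interval_open].
rewrite [X in measurable X](_ : _ =
    \bigcup_(k in [set: rat * rat * nat])
       (if `[< B k `<=` u @^-1` `]a, b[ >] then B k else set0)); last first.
  apply/seteqP; split => [p pU|p [k _]]; last by case: asboolP => // + Bp; exact.
  have := iffLR (@nbhs_ballP R (R * R)%type _ _) (open_nbhs_nbhs (conj oU pU)).
  move=> [d /= d0 dU].
  (* A square of half-width below d / 2 that contains p stays within d of p in each coordinate. *)
  have [n nd] : exists n, n.+1%:R^-1 < d / 2.
    have := near_infty_natSinv_lt (PosNum (divr_gt0 d0 (ltr0Sn _ 1))).
    by move=> [n _ /(_ n (leqnn _))] /= h; exists n.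
  have n0 : 0 < n.+1%:R^-1 :> R by rewrite invr_gt0.
  have [q1] : exists q, ratr q \in `]p.1, p.1 + n.+1%:R^-1[ by apply: rat_in_itvoo; rewrite ltrDl.
  rewrite in_itv /= => /andP[q11 q12].
  have [q2] : exists q, ratr q \in `]p.2, p.2 + n.+1%:R^-1[ by apply: rat_in_itvoo; rewrite ltrDl.
  rewrite in_itv /= => /andP[q21 q22].
  exists (q1, q2, n) => //.
  case: asboolP => [_|]; last first.
    move=> []; move=> [x y] [] /=; rewrite !in_itv/= => /andP[x1 x2] /andP[y1 y2].
    by apply: dU; split; [exact: (close_box x1 x2 q11 q12)|exact: (close_box y1 y2 q21 q22)].
  by split; rewrite /= in_itv/= in_box.
apply: countable_bigcupT_measurable => [|k]; first exact: countableP.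
by case: asboolP.
Qed.

End PlaneMeasure.

(** * Real integrals over the plane *)

Section PlaneIntegral.
Context {R : realType}.
Implicit Types u v g : R * R -> R.

Definition pmeas u : Prop :=
  measurable_fun [set: measurableTypeR R * measurableTypeR R] u.

Definition pint u : R := Rintegral (@area R) setT u.

Definition pable u : Prop := (@area R).-integrable setT (EFin \o u).

Definition sq (p : R * R) : R := p.1 ^+ 2 + p.2 ^+ 2.

Lemma sq_ge0 p : 0 <= sq p. Proof. by rewrite addr_ge0 ?sqr_ge0. Qed.

Lemma pmeasD u v : pmeas u -> pmeas v -> pmeas (fun p => u p + v p).
Proof. exact: measurable_funD. Qed.

Lemma pmeasB u v : pmeas u -> pmeas v -> pmeas (fun p => u p - v p).
Proof. exact: measurable_funB. Qed.

Lemma pmeasM u v : pmeas u -> pmeas v -> pmeas (fun p => u p * v p).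
Proof. exact: measurable_funM. Qed.

Lemma pmeas_cst c : pmeas (fun=> c). Proof. exact: measurable_cst. Qed.

Lemma pmeas_fst : pmeas fst.
Proof. exact: (@measurable_fst _ _ (measurableTypeR R) (measurableTypeR R)). Qed.

Lemma pmeas_snd : pmeas snd.
Proof. exact: (@measurable_snd _ _ (measurableTypeR R) (measurableTypeR R)). Qed.

Lemma pmeas_comp (h : R -> R) u : measurable_fun setT h -> pmeas u ->
  pmeas (fun p => h (u p)).
Proof. by move=> mh mu; exact: measurableT_comp. Qed.

Lemma pmeas_compc (h : R -> R) u : continuous h -> pmeas u ->
  pmeas (fun p => h (u p)).
Proof. by move=> ch; apply: pmeas_comp; exact: continuous_measurable_fun. Qed.

Lemma pmeasX n u : pmeas u -> pmeas (fun p => u p ^+ n).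
Proof. exact: measurable_funX. Qed.

(** The inverse is assembled from [expR] and [ln], which are measurable on the whole line; the
    factor u p makes the formula true at zeros of u as well, where the inverse is 0 by
    convention. *)
Lemma pmeasV u : pmeas u -> pmeas (fun p => (u p)^-1).
Proof.
move=> mu; suff -> : (fun p => (u p)^-1) = fun p => u p * expR (- ln (u p ^+ 2)).
  apply: pmeasM => //; apply: (pmeas_comp (h := fun x => expR (- ln x))).
    apply: measurableT_comp; first exact: measurable_expR.
    by apply: measurable_funN; exact: measurable_ln.
  exact: pmeasX.
apply/funext => p; have [->|u0] := eqVneq (u p) 0; first by rewrite invr0 mul0r.
by rewrite expRN lnK ?posrE ?exprn_even_gt0// expr2 invfM mulrA divff// mul1r.
Qed.

Lemma pmeas_sq : pmeas sq.
Proof.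
by apply: pmeasD; apply: pmeasX; [exact: pmeas_fst|exact: pmeas_snd].
Qed.

Lemma pable_pmeas u : pable u -> pmeas u.
Proof. by move=> /integrableP[/measurable_EFinP]. Qed.

Lemma pableD u v : pable u -> pable v -> pable (fun p => u p + v p).
Proof. by move=> iu iv; apply: eq_integrable (integrableD _ iu iv). Qed.

Lemma pableB u v : pable u -> pable v -> pable (fun p => u p - v p).
Proof. by move=> iu iv; apply: eq_integrable (integrableB _ iu iv). Qed.

Lemma pableZ c u : pable u -> pable (fun p => c * u p).
Proof. by move=> iu; apply: eq_integrable (integrableZl _ c iu). Qed.

Lemma pintD u v : pable u -> pable v ->
  pint (fun p => u p + v p) = pint u + pint v.
Proof. exact: RintegralD. Qed.

Lemma pintB u v : pable u -> pable v ->
  pint (fun p => u p - v p) = pint u - pint v.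
Proof. exact: RintegralB. Qed.

Lemma pintZ c u : pable u -> pint (fun p => c * u p) = c * pint u.
Proof. by move=> iu; apply: RintegralZl. Qed.

Lemma eq_pint u v : u =1 v -> pint u = pint v.
Proof. by move=> uv; congr pint; exact/funext. Qed.

Lemma eq_pable u v : u =1 v -> pable u -> pable v.
Proof. by move=> uv; suff -> : u = v by []; exact/funext. Qed.

Lemma pint_ge0 u : (forall p, 0 <= u p) -> 0 <= pint u.
Proof. by move=> u0; apply: Rintegral_ge0 => p _. Qed.

Lemma le_pint u v : pable u -> pable v -> (forall p, u p <= v p) ->
  pint u <= pint v.
Proof. by move=> iu iv uv; apply: le_Rintegral => // p _. Qed.

Lemma le_pable u v : pmeas u -> (forall p, `|u p| <= v p) -> pable v ->
  pable u.
Proof.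
move=> mu uv; apply: le_integrable => //; first exact/measurable_EFinP.
by move=> p _; rewrite /= lee_fin (le_trans (uv p))// ler_norm.
Qed.

Lemma pable0 : pable (fun=> 0).
Proof. exact: integrable0. Qed.

Lemma pint0 : pint (fun=> 0) = 0.
Proof. by rewrite /pint /Rintegral integral0. Qed.

Lemma pintE u : pable u -> (\int[@area R]_p (u p)%:E)%E = (pint u)%:E.
Proof. by move=> iu; rewrite /pint /Rintegral fineK//; apply: integrable_fin_num. Qed.

Lemma pable_ge0P u : pmeas u -> (forall p, 0 <= u p) ->
  pable u <-> (\int[@area R]_p (u p)%:E < +oo)%E.
Proof.
move=> mu u0; split=> [/integrableP[_]|h].
  by under eq_integral do rewrite /= ger0_norm//.
apply/integrableP; split; first exact/measurable_EFinP.
by under eq_integral do rewrite /= ger0_norm//.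
Qed.

Lemma pable_sum (I : Type) (s : seq I) (F : I -> R * R -> R) :
  (forall i, pable (F i)) -> pable (fun p => \sum_(i <- s) F i p).
Proof.
move=> iF; elim: s => [|i s ih].
  by apply: eq_pable pable0 => p; rewrite big_nil.
by apply: eq_pable (pableD (iF i) ih) => p; rewrite big_cons.
Qed.

Lemma pint_sum (I : Type) (s : seq I) (F : I -> R * R -> R) :
  (forall i, pable (F i)) ->
  pint (fun p => \sum_(i <- s) F i p) = \sum_(i <- s) pint (F i).
Proof.
move=> iF; elim: s => [|i s ih].
  by rewrite big_nil -[RHS]pint0; apply: eq_pint => p; rewrite big_nil.
rewrite big_cons -ih -pintD//; last exact: pable_sum.
by apply: eq_pint => p; rewrite big_cons.
Qed.

Lemma pint_dct (u_ : nat -> R * R -> R) u g : (forall n, pmeas (u_ n)) ->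
  (forall p, u_ ^~ p @ \oo --> u p) -> (forall n p, `|u_ n p| <= g p) ->
  pable g -> pable u /\ pint \o u_ @ \oo --> pint u.
Proof.
move=> mu_ cu ug ig.
have mu : pmeas u by apply: (measurable_fun_cvg mu_) => p _; exact: cu.
have h n := le_pable (mu_ n) (ug n) ig.
have m1 n : measurable_fun setT (EFin \o u_ n).
  by apply/measurable_EFinP; exact: mu_.
have m2 : measurable_fun setT (EFin \o u) by exact/measurable_EFinP.
have c1 : {ae @area R, forall p, setT p -> (EFin \o u_ n) p @[n --> \oo] --> (EFin \o u) p}.
  by apply: aeW => p _; apply/fine_cvgP; split; [exact: nearW|exact: cu].
have c2 : {ae @area R, forall p n, setT p -> (`|(EFin \o u_ n) p| <= (EFin \o g) p)%E}.
  by apply: aeW => p n _ /=; rewrite lee_fin.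
have [iu _ cv] :=
  @dominated_convergence _ _ R (@area R) setT measurableT _ _ _ m1 m2 c1 ig c2.
have e : (\int[@area R]_(x in setT) (EFin \o u) x)%E = (pint u)%:E by exact: pintE.
split => //; move: cv; rewrite {}e => /fine_cvgP[_].
exact.
Qed.

(** Since (1 + s)^2 is at least (1 + x^2) (1 + y^2), a product of two arctangent densities
    dominates, and its integral is finite by Tonelli's theorem. *)
Lemma pable_dominating : pable (fun p => ((1 + sq p) ^+ 2)^-1).
Proof.
pose k (x : R) := (oneDsqr x)^-1.
have ck : continuous k by exact: continuous_oneDsqrV.
have k0 x : 0 <= k x by rewrite invr_ge0 (le_trans ler01) ?oneDsqr_ge1.
have mk : pmeas (fun p => k p.1 * k p.2).
  by apply: pmeasM; apply: pmeas_compc => //; [exact: pmeas_fst|exact: pmeas_snd].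
have ik : (\int[@lebesgue_measure R]_x (k x)%:E = pi%:E)%E.
  rewrite ge0_symfun_integralT//; last by move=> x; rewrite /= /k /oneDsqr sqrrN.
  rewrite (_ : [set x | _] = `[0, +oo[%classic); last first.
    by apply/seteqP; split => x/=; rewrite in_itv/= andbT.
  by rewrite integral0y_oneDsqr -EFinM mulrCA divff// mulr1.
have ikk : pable (fun p => k p.1 * k p.2).
  have mk' : measurable_fun setT (EFin \o (fun p : R * R => k p.1 * k p.2)).
    exact/measurable_EFinP.
  have := @integrable12ltyP _ _ _ _ R (@lebesgue_measure R) (@lebesgue_measure R) _ mk'.
  rewrite /pable -/(@area R) => -[_]; apply.
  have mk1 : measurable_fun setT (EFin \o k).
    by apply/measurable_EFinP; exact: continuous_measurable_fun.
  rewrite (_ : (fun x => _) = fun x => (pi * k x)%:E); last first.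
    apply/funext => x; rewrite /= (_ : (fun y => _) = fun y => (k x)%:E * (k y)%:E)%E.
      rewrite ge0_integralZl ?lee_fin//; last by move=> y _; rewrite lee_fin.
      by transitivity ((k x)%:E * pi%:E)%E; [congr (_ * _)%E; exact: ik|rewrite -EFinM mulrC].
    by apply/funext => y; rewrite /= ger0_norm ?mulr_ge0.
  under eq_integral do rewrite EFinM.
  rewrite ge0_integralZl ?lee_fin ?pi_ge0//; last by move=> y _; rewrite lee_fin.
  by rewrite ik -EFinM ltry.
apply: le_pable ikk => [|p]; last first.
  have := sq_ge0 p; have := sqr_ge0 p.1; have := sqr_ge0 p.2 => h2 h1 h.
  rewrite ger0_norm ?invr_ge0 ?sqr_ge0// /k -invfM lef_pV2.
  - rewrite /oneDsqr /sq; nra.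
  - by rewrite posrE exprn_gt0// ltr_pwDl.
  - by rewrite posrE mulr_gt0// ltr_pwDl.
apply: pmeasV; apply: pmeasX; apply: pmeasD; [exact: pmeas_cst|exact: pmeas_sq].
Qed.

Lemma pable_dom u (C : R) : pmeas u ->
  (forall p, `|u p| <= C * ((1 + sq p) ^+ 2)^-1) -> pable u.
Proof. by move=> mu uC; apply: le_pable mu uC _; exact/pableZ/pable_dominating. Qed.

Lemma pable_csupp u (M r : R) : pmeas u -> (forall p, `|u p| <= M) ->
  (forall p, r <= sq p -> u p = 0) -> pable u.
Proof.
move=> mu uM ur; apply: (@pable_dom _ (M * (1 + Num.max 0 r) ^+ 2)) => // p.
have M0 : 0 <= M by apply: le_trans (uM p); exact: normr_ge0.
have [/ur ->|pr] := leP r (sq p).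
  rewrite normr0; apply: mulr_ge0; last by rewrite invr_ge0 sqr_ge0.
  by apply: mulr_ge0 => //; exact: sqr_ge0.
have p0 := sq_ge0 p.
have d0 : 0 < (1 + sq p) ^+ 2 by rewrite exprn_gt0// ltr_pwDl.
rewrite ler_pdivlMr//; apply: ler_pM => //; first exact: ltW.
have m0 : sq p <= Num.max 0 r by rewrite le_max (ltW pr) orbT.
by apply: lerXn2r; rewrite ?nnegrE; lra.
Qed.

(** By continuity u exceeds u p / 2 on a square around p, which has positive area. *)
Lemma pint_gt0 u (p : R * R) : pable u -> (forall q, 0 <= u q) -> {for p, continuous u} ->
  0 < u p -> 0 < pint u.
Proof.
move=> iu u0 /continuous2P cu up0.
have [d d0 dP] := cu _ (divr_gt0 up0 (ltr0Sn _ 1)).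
pose B : set (measurableTypeR R * measurableTypeR R) :=
  `](p.1 - d), (p.1 + d)[ `*` `](p.2 - d), (p.2 + d)[.
have mB : measurable B by apply: measurableX; exact: measurable_itv.
have l (x : R) : @lebesgue_measure R `](x - d), (x + d)[ = (d *+ 2)%:E.
  rewrite lebesgue_measure_itv/= lte_fin ifT; last by lra.
  by rewrite -EFinB; congr (_%:E); ring.
have aB : @area R B = ((d *+ 2)%:E * (d *+ 2)%:E)%E.
  rewrite /area /= product_measure1E; [|exact: measurable_itv|exact: measurable_itv].
  by apply: (f_equal2 mule); exact: l.
rewrite -lte_fin -pintE//.
apply: (@lt_le_trans _ _ (\int[@area R]_(q in B) (u p / 2)%:E)%E).
  rewrite integral_cst//; apply: mule_gt0; first by rewrite lte_fin divr_gt0.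
  by rewrite [X in (_ < X)%E]aB; apply: mule_gt0; rewrite lte_fin mulrn_wgt0.
rewrite integral_mkcond; apply: ge0_le_integral => //.
- move=> q _; rewrite /patch; case: ifP => // _; rewrite lee_fin; lra.
- apply/(measurable_restrict _ _) => //; exact: measurable_cst.
- by apply/measurable_EFinP; exact: pable_pmeas.
move=> q _; rewrite /patch; case: ifPn => [|_]; last by rewrite lee_fin.
rewrite inE => -[/=]; rewrite !in_itv/= => /andP[a b] /andP[a' b'].
have := dP q.1 q.2; rewrite !ltr_distl a b a' b' => /(_ erefl erefl) /andP[h _].
by rewrite lee_fin (surjective_pairing q); lra.
Qed.

End PlaneIntegral.

(** * Bisection of a square *)

Section Bisection.
Context {R : realType}.
Implicit Types (W : R -> R -> R).

(** The mixed second difference is an additive function of rectangles. For W = U2 - U1, with U1 a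
    primitive of A in x and U2 a primitive of B in y, it is the integral of A dx + B dy along the
    boundary. *)
Definition diff2 W x y hx hy :=
  W (x + hx) (y + hy) - W (x + hx) y - W x (y + hy) + W x y.

Variable W : R -> R -> R.

Let size (k : nat) : R := 2^-1 ^+ k.

Let d2 p k := diff2 W p.1 p.2 (size k) (size k).

(** Three quarters are tested for carrying at least a fourth of the second difference; if they all
    fail, additivity leaves the last one. *)
Let quarter (p : R * R) k : R * R :=
  let h := size k.+1 in
  let good q := `|d2 p k| <= 4 * `|d2 q k.+1| in
  if good p then p else
  if good (p.1 + h, p.2) then (p.1 + h, p.2) else
  if good (p.1, p.2 + h) then (p.1, p.2 + h) else (p.1 + h, p.2 + h).

Let sizeS k : size k.+1 *+ 2 = size k.
Proof. by rewrite /size exprS -mulrnAl -mulr_natr mulVf// mul1r. Qed.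

Let quarterP p k : `|d2 p k| <= 4 * `|d2 (quarter p k) k.+1|.
Proof.
rewrite /quarter; set h := size k.+1; case: ifPn => // /negP.
case: ifPn => // /negP; case: ifPn => // /negP.
move=> /negP; rewrite -ltNge => c1 /negP; rewrite -ltNge => c2 /negP.
rewrite -ltNge => c3; rewrite leNgt; apply/negP => c4.
have : d2 p k = d2 p k.+1 + d2 (p.1 + h, p.2) k.+1 + d2 (p.1, p.2 + h) k.+1 +
    d2 (p.1 + h, p.2 + h) k.+1.
  rewrite /d2 -(sizeS k) -/h /diff2 /= mulr2n !addrA; ring.
move=> e; have : `|d2 p k| <= `|d2 p k.+1| + `|d2 (p.1 + h, p.2) k.+1| +
    `|d2 (p.1, p.2 + h) k.+1| + `|d2 (p.1 + h, p.2 + h) k.+1|.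
  by rewrite e !(le_trans (ler_normD _ _))// !lerD2r !(le_trans (ler_normD _ _))// lerD2r ler_normD.
by move: c1 c2 c3 c4; rewrite -/h; lra.
Qed.

Let quarter1 p k : p.1 <= (quarter p k).1 /\
  (quarter p k).1 + size k.+1 <= p.1 + size k.
Proof.
have h0 : 0 < size k.+1 by rewrite exprn_gt0// invr_gt0.
have := sizeS k; rewrite /quarter mulr2n; set h := size k.+1.
by move=> <-; do 3 ?[case: ifPn => _] => /=; split; rewrite -/h in h0; lra.
Qed.

Let quarter2 p k : p.2 <= (quarter p k).2 /\
  (quarter p k).2 + size k.+1 <= p.2 + size k.
Proof.
have h0 : 0 < size k.+1 by rewrite exprn_gt0// invr_gt0.
have := sizeS k; rewrite /quarter mulr2n; set h := size k.+1.
by move=> <-; do 3 ?[case: ifPn => _] => /=; split; rewrite -/h in h0; lra.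
Qed.

Fixpoint corner k : R * R := if k is k'.+1 then quarter (corner k') k' else (0, 0).

Let nested_point (a : nat -> R) : a 0%N = 0 ->
  (forall k, a k <= a k.+1 /\ a k.+1 + size k.+1 <= a k + size k) ->
  exists x, forall k, [/\ 0 <= a k, a k <= x, x <= a k + size k & a k + size k <= 1].
Proof.
move=> a0 ak.
have s0 k : 0 <= size k by rewrite exprn_ge0// invr_ge0.
have nd : nondecreasing_seq a by apply/nondecreasing_seqP => k; case: (ak k).
have ni : nonincreasing_seq (fun k => a k + size k).
  by apply/nonincreasing_seqP => k; case: (ak k).
have ub m k : a m <= a k + size k.
  have [mk|/ltnW km] := leqP m k; first by rewrite (le_trans (nd _ _ mk))// lerDl.
  by apply: le_trans (ni _ _ km); rewrite lerDl.
exists (sup (range a)) => k; split.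
- by rewrite -a0; exact: nd.
- by apply: ub_le_sup; [exists (a 0%N + size 0) => _ [m _ <-]|exists k].
- by apply: ge_sup; [exists (a 0%N), 0%N|move=> _ [m _ <-]].
- by apply: (le_trans (ni _ _ (leq0n k))); rewrite a0 add0r /size expr0.
Qed.

(** The hypothesis says that the second difference is o(h^2) on squares shrinking to a point.
    Repeated quartering would keep it at least a fixed multiple of the area near a common point of
    the nested squares. *)
Lemma bisection :
  (forall x y : R, 0 <= x <= 1 -> 0 <= y <= 1 -> forall e : R, 0 < e ->
    exists2 d : R, 0 < d & forall a b h : R, 0 < h < d -> 0 <= a -> a + h <= 1 ->
      0 <= b -> b + h <= 1 -> a <= x <= a + h -> b <= y <= b + h ->
      `|diff2 W a b h h| <= e * h ^+ 2) ->
  diff2 W 0 0 1 1 = 0.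
Proof.
move=> H; apply/eqP; rewrite -normr_le0 leNgt; apply/negP.
set eta := `| _ | => eta0.
have [|x xP] := @nested_point (fun k => (corner k).1) erefl.
  by move=> k; exact: quarter1.
have [|y yP] := @nested_point (fun k => (corner k).2) erefl.
  by move=> k; exact: quarter2.
have big k : eta <= 4 ^+ k * `|d2 (corner k) k|.
  elim: k => [|k /le_trans]; first by rewrite mul1r /d2 /size expr0.
  apply; rewrite exprSr -mulrA ler_pM2l ?exprn_gt0//.
have [x0 x1 x2 x3] := xP 0%N; have [y0 y1 y2 y3] := yP 0%N.
(* Any tolerance below eta works: the k-th square carries at least eta / 4^k, which is eta times its
   area. *)
have [||d d0 dP] := H x y _ _ (eta / 2) (divr_gt0 eta0 (ltr0Sn _ 1)).
- by apply/andP; split; [exact: le_trans x1|exact: le_trans x3].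
- by apply/andP; split; [exact: le_trans y1|exact: le_trans y3].
have s0 k : 0 < size k by rewrite exprn_gt0// invr_gt0.
have [k kd] : exists k, size k < d.
  have : size @ \oo --> (0 : R) by apply: cvg_expr; rewrite ger0_norm ?invr_ge0// invf_lt1// ltr1n.
  move=> /cvgrPdist_lt/(_ _ d0)[k _ /(_ k (leqnn _))]; rewrite sub0r normrN ger0_norm; last exact: ltW.
  by exists k.
have [? ? ? ?] := xP k; have [? ? ? ?] := yP k.
have := dP (corner k).1 (corner k).2 (size k).
rewrite s0 kd => /(_ erefl) h.
have {h} : `|d2 (corner k) k| <= eta / 2 * size k ^+ 2.
  by apply: h => //; apply/andP; split.
rewrite leNgt => /negP; apply.
have f4 : 4 ^+ k * size k ^+ 2 = 1.
  by rewrite /size -exprM mulnC exprM -exprMn expr2 (_ : 4 * _ = 1) ?expr1n//; field.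
rewrite -(ltr_pM2l (x := 4 ^+ k)) ?exprn_gt0// mulrCA f4 mulr1.
by apply: lt_le_trans (big k); lra.
Qed.

End Bisection.

(** * Goursat's theorem for closed forms *)

Section Goursat.
Context {R : realType}.

(** The step may have either sign, because rectangles are later spanned by signed side lengths. *)
Lemma mvt_step (f df : R -> R) (a h : R) :
  (forall x : R, is_derive x (1 : R) f (df x)) ->
  exists2 c, `|c - a| <= `|h| & f (a + h) - f a = df c * h.
Proof.
move=> fd; have cf : continuous f.
  by move=> x; apply/differentiable_continuous/derivable1_diffP; case: (fd x).
have [h0|h0|h0] := ltgtP 0 h.
- have := @MVT R f df a (a + h) _ (fun x _ => fd x) (continuous_subspaceT cf); case; first by lra. move=> c.
  rewrite in_itv/= => /andP[c1 c2] e; exists c.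
    by rewrite ger0_norm ?(gtr0_norm h0)//; lra.
  by rewrite e; ring.
- have := @MVT R f df (a + h) a _ (fun x _ => fd x) (continuous_subspaceT cf); case; first by lra. move=> c.
  rewrite in_itv/= => /andP[c1 c2] e; exists c.
    by rewrite ler0_norm ?(ltr0_norm h0)//; lra.
  by rewrite -opprB e; ring.
- by exists a; rewrite -h0 ?subrr ?normr0// addr0 subrr mulr0.
Qed.

Variables (U1 U2 A B : R -> R -> R).
Hypothesis U1A : forall x y : R, is_derive x (1 : R) (fun t => U1 t y) (A x y).
Hypothesis U2B : forall x y : R, is_derive y (1 : R) (U2 x) (B x y).

Lemma diff2_mvt1 x y hx hy : exists2 c, `|c - x| <= `|hx| &
  diff2 U1 x y hx hy = (A c (y + hy) - A c y) * hx.
Proof.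
have [c cx e] := @mvt_step (fun t => U1 t (y + hy) - U1 t y)
  (fun t => A t (y + hy) - A t y) x hx (fun t => is_deriveB (U1A t _) (U1A t _)).
by exists c => //; rewrite -e /diff2; ring.
Qed.

Lemma diff2_mvt2 x y hx hy : exists2 c, `|c - y| <= `|hy| &
  diff2 U2 x y hx hy = (B (x + hx) c - B x c) * hy.
Proof.
have [c cx e] := @mvt_step (fun t => U2 (x + hx) t - U2 x t)
  (fun t => B (x + hx) t - B x t) y hy (fun t => is_deriveB (U2B _ t) (U2B _ t)).
by exists c => //; rewrite -e /diff2; ring.
Qed.

(* The 1-form A dx + B dy is differentiable and closed at (x, y). *)
Definition closed_at (x y : R) := exists al be de : R,
  forall e : R, 0 < e -> exists2 d : R, 0 < d & forall s t : R, `|s| < d -> `|t| < d ->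
    `|A (x + s) (y + t) - A x y - al * s - be * t| <= e * (`|s| + `|t|) /\
    `|B (x + s) (y + t) - B x y - be * s - de * t| <= e * (`|s| + `|t|).

(** Increments at a fixed first, respectively second, coordinate eliminate the coefficients al and
    de. The common coefficient be of A in y and of B in x is what closedness means, and it makes the
    leading terms cancel in [goursat]. *)
Lemma closed_at_increment x y : closed_at x y -> exists be : R,
  forall e : R, 0 < e -> exists2 d : R, 0 < d &
    forall r u u' v v' : R, r < d -> `|u - x| <= r -> `|u' - x| <= r ->
      `|v - y| <= r -> `|v' - y| <= r ->
    `|A u v - A u v' - be * (v - v')| <= e * r /\
    `|B u v - B u' v - be * (u - u')| <= e * r.
Proof.
move=> [al [be [de H]]]; exists be => e e0.
(* Each increment is a difference of two expansions, and each expansion has an error of at most e /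
   4 times 2 r. *)
have e4 : 0 < e / 4 by lra.
have [d d0 dP] := H _ e4; exists d => // r u u' v v' rd hu hu' hv hv'.
have k s t : `|s - x| <= r -> `|t - y| <= r ->
   `|A s t - A x y - al * (s - x) - be * (t - y)| <= e * r / 2 /\
   `|B s t - B x y - be * (s - x) - de * (t - y)| <= e * r / 2.
  move=> hs ht; have := dP _ _ (le_lt_trans hs rd) (le_lt_trans ht rd).
  rewrite !(addrC _ (_ - _)) !subrK => -[k1 k2].
  have b : e / 4 * (`|s - x| + `|t - y|) <= e * r / 2.
    by rewrite (_ : e * r / 2 = e / 4 * (r + r)); [rewrite ler_pM2l// lerD|field].
  by split; [exact: le_trans k1 b|exact: le_trans k2 b].
have [a1 _] := k u v hu hv; have [a2 _] := k u v' hu hv'.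
have [_ b1] := k u v hu hv; have [_ b2] := k u' v hu' hv.
split.
  have := le_trans (ler_normB _ _) (lerD a1 a2); rewrite -splitr.
  by congr (`|_| <= _); ring.
have := le_trans (ler_normB _ _) (lerD b1 b2); rewrite -splitr.
by congr (`|_| <= _); ring.
Qed.

(** The rectangle is parametrised by the unit square, so that [bisection] applies to squares even
    when the sides have different lengths or negative signs. *)
Lemma goursat x0 y0 lx ly :
  (forall s t : R, 0 <= s <= 1 -> 0 <= t <= 1 -> closed_at (x0 + s * lx) (y0 + t * ly)) ->
  diff2 (fun x y => U2 x y - U1 x y) x0 y0 lx ly = 0.
Proof.
move=> cl; pose W s t := U2 (x0 + s * lx) (y0 + t * ly) - U1 (x0 + s * lx) (y0 + t * ly).
suff : diff2 W 0 0 1 1 = 0 by rewrite /diff2 /W !mul0r !addr0 !add0r !mul1r.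
apply: bisection => s t s01 t01 e e0.
have [be H] := closed_at_increment (cl _ _ s01 t01).
pose L := `|lx| + `|ly| + 1.
have L0 : 0 < L by rewrite ltr_wpDl ?addr_ge0.
(* Two products arise, each an increment error at scale 2 h L times a side of at most h L; with this
   tolerance each is at most e h^2 / 2. *)
have [d d0 dP] := H (e / (4 * L ^+ 2)) (divr_gt0 e0 (mulr_gt0 (ltr0Sn _ 3) (exprn_gt0 2 L0))).
exists (d / (2 * L)) => [|a b h /andP[h0 hd] _ _ _ _ /andP[as1 as2] /andP[bt1 bt2]].
  by rewrite divr_gt0// mulr_gt0.
have hL : h * (2 * L) < d by rewrite -ltr_pdivlMr// mulr_gt0.
have -> : diff2 W a b h h = diff2 U2 (x0 + a * lx) (y0 + b * ly) (h * lx) (h * ly)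
   - diff2 U1 (x0 + a * lx) (y0 + b * ly) (h * lx) (h * ly).
  by rewrite /diff2 /W !mulrDl !addrA; ring.
have [c cx ->] := diff2_mvt1 (x0 + a * lx) (y0 + b * ly) (h * lx) (h * ly).
have [c' cy ->] := diff2_mvt2 (x0 + a * lx) (y0 + b * ly) (h * lx) (h * ly).
have near (p q l m : R) : `|l| <= L -> q <= p <= q + h -> `|m| <= h * `|l| ->
    `|m + (q - p) * l| <= h * (2 * L).
  move=> lL /andP[qp pq] ml.
  have qp' : `|q - p| <= h by rewrite ler_norml; apply/andP; split; lra.
  rewrite (le_trans (ler_normD _ _))// (_ : h * (2 * L) = h * L + h * L); last by ring.
  apply: lerD; first by rewrite (le_trans ml)// ler_pM2l.
  by rewrite normrM ler_pM.
have lxL : `|lx| <= L by rewrite /L -addrA lerDl addr_ge0.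
have lyL : `|ly| <= L by rewrite /L addrAC lerDr addr_ge0.
have near0 (p q l : R) : `|l| <= L -> q <= p <= q + h -> `|(q - p) * l| <= h * (2 * L).
  by move=> lL qp; rewrite -[_ * _]add0r near// normr0 mulr_ge0// ltW.
have nh (l : R) : `|h * l| <= h * `|l| by rewrite normrM gtr0_norm.
have [||||a1 _] := dP _ c (x0 + a * lx) (y0 + b * ly + h * ly) (y0 + b * ly) hL.
- rewrite (_ : _ - _ = c - (x0 + a * lx) + (a - s) * lx); last by ring.
  by apply: near => //; [exact/andP|exact: le_trans cx (nh _)].
- by rewrite (_ : _ - _ = (a - s) * lx); [apply: near0 => //; exact/andP|ring].
- rewrite (_ : _ - _ = h * ly + (b - t) * ly); last by ring.
  by apply: near => //; exact/andP.
- by rewrite (_ : _ - _ = (b - t) * ly); [apply: near0 => //; exact/andP|ring].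
have [||||_ b1] := dP _ (x0 + a * lx + h * lx) (x0 + a * lx) c' c' hL.
- rewrite (_ : _ - _ = h * lx + (a - s) * lx); last by ring.
  by apply: near => //; exact/andP.
- by rewrite (_ : _ - _ = (a - s) * lx); [apply: near0 => //; exact/andP|ring].
- rewrite (_ : _ - _ = c' - (y0 + b * ly) + (b - t) * ly); last by ring.
  by apply: near => //; [exact/andP|exact: le_trans cy (nh _)].
- rewrite (_ : _ - _ = c' - (y0 + b * ly) + (b - t) * ly); last by ring.
  by apply: near => //; [exact/andP|exact: le_trans cy (nh _)].
move: a1 b1; set a1 := (X in `|X|) => a1E; set b1 := (X in `|X|) => b1E.
(* The contributions be (h lx) (h ly) of the two increments cancel here. *)
rewrite [X in `|X|](_ : _ = b1 * (h * ly) - a1 * (h * lx)); last by rewrite /a1 /b1; ring.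
have E0 : e / (4 * L ^+ 2) * (h * (2 * L)) * (h * L) + e / (4 * L ^+ 2) * (h * (2 * L)) * (h * L)
   = e * h ^+ 2 by field; rewrite gt_eqF.
rewrite -E0 (le_trans (ler_normB _ _))// !normrM (gtr0_norm h0).
by apply: lerD; apply: ler_pM => //; rewrite ?mulr_ge0 ?(ltW h0)// ler_pM2l.
Qed.

End Goursat.

(** * Primitives of continuous functions *)

Section Primitive.
Context {R : realType}.
Implicit Types (f : R -> R).

Definition antideriv f (x : R) : R :=
  if 0 <= x then Rintegral (@lebesgue_measure R) `]0, x] f
  else - Rintegral (@lebesgue_measure R) `]x, 0] f.

(** Near x the signed integral from 0 differs by a constant from the integral from -N, a fixed left
    end point lying to the left of both 0 and x; the fundamental theorem is applied to the
    latter. *)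
Lemma is_derive_antideriv f (x : R) : continuous f ->
  is_derive x (1 : R) (antideriv f) (f x).
Proof.
move=> cf; pose N : R := `|x| + 2.
have xN : `|x| < N - 1 by rewrite /N; lra.
have int (u v : R) : (@lebesgue_measure R).-integrable `[u, v] (EFin \o f).
  by apply: continuous_compact_integrable; [exact: segment_compact|exact: continuous_subspaceT].
pose G (t : R) : R := Rintegral (@lebesgue_measure R) `[- N, t] f.
have loc (t : R) : - N < t -> antideriv f t = G t - G 0.
  move=> tN; rewrite /antideriv /G; case: leP => t0.
    rewrite -(Rintegral_itvB (a := BLeft (- N)) (b := BRight t) (x := 0)) ?bnd_simp//.
    by have := normr_ge0 x; lra.
  rewrite -opprB; congr (- _); rewrite -(Rintegral_itvB (a := BLeft (- N)) (b := BRight 0) (x := t)) ?bnd_simp//.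
    exact: ltW.
  exact: ltW.
have xN' : - N < x by have := ler_norm (- x); rewrite normrN; lra.
have x1 : x < x + 1 by rewrite ltrDl.
have [|dG GE] := @continuous_FTC1 R f (BLeft (- N)) x (x + 1) x1 (int _ _) _ (cf x).
  by rewrite /= lte_fin.
have : is_derive x (1 : R) (fun t => G t - G 0) (f x).
  rewrite -[f x]subr0; apply: is_deriveB.
  exact: (DeriveDef dG (eq_trans (esym (derive1E _ _)) GE)).
apply: near_eq_is_derive; near=> t; rewrite loc//.
near: t; exact: lt_nbhsr.
Unshelve. all: by end_near. Qed.

End Primitive.

Lemma diff2_split {R : realType} (W : R -> R -> R) x y h1 h2 k1 k2 :
  diff2 W x y (h1 + h2) (k1 + k2) = diff2 W x y h1 k1 +
    diff2 W (x + h1) y h2 (k1 + k2) + diff2 W x (y + k1) h1 k2.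
Proof. by rewrite /diff2 !addrA; ring. Qed.

(** * Forms that are continuous everywhere and closed off one point *)

Section PuncturedPrimitive.
Context {R : realType}.
Variables (A B : R -> R -> R) (a1 a2 : R).
Hypothesis cA : continuous (fun p : R * R => A p.1 p.2).
Hypothesis cB : continuous (fun p : R * R => B p.1 p.2).
Hypothesis AB : forall x y, (x != a1) || (y != a2) -> closed_at A B x y.

Lemma continuous_slice1 (u : R * R -> R) y : continuous u ->
  continuous (fun x => u (x, y)).
Proof.
move=> cu x; apply/cvgrPdist_lt => e e0.
have [d d0 dP] := (iffLR (continuous2P u (x, y)) (@cu (x, y))) e e0.
apply/nbhs_ballP; exists d => // t xt; rewrite distrC; apply: dP => /=.
  by rewrite distrC.
by rewrite subrr normr0.
Qed.

Lemma continuous_slice2 (u : R * R -> R) x : continuous u ->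
  continuous (fun y => u (x, y)).
Proof.
move=> cu y; apply/cvgrPdist_lt => e e0.
have [d d0 dP] := (iffLR (continuous2P u (x, y)) (@cu (x, y))) e e0.
apply/nbhs_ballP; exists d => // t xt; rewrite distrC; apply: dP => /=.
  by rewrite subrr normr0.
by rewrite distrC.
Qed.

Let U1 x y := antideriv (fun t => A t y) x.
Let U2 x := antideriv (B x).
Let W x y := U2 x y - U1 x y.

Let U1A (x y : R) : is_derive x (1 : R) (fun t => U1 t y) (A x y).
Proof.
by apply: (is_derive_antideriv (f := fun t => A t y)); exact: (continuous_slice1 (y := y) cA).
Qed.

Let U2B (x y : R) : is_derive y (1 : R) (U2 x) (B x y).
Proof.
by apply: (is_derive_antideriv (f := B x)); exact: (continuous_slice2 (x := x) cB).
Qed.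

(** A rectangle with a corner at the exceptional point may be shrunk towards it: the two pieces cut
    off avoid that point, so Goursat's theorem applies to them. *)
Let corner_eq lx ly th : 0 < th < 1 -> lx != 0 -> ly != 0 ->
  diff2 W a1 a2 lx ly = diff2 W a1 a2 (th * lx) (th * ly).
Proof.
move=> /andP[th0 th1] lx0 ly0.
have nz (s : R) : 0 <= s <= 1 -> th + s * (1 - th) != 0.
  move=> /andP[s0 s1]; rewrite gt_eqF// ltr_pwDl// mulr_ge0// subr_ge0 ltW//.
have g1 : diff2 W (a1 + th * lx) a2 ((1 - th) * lx) ly = 0.
  apply: (goursat U1A U2B) => s t s01 t01; apply: AB; apply/orP; left.
  rewrite -subr_eq0 (_ : _ - _ = (th + s * (1 - th)) * lx); last by ring.
  by rewrite mulf_neq0// nz.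
have g2 : diff2 W a1 (a2 + th * ly) (th * lx) ((1 - th) * ly) = 0.
  apply: (goursat U1A U2B) => s t s01 t01; apply: AB; apply/orP; right.
  rewrite -subr_eq0 (_ : _ - _ = (th + t * (1 - th)) * ly); last by ring.
  by rewrite mulf_neq0// nz.
rewrite {1}(_ : lx = th * lx + (1 - th) * lx); last by ring.
rewrite {1}(_ : ly = th * ly + (1 - th) * ly); last by ring.
rewrite diff2_split g2 addr0 (_ : th * ly + _ = ly) ?g1 ?addr0//; ring.
Qed.

(** After shrinking by th, continuity of A and B bounds the increments by 2, so the second
    difference is at most 2 th L. Being independent of th, it vanishes. *)
Let corner0 lx ly : diff2 W a1 a2 lx ly = 0.
Proof.
have [->|lx0] := eqVneq lx 0; first by rewrite /diff2 addr0; ring.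
have [->|ly0] := eqVneq ly 0; first by rewrite /diff2 addr0; ring.
have [d d0 dP] := (iffLR (continuous2P _ (a1, a2)) (@cA (a1, a2))) 1 ltr01.
have [d' d'0 dP'] := (iffLR (continuous2P _ (a1, a2)) (@cB (a1, a2))) 1 ltr01.
pose L := `|lx| + `|ly|.
have L0 : 0 < L by rewrite ltr_pwDl ?normr_gt0.
apply/eqP; rewrite -normr_le0 leNgt; apply/negP => e0.
set e := `| _ | in e0.
pose th := Num.min (2^-1) (Num.min (d / 2 / L) (Num.min (d' / 2 / L) (e / 4 / L))).
have th0 : 0 < th by rewrite !lt_min invr_gt0 ltr0n /= !divr_gt0.
have th1 : th < 1 by rewrite (@le_lt_trans _ _ 2^-1) ?ge_min ?lexx// invf_lt1// ltr1n.
have thd : th * L < d.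
  by rewrite (@le_lt_trans _ _ (d / 2))//; [rewrite -ler_pdivlMr// !ge_min lexx/= orbT|lra].
have thd' : th * L < d'.
  by rewrite (@le_lt_trans _ _ (d' / 2))//; [rewrite -ler_pdivlMr// !ge_min lexx/= !orbT|lra].
have the : th * L <= e / 4 by rewrite -ler_pdivlMr// !ge_min lexx/= !orbT.
have : e <= 2 * (th * L).
  rewrite /e (@corner_eq lx ly th) ?th0//.
  have -> : diff2 W a1 a2 (th * lx) (th * ly) = diff2 U2 a1 a2 (th * lx) (th * ly)
     - diff2 U1 a1 a2 (th * lx) (th * ly) by rewrite /diff2 /W; ring.
  have [c cx ->] := diff2_mvt1 U1A a1 a2 (th * lx) (th * ly).
  have [c' cy ->] := diff2_mvt2 U2B a1 a2 (th * lx) (th * ly).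
  have nx : `|th * lx| <= th * L by rewrite normrM gtr0_norm// ler_pM2l// lerDl.
  have ny : `|th * ly| <= th * L by rewrite normrM gtr0_norm// ler_pM2l// lerDr.
  have y1 : `|a2 + th * ly - a2| <= th * L by rewrite addrAC subrr add0r.
  have x1 : `|a1 + th * lx - a1| <= th * L by rewrite addrAC subrr add0r.
  have x0 : `|a1 - a1| <= th * L by rewrite subrr normr0 mulr_ge0// ltW.
  have y0 : `|a2 - a2| <= th * L by rewrite subrr normr0 mulr_ge0// ltW.
  have cx' := le_trans cx nx; have cy' := le_trans cy ny.
  have p1 := dP _ _ (le_lt_trans cx' thd) (le_lt_trans y1 thd).
  have p2 := dP _ _ (le_lt_trans cx' thd) (le_lt_trans y0 thd).
  have p3 := dP' _ _ (le_lt_trans x1 thd') (le_lt_trans cy' thd').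
  have p4 := dP' _ _ (le_lt_trans x0 thd') (le_lt_trans cy' thd').
  have q1 := le_trans (ler_normB _ _) (lerD (ltW p1) (ltW p2)).
  have q2 := le_trans (ler_normB _ _) (lerD (ltW p3) (ltW p4)).
  rewrite /= [X in `|X| <= _](_ : _ = A c (a2 + th * ly) - A c a2) in q1; last by ring.
  rewrite /= [X in `|X| <= _](_ : _ = B (a1 + th * lx) c' - B a1 c') in q2; last by ring.
  apply: le_trans (ler_normB _ _) _; rewrite !normrM.
  rewrite (_ : 2 * (th * L) = (1 + 1) * `|th * ly| + (1 + 1) * `|th * lx|); last first.
    by rewrite !normrM gtr0_norm// /L; ring.
  by rewrite -!normrM; apply: lerD; rewrite normrM ler_wpM2r.
lra.
Qed.

(** Vanishing second differences split W into a function of x plus a function of y. Moving the first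
    to [U2] leaves the y-derivative intact, and the same function is [U1] plus a function of y,
    which gives the x-derivative. *)
Lemma punctured_primitive : exists F : R -> R -> R, forall x y : R,
  is_derive x (1 : R) (fun t => F t y) (A x y) /\ is_derive y (1 : R) (F x) (B x y).
Proof.
pose F x y := U2 x y - (W x a2 - W a1 a2).
have FE x y : F x y = U1 x y + W a1 y.
  have := corner0 (x - a1) (y - a2).
  rewrite /diff2 !subrKC /F => e; apply/eqP; rewrite -subr_eq0 -[X in _ == X]e; apply/eqP.
  by rewrite /W; ring.
exists F => x y; split.
  rewrite (_ : (fun t => F t y) = (fun t => U1 t y + W a1 y)); last first.
    by apply/funext => t.
  by rewrite -[A x y]addr0; apply: is_deriveD.
by rewrite -[B x y]subr0; apply: is_deriveB.
Qed.

End PuncturedPrimitive.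

(** * Euler's identity and rotation invariance *)

Section RotationIdentity.
Context {R : realType}.
Implicit Types u v : R * R -> R.

Lemma cont2M u v : continuous u -> continuous v -> continuous (fun p => u p * v p).
Proof. by move=> cu cv p; apply: cvgM; [exact: cu|exact: cv]. Qed.

Lemma cont2D u v : continuous u -> continuous v -> continuous (fun p => u p + v p).
Proof. by move=> cu cv p; apply: cvgD; [exact: cu|exact: cv]. Qed.

Lemma cont2B u v : continuous u -> continuous v -> continuous (fun p => u p - v p).
Proof. by move=> cu cv p; apply: cvgB; [exact: cu|exact: cv]. Qed.

Lemma cont2c (c : R) : continuous (fun _ : R * R => c).
Proof. by move=> p; exact: cvg_cst. Qed.

Lemma cont2_fst : continuous (fst : R * R -> R).
Proof. by move=> p; exact: cvg_fst. Qed.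

Lemma cont2_snd : continuous (snd : R * R -> R).
Proof. by move=> p; exact: cvg_snd. Qed.

Lemma cont2_comp (h : R -> R) u : continuous h -> continuous u ->
  continuous (fun p => h (u p)).
Proof. by move=> ch cu p; apply: continuous_comp; [exact: cu|exact: ch]. Qed.

Lemma cont2_sq : continuous (@sq R).
Proof.
apply: cont2D; apply: (cont2_comp (h := fun x => x ^+ 2)) => //;
  by [exact: exprn_continuous|exact: cont2_fst|exact: cont2_snd].
Qed.

Lemma bounded_disc u (r : R) : continuous u ->
  exists M : R, forall p, sq p <= r -> `|u p| <= M.
Proof.
move=> cu; pose T : R := 1 + `|r|; pose K : set (R * R) := `[(- T), T] `*` `[(- T), T].
have T0 : 0 <= T by rewrite addr_ge0.
have cK : compact K by apply: compact_setX; exact: segment_compact.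
have K0 : K !=set0 by exists (0, 0); split; rewrite /= in_itv/= oppr_le0 T0.
have [|c _ cP] := @compact_EVT_max _ R (fun p => `|u p|) K K0 cK.
  apply: continuous_subspaceT => p; apply: continuous_comp; first exact: cu.
  exact: norm_continuous.
exists (`|u c|) => p pr; apply: cP; rewrite inE.
have aux (x y : R) : x ^+ 2 + y ^+ 2 <= r -> `|x| <= T.
  move=> h; have := ler_norm r; have := sqr_ge0 y; have : 0 <= `|r| by [].
  rewrite /T -(real_normK (num_real x)) in h *.
  set t := `|x| in h *; set b := `|r|; nra.
split; rewrite /= in_itv/= -ler_norml.
  exact: aux pr.
by apply: (aux _ p.1); rewrite addrC.
Qed.

Lemma pable_cc u (r : R) : continuous u -> (forall p, r <= sq p -> u p = 0) ->
  pable u.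
Proof.
move=> cu ur; have [M MP] := bounded_disc r cu.
apply: (@pable_csupp _ _ (Num.max M 0) r) => //.
  exact: continuous2_measurable.
move=> p; rewrite le_max; have [/ur ->|pr] := leP r (sq p).
  by rewrite normr0 lexx orbT.
by rewrite MP// ltW.
Qed.

Let integral_derivative0 (f f' : R -> R) (r : R) : continuous f' ->
  (forall x : R, is_derive x (1 : R) f (f' x)) ->
  (forall x : R, r <= x ^+ 2 -> f x = 0 /\ f' x = 0) ->
  (\int[@lebesgue_measure R]_x (f' x)%:E = 0)%E.
Proof.
move=> cf' ff' fr; pose T : R := 1 + `|r|.
have T0 : - T < T by rewrite /T; have := normr_ge0 r; lra.
have big (x : R) : T <= `|x| -> r <= x ^+ 2.
  rewrite -(real_normK (num_real x)) /T; have := normr_ge0 r; have := ler_norm r.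
  by set t := `|x|; nra.
have cf : continuous f.
  by move=> x; apply/differentiable_continuous/derivable1_diffP; case: (ff' x).
rewrite (_ : (\int[_]_x _)%E = (\int[@lebesgue_measure R]_(x in `[(- T)%R, T%R]) (f' x)%:E)%E).
  rewrite (@continuous_FTC2 R f' f)//.
  - have [-> _] : f T = 0 /\ f' T = 0 by apply/fr/big; exact: ler_norm.
    have [-> _] : f (- T) = 0 /\ f' (- T) = 0.
      by apply/fr/big; rewrite normrN; exact: ler_norm.
    by rewrite subee.
  - exact: continuous_subspaceT.
  - split.
    + by move=> x _; case: (ff' x).
    + by apply: cvg_at_right_filter; exact: cf.
    + by apply: cvg_at_left_filter; exact: cf.
  - by move=> x _; rewrite derive1E; case: (ff' x).
rewrite [RHS]integral_mkcond; apply: eq_integral => x _; rewrite /patch.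
case: ifPn => //; rewrite notin_setE/= in_itv/= -ler_norml => /negP; rewrite -ltNge.
by move=> /ltW/big/fr[_ ->].
Qed.

(** By Fubini's theorem it is enough to integrate along horizontal lines, where u vanishes at both
    ends. *)
Lemma pint_dx u ux (r : R) : continuous ux ->
  (forall x y : R, is_derive x (1 : R) (fun t => u (t, y)) (ux (x, y))) ->
  (forall p, r <= sq p -> u p = 0 /\ ux p = 0) -> pint ux = 0.
Proof.
move=> cux d0 d0'.
have iux : pable ux by apply: (pable_cc (r := r)) => // p /d0'[].
have := @integral21_prod_meas1 _ _ _ _ R (@lebesgue_measure R) (@lebesgue_measure R) _ iux.
rewrite /pint /Rintegral /area => <-; rewrite integral0_eq// => y _.
apply: (@integral_derivative0 (fun x => u (x, y)) (fun x => ux (x, y)) r) => //.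
  exact: continuous_slice1.
by move=> x rx; apply: d0'; rewrite /sq (le_trans rx)// lerDl sqr_ge0.
Qed.

Lemma pint_dy u uy (r : R) : continuous uy ->
  (forall x y : R, is_derive y (1 : R) (fun t => u (x, t)) (uy (x, y))) ->
  (forall p, r <= sq p -> u p = 0 /\ uy p = 0) -> pint uy = 0.
Proof.
move=> cux d0 d0'.
have iux : pable uy by apply: (pable_cc (r := r)) => // p /d0'[].
have := @integral12_prod_meas1 _ _ _ _ R (@lebesgue_measure R) (@lebesgue_measure R) _ iux.
rewrite /pint /Rintegral /area => <-; rewrite integral0_eq// => x _.
apply: (@integral_derivative0 (fun y => u (x, y)) (fun y => uy (x, y)) r) => //.
  exact: continuous_slice2.
by move=> y rx; apply: d0'; rewrite /sq (le_trans rx)// lerDr sqr_ge0.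
Qed.

(** A compactly supported radial test profile. It lives on the whole line, so that its derivative at
    s = 0 is two-sided. *)
Definition bump (r : R) (rho rho' : R -> R) : Prop :=
  [/\ continuous rho', (forall s : R, is_derive s (1 : R) rho (rho' s))
    & forall s, r <= s -> rho s = 0 /\ rho' s = 0].

Lemma bump_continuous r rho rho' : bump r rho rho' -> continuous rho.
Proof.
by move=> [_ d _] x; apply/differentiable_continuous/derivable1_diffP; case: (d x).
Qed.

Lemma is_derive_radial1 (rho rho' : R -> R) (x y : R) :
  (forall s : R, is_derive s (1 : R) rho (rho' s)) ->
  is_derive x (1 : R) (fun t => rho (sq (t, y))) (rho' (sq (x, y)) * (2 * x)).
Proof.
move=> d; apply: (@is_derive1_comp R rho (fun t => sq (t, y))).
by rewrite /sq/=; apply: is_derive_eq; rewrite /GRing.scale/=; ring.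
Qed.

Lemma is_derive_radial2 (rho rho' : R -> R) (x y : R) :
  (forall s : R, is_derive s (1 : R) rho (rho' s)) ->
  is_derive y (1 : R) (fun t => rho (sq (x, t))) (rho' (sq (x, y)) * (2 * y)).
Proof.
move=> d; apply: (@is_derive1_comp R rho (fun t => sq (x, t))).
by rewrite /sq/=; apply: is_derive_eq; rewrite /GRing.scale/=; ring.
Qed.

(** Half the divergence of the field (x, y) rho (s), whose integral vanishes as the field has
    compact support. *)
Lemma pint_euler r rho rho' : bump r rho rho' ->
  pint (fun p => rho (sq p) + sq p * rho' (sq p)) = 0.
Proof.
move=> b; have cr := bump_continuous b; move: b => [cr' dr r0].
have cs (h : R -> R) : continuous h -> continuous (fun p : R * R => h (sq p)).
  by move=> ch; apply: cont2_comp => //; exact: cont2_sq.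
pose ux (p : R * R) := rho (sq p) + p.1 * (rho' (sq p) * (2 * p.1)).
pose uy (p : R * R) := rho (sq p) + p.2 * (rho' (sq p) * (2 * p.2)).
have cux : continuous ux.
  apply: cont2D; first exact: cs.
  by do 2! [apply: cont2M; [by [exact: cont2_fst|exact: cs]|]];
    apply: cont2M; [exact: cont2c|exact: cont2_fst].
have cuy : continuous uy.
  apply: cont2D; first exact: cs.
  by do 2! [apply: cont2M; [by [exact: cont2_snd|exact: cs]|]];
    apply: cont2M; [exact: cont2c|exact: cont2_snd].
have x0 p : r <= sq p -> p.1 * rho (sq p) = 0 /\ ux p = 0.
  by move=> /r0[h1 h2]; rewrite /ux h1 h2; split; ring.
have y0 p : r <= sq p -> p.2 * rho (sq p) = 0 /\ uy p = 0.
  by move=> /r0[h1 h2]; rewrite /uy h1 h2; split; ring.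
have ix : pable ux by apply: (pable_cc (r := r)) => // p /x0[].
have iy : pable uy by apply: (pable_cc (r := r)) => // p /y0[].
have ex : pint ux = 0.
  apply: (@pint_dx (fun p => p.1 * rho (sq p)) _ r) => // x y /=.
  have h := is_derive_radial1 x y dr.
  by apply: is_derive_eq; rewrite /GRing.scale /ux /=; ring.
have ey : pint uy = 0.
  apply: (@pint_dy (fun p => p.2 * rho (sq p)) _ r) => // x y /=.
  have h := is_derive_radial2 x y dr.
  by apply: is_derive_eq; rewrite /GRing.scale /uy /=; ring.
have ixy : pable (fun p => ux p + uy p) := pableD ix iy.
have <- : pint (fun p => 2^-1 * (ux p + uy p)) = 0.
  by rewrite pintZ// pintD// ex ey addr0 mulr0.
by apply: eq_pint => p; rewrite /ux /uy {2}/sq; field.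
Qed.

Section Rotation.
Variables (A B F : R -> R -> R).
Hypothesis cA : continuous (fun p : R * R => A p.1 p.2).
Hypothesis cB : continuous (fun p : R * R => B p.1 p.2).
Hypothesis FA : forall x y : R, is_derive x (1 : R) (fun t => F t y) (A x y).
Hypothesis FB : forall x y : R, is_derive y (1 : R) (F x) (B x y).

(** Both partial derivatives are bounded near the point, and F x' y' - F x y is a step in x followed
    by a step in y. *)
Let cF : continuous (fun p : R * R => F p.1 p.2).
Proof.
move=> -[x y]; apply/continuous2P => e e0 /=.
have [d d0 dP] := (iffLR (continuous2P _ (x, y)) (@cA (x, y))) 1 ltr01.
have [d' d'0 dP'] := (iffLR (continuous2P _ (x, y)) (@cB (x, y))) 1 ltr01.
pose M := `|A x y| + `|B x y| + 1.
have M0 : 0 < M by rewrite ltr_wpDl ?addr_ge0.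
exists (Num.min (Num.min d d') (e / 2 / M)); first by rewrite !lt_min d0 d'0 !divr_gt0.
move=> x' y'; rewrite !lt_min => /andP[/andP[xd xd'] xe] /andP[/andP[yd yd'] ye].
have [c cx e1] := mvt_step x (x' - x) (fun t => FA t y').
have [c' cy e2] := mvt_step y (y' - y) (FB x).
move: e1 e2; rewrite !subrKC => e1 e2.
have -> : F x' y' - F x y = (F x' y' - F x y') + (F x y' - F x y) by ring.
rewrite e1 e2 (le_lt_trans (ler_normD _ _))// !normrM.
have A1 : `|A c y'| <= M.
  have := dP c y' (le_lt_trans cx xd) yd; have := ler_normB (A c y' - A x y) (- A x y).
  rewrite opprK subrK normrN /M; have := normr_ge0 (B x y); lra.
have B1 : `|B x c'| <= M.
  have := dP' x c'; rewrite subrr normr0 => /(_ d'0 (le_lt_trans cy yd')).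
  have := ler_normB (B x c' - B x y) (- B x y).
  rewrite opprK subrK normrN /M; have := normr_ge0 (A x y) => /=; lra.
have h1 : `|A c y'| * `|x' - x| < e / 2.
  by apply: (@le_lt_trans _ _ (M * `|x' - x|)); rewrite ?ler_wpM2r// mulrC -ltr_pdivlMr.
have h2 : `|B x c'| * `|y' - y| < e / 2.
  by apply: (@le_lt_trans _ _ (M * `|y' - y|)); rewrite ?ler_wpM2r// mulrC -ltr_pdivlMr.
lra.
Qed.

(** The integrand equals d_y (x F rho) - d_x (y F rho), because the terms 2 x y F rho' cancel; each
    derivative has integral 0. *)
Lemma pint_rotation r rho rho' : bump r rho rho' ->
  pint (fun p => (p.1 * B p.1 p.2 - p.2 * A p.1 p.2) * rho (sq p)) = 0.
Proof.
move=> b; have cr := bump_continuous b; move: b => [cr' dr r0].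
have cs (h : R -> R) : continuous h -> continuous (fun p : R * R => h (sq p)).
  by move=> ch; apply: cont2_comp => //; exact: cont2_sq.
have cr1 := cs _ cr; have cr2 := cs _ cr'.
have c1 := cont2_fst; have c2 := cont2_snd; have cc := cont2c.
pose uy (p : R * R) := p.1 * (B p.1 p.2 * rho (sq p) + F p.1 p.2 * (rho' (sq p) * (2 * p.2))).
pose ux (p : R * R) := p.2 * (A p.1 p.2 * rho (sq p) + F p.1 p.2 * (rho' (sq p) * (2 * p.1))).
have cux : continuous ux.
  apply: cont2M => //; apply: cont2D; first exact: cont2M.
  by apply: cont2M => //; apply: cont2M => //; apply: cont2M.
have cuy : continuous uy.
  apply: cont2M => //; apply: cont2D; first exact: cont2M.
  by apply: cont2M => //; apply: cont2M => //; apply: cont2M.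
have x0 p : r <= sq p -> p.2 * (F p.1 p.2 * rho (sq p)) = 0 /\ ux p = 0.
  by move=> /r0[h1 h2]; rewrite /ux h1 h2; split; ring.
have y0 p : r <= sq p -> p.1 * (F p.1 p.2 * rho (sq p)) = 0 /\ uy p = 0.
  by move=> /r0[h1 h2]; rewrite /uy h1 h2; split; ring.
have ix : pable ux by apply: (pable_cc (r := r)) => // p /x0[].
have iy : pable uy by apply: (pable_cc (r := r)) => // p /y0[].
have ex : pint ux = 0.
  apply: (@pint_dx (fun p => p.2 * (F p.1 p.2 * rho (sq p))) _ r) => // x y /=.
  have h := is_derive_radial1 x y dr; have h' := FA x y.
  by apply: is_derive_eq; rewrite /GRing.scale /ux /=; ring.
have ey : pint uy = 0.
  apply: (@pint_dy (fun p => p.1 * (F p.1 p.2 * rho (sq p))) _ r) => // x y /=.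
  have h := is_derive_radial2 x y dr; have h' := FB x y.
  by apply: is_derive_eq; rewrite /GRing.scale /uy /=; ring.
have <- : pint (fun p => uy p - ux p) = 0 by rewrite pintB ?ex ?ey ?subr0.
by apply: eq_pint => p; rewrite /ux /uy; ring.
Qed.

End Rotation.
End RotationIdentity.

(** * Complex derivatives and Cauchy's theorem in averaged form *)

Section ComplexBasics.
Context {R : realType}.
Implicit Types (z w : R[i]) (g K : R[i] -> R[i]).

Lemma sqr_modulus z : modulus z ^+ 2 = complex.Re z ^+ 2 + complex.Im z ^+ 2.
Proof. by case: z => x y; rewrite /modulus /= sqr_sqrtr// addr_ge0 ?sqr_ge0. Qed.

Lemma modulus_ge0 z : 0 <= modulus z.
Proof. by case: z => x y; rewrite /modulus /= sqrtr_ge0. Qed.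

Lemma modulusM z w : modulus (z * w) = modulus z * modulus w.
Proof. exact: ComplexField.Normc.normcM. Qed.

Lemma ltcR (x y : R) : (x%:C < y%:C) = (x < y).
Proof. by rewrite ltcE /= eqxx. Qed.

Lemma lecR (x y : R) : (x%:C <= y%:C) = (x <= y).
Proof. by rewrite lecE /= eqxx. Qed.

Lemma modulus_norm z : `|z| = (modulus z)%:C.
Proof. by rewrite normc_def; case: z. Qed.

Lemma modulusD z w : modulus (z + w) <= modulus z + modulus w.
Proof. by have := ler_normD z w; rewrite !modulus_norm -rmorphD/= lecR. Qed.

Lemma modulusN z : modulus (- z) = modulus z.
Proof. by apply: complexI; rewrite -!modulus_norm normrN. Qed.

Lemma modulus0 : modulus (0 : R[i]) = 0.
Proof. exact: ComplexField.Normc.normc0. Qed.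

Lemma modulus1 : modulus (1 : R[i]) = 1.
Proof. exact: ComplexField.Normc.normc1. Qed.

Lemma modulusV z : modulus z^-1 = (modulus z)^-1.
Proof. exact: ComplexField.Normc.normcV. Qed.

Lemma modulus_eq0 z : (modulus z == 0) = (z == 0).
Proof.
apply/eqP/eqP => [|->]; last exact: modulus0.
exact: ComplexField.Normc.eq0_normc.
Qed.

Lemma modulus_gt0 z : (0 < modulus z) = (z != 0).
Proof. by rewrite lt_neqAle modulus_ge0 andbT eq_sym modulus_eq0. Qed.

Lemma modulusX z n : modulus (z ^+ n) = modulus z ^+ n.
Proof.
by elim: n => [|n ih]; rewrite ?expr0 ?modulus1// !exprS modulusM ih.
Qed.

Lemma modulus_real (x : R) : modulus x%:C = `|x|.
Proof. by rewrite /modulus /= expr0n/= addr0 sqrtr_sqr. Qed.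

Lemma ler_Re_modulus z : `|complex.Re z| <= modulus z.
Proof.
by rewrite -ler_sqr ?nnegrE ?modulus_ge0// sqr_modulus real_normK ?num_real// lerDl sqr_ge0.
Qed.

Lemma ler_Im_modulus z : `|complex.Im z| <= modulus z.
Proof.
by rewrite -ler_sqr ?nnegrE ?modulus_ge0// sqr_modulus real_normK ?num_real// lerDr sqr_ge0.
Qed.

Lemma ler_modulus_ReIm z : modulus z <= `|complex.Re z| + `|complex.Im z|.
Proof.
rewrite -ler_sqr ?nnegrE ?modulus_ge0 ?addr_ge0// sqr_modulus sqrrD.
rewrite !real_normK ?num_real// lerD2r lerDl mulrn_wge0// mulr_ge0//.
Qed.

Lemma sqr_modulus_cpx (p : R * R) : modulus (cpx p) ^+ 2 = sq p.
Proof. by rewrite sqr_modulus. Qed.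

Lemma ReB z w : complex.Re (z - w) = complex.Re z - complex.Re w.
Proof. by case: z; case: w. Qed.

Lemma ImB z w : complex.Im (z - w) = complex.Im z - complex.Im w.
Proof. by case: z; case: w. Qed.

Lemma ReD z w : complex.Re (z + w) = complex.Re z + complex.Re w.
Proof. by case: z; case: w. Qed.

Lemma ImD z w : complex.Im (z + w) = complex.Im z + complex.Im w.
Proof. by case: z; case: w. Qed.

Lemma ReM z w : complex.Re (z * w) =
  complex.Re z * complex.Re w - complex.Im z * complex.Im w.
Proof. by case: z; case: w. Qed.

Lemma ImM z w : complex.Im (z * w) =
  complex.Re z * complex.Im w + complex.Im z * complex.Re w.
Proof. by case: z; case: w. Qed.

Lemma eq_complexP z w : complex.Re z = complex.Re w ->
  complex.Im z = complex.Im w -> z = w.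
Proof. by case: z; case: w => ? ? ? ? /= -> ->. Qed.

(** The norm of R[i] takes values in R[i]; this form of differentiability measures with the
    real-valued modulus instead. *)
Definition cderiv g z c := forall e : R, 0 < e -> exists2 d : R, 0 < d &
  forall h, modulus h < d -> modulus (g (z + h) - g z - c * h) <= e * modulus h.

Definition ccont g z := forall e : R, 0 < e -> exists2 d : R, 0 < d &
  forall h, modulus h < d -> modulus (g (z + h) - g z) < e.

Lemma derivable_cderivP g z :
  derivable (g : R[i]^o -> R[i]^o) z 1 <-> exists c, cderiv g z c.
Proof.
split=> [/cvg_ex[c /cvgrPdist_lt gc]|[c gc]].
  exists c => e e0; have e0' : 0 < e%:C by rewrite ltcR.
  have [d /= d0 dP] := (iffLR (@nbhs_ballP _ _ _ _) (gc _ e0')).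
  (* Radii of balls are themselves complex numbers here; a positive one is real. *)
  have dr : d = (complex.Re d)%:C by case: d d0 {dP} => a b; rewrite ltcE /= => /andP[/eqP ->].
  exists (complex.Re d) => [|h hd]; first by move: d0; rewrite ltcE /= => /andP[].
  have [->|h0] := eqVneq h 0; first by rewrite addr0 mulr0 subrr subr0 modulus0 mulr0.
  have /dP/(_ h0) : ball (0 : R[i]^o) d h.
    by rewrite /ball/= sub0r normrN modulus_norm dr ltcR.
  rewrite modulus_norm ltcR => /ltW; rewrite -(ler_pM2r (x := modulus h)) ?modulus_gt0//.
  rewrite -modulusM [X in modulus X <= _ -> _](_ : _ = - (g (z + h) - g z - c * h)) ?modulusN//.
  by rewrite /= /GRing.scale/= mulr1 [h + z]addrC; field; exact: h0.
apply/cvg_ex; exists c; apply/cvgrPdist_lt => e e0.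
have er : e = (complex.Re e)%:C by case: e e0 => a b; rewrite ltcE /= => /andP[/eqP ->].
have e0' : 0 < complex.Re e / 2.
  by move: e0; rewrite ltcE /= => /andP[_ ?]; rewrite divr_gt0.
have [d d0 dP] := gc _ e0'.
apply/nbhs_ballP; exists d%:C; first by rewrite /= ltcR.
move=> h; rewrite /ball/= sub0r normrN modulus_norm ltcR => hd h0.
rewrite modulus_norm [X in _ < X]er ltcR.
apply: (@le_lt_trans _ _ (complex.Re e / 2)); last by rewrite ltr_pdivrMr// ltr_pMr ?ltr1n//; lra.
rewrite -(ler_pM2r (x := modulus h)) ?modulus_gt0//; apply: le_trans (dP _ hd).
rewrite -modulusM [X in modulus X <= _](_ : _ = - (g (z + h) - g z - c * h)) ?modulusN//.
by rewrite /= /GRing.scale/= mulr1 [h + z]addrC; field; exact: h0.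
Qed.

Lemma cderiv_ccont g z c : cderiv g z c -> ccont g z.
Proof.
move=> gc e e0; have [d d0 dP] := gc 1 ltr01.
have c0 := modulus_ge0 c.
have c1 : 0 < modulus c + 1 by lra.
exists (Num.min d (e / (modulus c + 1))); first by rewrite lt_min d0 divr_gt0.
move=> h; rewrite lt_min ltr_pdivlMr// => /andP[/dP hd he].
rewrite -(subrK (c * h) (g _ - _)) (le_lt_trans (modulusD _ _))// modulusM.
by apply: le_lt_trans he; lra.
Qed.

Lemma ccont_cont2 g : (forall z, ccont g z) ->
  continuous (fun p => complex.Re (g (cpx p))) /\
  continuous (fun p => complex.Im (g (cpx p))).
Proof.
move=> cg; have key p (e : R) : 0 < e -> exists2 d : R, 0 < d & forall x y,
    `|x - p.1| < d -> `|y - p.2| < d -> modulus (g (cpx (x, y)) - g (cpx p)) < e.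
  move=> e0; have [d d0 dP] := cg (cpx p) e e0; exists (d / 2); first by rewrite divr_gt0.
  move=> x y xd yd; rewrite -(subrKC (cpx p) (cpx (x, y))); apply: dP.
  by apply: le_lt_trans (ler_modulus_ReIm _) _; rewrite ReB ImB /= (splitr d) ltrD.
split=> p; apply/continuous2P => e e0; have [d d0 dP] := key p e e0; exists d => // x y xd yd.
  by rewrite -ReB; apply: le_lt_trans (ler_Re_modulus _) (dP _ _ xd yd).
by rewrite -ImB; apply: le_lt_trans (ler_Im_modulus _) (dP _ _ xd yd).
Qed.

Lemma entire_cderiv g z : entire g -> exists c, cderiv g z c.
Proof. by move=> /(_ z)/derivable_cderivP. Qed.

Lemma entire_ccont g z : entire g -> ccont g z.
Proof. by move=> /(entire_cderiv z)[c]; exact: cderiv_ccont. Qed.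

(** The Cauchy-Riemann equations, for the real and imaginary parts P dx - Q dy and Q dx + P dy of g
    dz. *)
Lemma closed_at_cderiv g (x y : R) c : cderiv g (cpx (x, y)) c ->
  let P x y := complex.Re (g (cpx (x, y))) in
  let Q x y := complex.Im (g (cpx (x, y))) in
  closed_at P (fun x y => - Q x y) x y /\ closed_at Q P x y.
Proof.
move=> gc P Q.
have key (e : R) : 0 < e -> exists2 d : R, 0 < d & forall s t : R, `|s| < d -> `|t| < d ->
    `|P (x + s) (y + t) - P x y - (complex.Re c * s - complex.Im c * t)| <= e * (`|s| + `|t|) /\
    `|Q (x + s) (y + t) - Q x y - (complex.Re c * t + complex.Im c * s)| <= e * (`|s| + `|t|).
  move=> e0; have [d d0 dP] := gc e e0; exists (d / 2); first by rewrite divr_gt0.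
  move=> s t sd td; have sm := ler_modulus_ReIm (cpx (s, t)).
  have {}dP : modulus (g (cpx (x + s, y + t)) - g (cpx (x, y)) - c * cpx (s, t)) <= e * (`|s| + `|t|).
    apply: le_trans (dP (cpx (s, t)) _) _; first by rewrite (le_lt_trans sm)// (splitr d) ltrD.
    by rewrite ler_pM2l.
  split; [apply: le_trans dP; apply: le_trans (ler_Re_modulus _)|
          apply: le_trans dP; apply: le_trans (ler_Im_modulus _)].
    by rewrite !ReB ReM.
  by rewrite !ImB ImM.
split.
  exists (complex.Re c), (- complex.Im c), (- complex.Re c) => e e0.
  have [d d0 dP] := key e e0; exists d => // s t sd td; have [p q] := dP s t sd td.
  split; first by move: p; congr (`|_| <= _); ring.
  by rewrite -normrN; move: q; congr (`|_| <= _); ring.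
exists (complex.Im c), (complex.Re c), (- complex.Im c) => e e0.
have [d d0 dP] := key e e0; exists d => // s t sd td; have [p q] := dP s t sd td.
by split; [move: q|move: p]; congr (`|_| <= _); ring.
Qed.

(** If F is a primitive of K dz, then x d_y F - y d_x F = i z K, so rotation invariance annihilates
    the mean of z K. One point without derivative is allowed, for the sake of divided
    differences. *)
Lemma pint_holomorphic K (a : R[i]) r rho rho' : (forall z, ccont K z) ->
  (forall z, z != a -> exists c, cderiv K z c) -> bump r rho rho' ->
  pint (fun p => complex.Re (cpx p * K (cpx p)) * rho (sq p)) = 0 /\
  pint (fun p => complex.Im (cpx p * K (cpx p)) * rho (sq p)) = 0.
Proof.
move=> cK dK b; have [cP cQ] := ccont_cont2 cK.
pose P x y := complex.Re (K (cpx (x, y))); pose Q x y := complex.Im (K (cpx (x, y))).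
have cl (x y : R) : (x != complex.Re a) || (y != complex.Im a) ->
    closed_at P (fun x y => - Q x y) x y /\ closed_at Q P x y.
  move=> xy; have [|c Kc] := dK (cpx (x, y)); last exact: closed_at_cderiv Kc.
  by apply: contraTneq xy => <- /=; rewrite !eqxx.
have cP' : continuous (fun p : R * R => P p.1 p.2).
  by rewrite (_ : (fun p => _) = fun p => complex.Re (K (cpx p)))//; apply/funext => -[].
have cQ' : continuous (fun p : R * R => Q p.1 p.2).
  by rewrite (_ : (fun p => _) = fun p => complex.Im (K (cpx p)))//; apply/funext => -[].
have cNQ : continuous (fun p : R * R => - Q p.1 p.2).
  by move=> p; apply: cvgN; exact: cQ'.
have [F1 F1P] := @punctured_primitive _ P (fun x y => - Q x y) _ _ cP' cNQ
  (fun x y xy => (cl x y xy).1).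
have [F2 F2P] := @punctured_primitive _ Q P _ _ cQ' cP' (fun x y xy => (cl x y xy).2).
have r1 := pint_rotation cP' cNQ (fun x y => (F1P x y).1) (fun x y => (F1P x y).2) b.
have r2 := pint_rotation cQ' cP' (fun x y => (F2P x y).1) (fun x y => (F2P x y).2) b.
have e (p : R * R) : (P p.1 p.2 = complex.Re (K (cpx p))) * (Q p.1 p.2 = complex.Im (K (cpx p))).
  by case: p.
have i1 : pable (fun p : R * R => (p.1 * - Q p.1 p.2 - p.2 * P p.1 p.2) * rho (sq p)).
  have [_ _ b0] := b; apply: (pable_cc (r := r)); last by move=> p /b0[-> _]; rewrite mulr0.
  apply: cont2M; last by apply: cont2_comp cont2_sq; exact: bump_continuous b.
  by apply: cont2B; apply: cont2M => //; [exact: cont2_fst|exact: cont2_snd].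
split; first by rewrite -[RHS]r2; apply: eq_pint => p; rewrite ReM !e.
rewrite -[RHS](mulr0 (-1)) -[in RHS]r1 -pintZ//; apply: eq_pint => p.
by rewrite ImM !e /=; ring.
Qed.

End ComplexBasics.

(** * C^1 functions of one variable and cutoffs *)

Section C1Functions.
Context {R : realType}.
Implicit Types f g : R -> R.

Definition c1 f f' : Prop :=
  continuous f' /\ forall s : R, is_derive s (1 : R) f (f' s).

Lemma c1_continuous f f' : c1 f f' -> continuous f.
Proof.
by move=> [_ d] x; apply/differentiable_continuous/derivable1_diffP; case: (d x).
Qed.

Lemma eq_c1 f f' g g' : f =1 g -> f' =1 g' -> c1 f f' -> c1 g g'.
Proof. by move=> /funext <- /funext <-. Qed.

Lemma c1_cst (c : R) : c1 (fun=> c) (fun=> 0).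
Proof. by split=> [x|s]; [exact: cvg_cst|exact: is_derive_cst]. Qed.

Lemma c1_id : c1 (fun s => s) (fun=> 1).
Proof. by split=> [x|s]; [exact: cvg_cst|exact: is_derive_id]. Qed.

Lemma c1D f f' g g' : c1 f f' -> c1 g g' ->
  c1 (fun s => f s + g s) (fun s => f' s + g' s).
Proof.
move=> [cf df] [cg dg]; split=> s; last exact: is_deriveD.
by apply: cvgD; [exact: cf|exact: cg].
Qed.

Lemma c1M f f' g g' : c1 f f' -> c1 g g' ->
  c1 (fun s => f s * g s) (fun s => f' s * g s + f s * g' s).
Proof.
move=> cf cg; have c := c1_continuous cf; have c' := c1_continuous cg.
move: cf cg => [cf df] [cg dg]; split=> s.
  by apply: cvgD; apply: cvgM; [exact: cf|exact: c'|exact: c|exact: cg].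
have h := df s; have h' := dg s.
by apply: is_derive_eq; rewrite /GRing.scale /=; ring.
Qed.

Lemma c1Z f f' (k : R) : c1 f f' -> c1 (fun s => k * f s) (fun s => k * f' s).
Proof.
by move=> cf; apply: eq_c1 (c1M (c1_cst k) cf) => s; rewrite ?mul0r ?add0r.
Qed.

Lemma c1X f f' n : c1 f f' -> exists f'', c1 (fun s => f s ^+ n) f''.
Proof.
move=> cf; elim: n => [|n [h ch]].
  by exists (fun=> 0); apply: eq_c1 (c1_cst 1) => s; rewrite ?expr0.
exists (fun s => f' s * f s ^+ n + f s * h s).
by apply: eq_c1 (c1M cf ch) => s; rewrite ?exprS.
Qed.

Lemma c1V f f' : (forall s, 0 < f s) -> c1 f f' ->
  c1 (fun s => (f s)^-1) (fun s => - (f s ^- 2 * f' s)).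
Proof.
move=> f0 cf; have c := c1_continuous cf.
move: cf => [cf df]; have n0 s : f s != 0 by rewrite gt_eqF.
split=> s; last first.
  by have h := df s; apply: is_derive_eq; rewrite /GRing.scale /=; ring.
apply: cvgN; apply: cvgM; last exact: cf.
apply: cvgV; first by rewrite expf_neq0.
by apply: (@continuous_comp _ _ _ f (fun x => x ^+ 2)); [exact: c|exact: exprn_continuous].
Qed.

(** Suited to piecewise quadratic functions, where the remainder is estimated by cases on signs. *)
Lemma is_derive_quad f (x d : R) :
  (forall h : R, `|f (x + h) - f x - d * h| <= h ^+ 2) -> is_derive x (1 : R) f d.
Proof.
move=> H; have cv : (fun h => h^-1 *: (f (h *: (1 : R) + x) - f x)) @ 0^' --> d.
  apply/cvgrPdist_lt => e e0; apply/nbhs_ballP; exists e => // h.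
  rewrite /ball/= sub0r normrN => he h0.
  apply: le_lt_trans he; rewrite -(ler_pM2r (x := `|h|)) ?normr_gt0// -normrM.
  rewrite -expr2 real_normK ?num_real//; apply: le_trans (H h).
  rewrite -normrN [X in `|X| <= _](_ : _ = f (x + h) - f x - d * h)//.
  by rewrite /GRing.scale/= mulr1 [h + x]addrC; field; exact: h0.
by apply: DeriveDef; [apply/cvg_ex; exists d|exact: cvg_lim].
Qed.

Lemma cont_max0 : continuous (fun s : R => Num.max 0 s).
Proof.
move=> s; apply/cvgrPdist_lt => e e0; apply/nbhs_ballP; exists e => // t.
rewrite /ball/= => st; apply: le_lt_trans st.
by rewrite /Num.max; case: ltP => s0; case: ltP => t0; rewrite ler_norml;
  have := ler_norm (s - t); have := ler_norm (t - s); rewrite (distrC t s);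
  move=> *; apply/andP; split; lra.
Qed.

(** The squared positive part is the building block of every cutoff and extension below: piecewise
    polynomial, yet C^1. *)
Lemma c1_sqmax : c1 (fun s : R => Num.max 0 s ^+ 2) (fun s => 2 * Num.max 0 s).
Proof.
split=> s; first by apply: cvgM; [exact: cvg_cst|exact: cont_max0].
apply: is_derive_quad => h; rewrite /Num.max.
by case: ltP => s0; case: ltP => t0; rewrite ler_norml; apply/andP; split; nra.
Qed.

Lemma c1_comp_affine f f' (a b : R) : c1 f f' ->
  c1 (fun s => f (a + b * s)) (fun s => b * f' (a + b * s)).
Proof.
move=> [cf df]; split=> s.
  apply: cvgM; first exact: cvg_cst.
  apply: (continuous_comp (f := fun s => a + b * s)); last exact: cf.
  by apply: cvgD; [exact: cvg_cst|apply: cvgM; [exact: cvg_cst|exact: cvg_id]].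
have h := df (a + b * s).
have h' : is_derive s (1 : R) (fun s => a + b * s) b.
  by apply: is_derive_eq; rewrite /GRing.scale /=; ring.
by rewrite mulrC; exact: (is_derive1_comp (f := f) (g := fun s => a + b * s)).
Qed.

Lemma bumpM r rho rho' g g' : bump r rho rho' -> c1 g g' ->
  bump r (fun s => rho s * g s) (fun s => rho' s * g s + rho s * g' s).
Proof.
move=> [c d z] cg; have [c' d'] := c1M (conj c d : c1 rho rho') cg.
by split => // s /z[-> ->]; rewrite !mul0r addr0.
Qed.

Definition cutoff (r : R) (s : R) := Num.max 0 (1 - r^-1 * s) ^+ 2.

Lemma bump_cutoff r : 0 < r -> bump r (cutoff r) (fun s => - r^-1 * (2 * Num.max 0 (1 - r^-1 * s))).
Proof.
move=> r0; have [c d] : c1 (cutoff r) (fun s => - r^-1 * (2 * Num.max 0 (1 - r^-1 * s))).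
  have e s : 1 + - r^-1 * s = 1 - r^-1 * s by rewrite mulNr.
  by apply: eq_c1 (c1_comp_affine 1 (- r^-1) c1_sqmax) => s; rewrite /cutoff e.
split => // s rs; rewrite /cutoff max_l ?expr0n ?mulr0//.
by rewrite subr_le0 mulrC ler_pdivlMr// mul1r.
Qed.

Lemma cutoff_ge0 r s : 0 <= cutoff r s. Proof. exact: sqr_ge0. Qed.

Lemma cutoff_le1 r s : 0 < r -> 0 <= s -> cutoff r s <= 1.
Proof.
move=> r0 s0; rewrite /cutoff expr_le1// ?le_max ?lexx// ge_max ler01/= gerBl.
by rewrite mulr_ge0// invr_ge0 ltW.
Qed.

Lemma cutoff_gt0 r s : 0 < r -> s < r -> 0 < cutoff r s.
Proof.
move=> r0 sr; rewrite /cutoff exprn_gt0// lt_max; apply/orP; right.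
by rewrite subr_gt0 mulrC ltr_pdivrMr// mul1r.
Qed.

Lemma cutoff_homo r r' s : 0 < r -> r <= r' -> 0 <= s -> cutoff r s <= cutoff r' s.
Proof.
move=> r0 rr' s0; have h : Num.max 0 (1 - r^-1 * s) <= Num.max 0 (1 - r'^-1 * s).
  rewrite ge_max !le_max lexx/= lerB ?orbT// ler_wpM2r// lef_pV2 ?posrE//.
  exact: lt_le_trans rr'.
by apply: lerXn2r => //; rewrite nnegrE le_max lexx.
Qed.

End C1Functions.

(** * Complex-valued integrals *)

Section ComplexIntegral.
Context {R : realType}.
Implicit Types h k : R * R -> R[i].

Definition cable h : Prop :=
  pable (fun p => complex.Re (h p)) /\ pable (fun p => complex.Im (h p)).

Definition cint h : R[i] :=
  pint (fun p => complex.Re (h p)) +i* pint (fun p => complex.Im (h p)).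

Lemma eq_cint h k : h =1 k -> cint h = cint k.
Proof. by move=> /funext ->. Qed.

Lemma eq_cable h k : h =1 k -> cable h -> cable k.
Proof. by move=> /funext ->. Qed.

Lemma cable0 : cable (fun=> 0). Proof. by split; exact: pable0. Qed.

Lemma cint0 : cint (fun=> 0) = 0.
Proof. by rewrite /cint pint0. Qed.

Lemma cableD h k : cable h -> cable k -> cable (fun p => h p + k p).
Proof.
move=> [h1 h2] [k1 k2]; split.
  by apply: eq_pable (pableD h1 k1) => p; rewrite ReD.
by apply: eq_pable (pableD h2 k2) => p; rewrite ImD.
Qed.

Lemma cintD h k : cable h -> cable k ->
  cint (fun p => h p + k p) = cint h + cint k.
Proof.
move=> [h1 h2] [k1 k2]; apply: eq_complexP; rewrite ?ReD ?ImD /= -pintD//.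
  by apply: eq_pint => p; rewrite ReD.
by apply: eq_pint => p; rewrite ImD.
Qed.

Lemma cableZ c h : cable h -> cable (fun p => c * h p).
Proof.
move=> [h1 h2]; split.
  apply: eq_pable (pableB (pableZ (complex.Re c) h1) (pableZ (complex.Im c) h2)) => p.
  by rewrite ReM.
apply: eq_pable (pableD (pableZ (complex.Re c) h2) (pableZ (complex.Im c) h1)) => p.
by rewrite ImM.
Qed.

Lemma cintZ c h : cable h -> cint (fun p => c * h p) = c * cint h.
Proof.
move=> [h1 h2]; apply: eq_complexP; rewrite ?ReM ?ImM /= -!pintZ//.
  by rewrite -pintB; [apply: eq_pint => p; rewrite ReM|exact: pableZ|exact: pableZ].
by rewrite -pintD; [apply: eq_pint => p; rewrite ImM|exact: pableZ|exact: pableZ].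
Qed.

Lemma cable_sum (I : Type) (s : seq I) (F : I -> R * R -> R[i]) :
  (forall i, cable (F i)) -> cable (fun p => \sum_(i <- s) F i p).
Proof.
move=> iF; elim: s => [|i s ih].
  by apply: eq_cable cable0 => p; rewrite big_nil.
by apply: eq_cable (cableD (iF i) ih) => p; rewrite big_cons.
Qed.

Lemma cint_sum (I : Type) (s : seq I) (F : I -> R * R -> R[i]) :
  (forall i, cable (F i)) ->
  cint (fun p => \sum_(i <- s) F i p) = \sum_(i <- s) cint (F i).
Proof.
move=> iF; elim: s => [|i s ih].
  by rewrite big_nil -[RHS]cint0; apply: eq_cint => p; rewrite big_nil.
rewrite big_cons -ih -cintD//; last exact: cable_sum.
by apply: eq_cint => p; rewrite big_cons.
Qed.

Lemma modulus_cint h (b : R * R -> R) : cable h -> pable b ->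
  (forall p, modulus (h p) <= b p) -> modulus (cint h) <= 2 * pint b.
Proof.
move=> [h1 h2] ib hb; rewrite (le_trans (ler_modulus_ReIm _))//= mulr_natl mulr2n.
have key (u : R * R -> R) : pable u -> (forall p, `|u p| <= b p) -> `|pint u| <= pint b.
  move=> iu ub; rewrite ler_norml; apply/andP; split; last first.
    by apply: le_pint => // p; apply: le_trans (ub p); exact: ler_norm.
  rewrite -mulN1r -pintZ//; apply: le_pint => //; first exact: pableZ.
  by move=> p; rewrite mulN1r lerNl (le_trans _ (ub p))// -normrN ler_norm.
by apply: lerD; apply: key => // p; apply: le_trans (hb p);
  [exact: ler_Re_modulus|exact: ler_Im_modulus].
Qed.

End ComplexIntegral.

(** * Entire functions and orthogonality of monomials *)

Section EntireFunctions.
Context {R : realType}.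
Implicit Types (g h : R[i] -> R[i]) (z w c : R[i]) (r : R) (rho : R -> R).

Lemma entire_cst (c : R[i]) : entire (fun=> c).
Proof. by move=> z; exact: derivable_cst. Qed.

Arguments entire_cst : clear implicits.

Lemma entire_id : entire (fun z : R[i] => z).
Proof. by move=> z; exact: derivable_id. Qed.

Arguments entire_id : clear implicits.

Lemma entireD g h : entire g -> entire h -> entire (fun z => g z + h z).
Proof. by move=> eg eh z; exact: (derivableD (eg z) (eh z)). Qed.

Lemma entireM g h : entire g -> entire h -> entire (fun z => g z * h z).
Proof. by move=> eg eh z; exact: (derivableM (eg z) (eh z)). Qed.

Lemma entireX n : entire (fun z : R[i] => z ^+ n).
Proof.
elim: n => [|n ih]; first exact: entire_cst.
rewrite (_ : (fun z => _) = fun z => z * z ^+ n); last by apply/funext => z; rewrite exprS.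
exact: (entireM entire_id ih).
Qed.

Arguments entireX : clear implicits.

Lemma entire_sum n (F : nat -> R[i] -> R[i]) : (forall k, entire (F k)) ->
  entire (fun z => \sum_(k < n) F k z).
Proof.
move=> eF; elim: n => [|n ih].
  rewrite (_ : (fun z => _) = fun=> 0); first exact: entire_cst.
  by apply/funext => z; rewrite big_ord0.
rewrite (_ : (fun z => _) = fun z => \sum_(k < n) F k z + F n z); first exact: (entireD ih (eF n)).
by apply/funext => z; rewrite big_ord_recr.
Qed.

Lemma entire_cont2 g : entire g ->
  continuous (fun p => complex.Re (g (cpx p))) /\
  continuous (fun p => complex.Im (g (cpx p))).
Proof. by move=> eg; apply: ccont_cont2 => z; exact: entire_ccont. Qed.

Lemma entire_cont2_modulus g : entire g ->
  continuous (fun p => modulus (g (cpx p)) ^+ 2).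
Proof.
move=> /entire_cont2[c d].
rewrite (_ : (fun p => _) = fun p => complex.Re (g (cpx p)) * complex.Re (g (cpx p)) +
   complex.Im (g (cpx p)) * complex.Im (g (cpx p))).
  by apply: cont2D; apply: cont2M.
by apply/funext => p; rewrite sqr_modulus !expr2.
Qed.

Lemma pable_bump (u : R * R -> R) r rho rho' : continuous u -> bump r rho rho' ->
  pable (fun p => u p * rho (sq p)).
Proof.
move=> cu b; have [_ _ b0] := b; apply: (pable_cc (r := r)); last first.
  by move=> p /b0[-> _]; rewrite mulr0.
by apply: cont2M => //; apply: cont2_comp cont2_sq; exact: bump_continuous b.
Qed.

Lemma pint_monomial m r rho rho' : bump r rho rho' ->
  pint (fun p => complex.Re (cpx p ^+ m.+1) * rho (sq p)) = 0 /\
  pint (fun p => complex.Im (cpx p ^+ m.+1) * rho (sq p)) = 0.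
Proof.
move=> b.
have [c d] := pint_holomorphic (a := 0) (fun z => entire_ccont z (entireX m))
  (fun z _ => entire_cderiv z (entireX m)) b.
by split; [rewrite -[RHS]c|rewrite -[RHS]d]; apply: eq_pint => p; rewrite exprS.
Qed.

Lemma mulJ_sq (p : R * R) : (cpx p)^* * cpx p = (sq p)%:C.
Proof. by apply: eq_complexP; case: p => x y; rewrite /sq/=; ring. Qed.

(** The product of conj(z)^j and z^k is s^j z^(k-j); the radial factor s^j is absorbed into the
    profile, and a positive power of z has mean 0. *)
Lemma pint_orthogonal c j k r rho rho' : (j < k)%N -> bump r rho rho' ->
  pint (fun p => complex.Re (c * (cpx p)^* ^+ j * cpx p ^+ k) * rho (sq p)) = 0.
Proof.
move=> jk b; have [f' fj] := c1X j (@c1_id R).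
have bj := bumpM b fj; have [m km] : exists m, k = (j + m.+1)%N.
  by exists (k - j).-1; rewrite prednK ?subn_gt0// subnKC// ltnW.
have [e1 e2] := pint_monomial m bj.
have [cR cI] := entire_cont2 (entireX m.+1).
have i1 := pable_bump cR bj; have i2 := pable_bump cI bj.
transitivity (pint (fun p => complex.Re c * (complex.Re (cpx p ^+ m.+1) * (rho (sq p) * sq p ^+ j)) -
   complex.Im c * (complex.Im (cpx p ^+ m.+1) * (rho (sq p) * sq p ^+ j)))).
  apply: eq_pint => p; rewrite km exprD mulrA -(mulrA c) -exprMn mulJ_sq -rmorphXn/=.
  by rewrite mulrAC ReM ReM ImM /=; ring.
rewrite pintB; [|exact: pableZ|exact: pableZ].
by rewrite !pintZ// e1 e2 !mulr0 subr0.
Qed.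

End EntireFunctions.

(** * Power series and Parseval's identity on discs *)

Section PowerSeries.
Context {R : realType}.
Implicit Types (g h : R[i] -> R[i]) (z w : R[i]) (r : R) (rho : R -> R) (a b : nat -> R[i]).

Definition psum a N z := \sum_(k < N) a k * z ^+ k.

Definition ccvg (u : nat -> R[i]) (l : R[i]) :=
  (fun n => complex.Re (u n)) @ \oo --> (complex.Re l : R) /\
  (fun n => complex.Im (u n)) @ \oo --> (complex.Im l : R).

(** Absolute convergence is recorded as boundedness of the partial sums, the form in which it
    dominates them on smaller discs. *)
Definition pser a g (r : R) := forall z, modulus z < r ->
  (exists B : R, forall N, \sum_(k < N) modulus (a k) * modulus z ^+ k <= B) /\
  ccvg (fun N => psum a N z) (g z).

Lemma psum_entire a N : entire (psum a N).
Proof.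
rewrite /psum; apply: (entire_sum (n := N) (F := fun k z => a k * z ^+ k)) => k.
exact: (entireM (@entire_cst R (a k)) (@entireX R k)).
Qed.

Arguments psum_entire : clear implicits.

Lemma modulus_sum (I : Type) (s : seq I) (F : I -> R[i]) :
  modulus (\sum_(i <- s) F i) <= \sum_(i <- s) modulus (F i).
Proof.
elim: s => [|i s ih]; first by rewrite !big_nil modulus0.
by rewrite !big_cons (le_trans (modulusD _ _))// lerD2l.
Qed.

Lemma Re_sum (I : Type) (s : seq I) (F : I -> R[i]) :
  complex.Re (\sum_(i <- s) F i) = \sum_(i <- s) complex.Re (F i).
Proof. by elim: s => [|i s ih]; rewrite ?big_nil// !big_cons ReD ih. Qed.

Lemma Im_sum (I : Type) (s : seq I) (F : I -> R[i]) :
  complex.Im (\sum_(i <- s) F i) = \sum_(i <- s) complex.Im (F i).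
Proof. by elim: s => [|i s ih]; rewrite ?big_nil// !big_cons ImD ih. Qed.

Lemma modulus_psum a N z (t : R) : modulus z <= t ->
  modulus (psum a N z) <= \sum_(k < N) modulus (a k) * t ^+ k.
Proof.
move=> zt; rewrite (le_trans (modulus_sum _ _))//; apply: ler_sum => k _.
rewrite modulusM modulusX ler_wpM2l ?modulus_ge0//.
by apply: lerXn2r => //; rewrite nnegrE ?modulus_ge0// (le_trans (modulus_ge0 z)).
Qed.

Lemma sqr_modulusD z w :
  modulus (z + w) ^+ 2 = modulus z ^+ 2 + 2 * complex.Re (z^* * w) + modulus w ^+ 2.
Proof. by rewrite !sqr_modulus ReD ImD ReM; case: z w => [? ?] [? ?] /=; ring. Qed.

Lemma parseval_psum a N r rho rho' : bump r rho rho' ->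
  pint (fun p => modulus (psum a N (cpx p)) ^+ 2 * rho (sq p)) =
  \sum_(k < N) modulus (a k) ^+ 2 * pint (fun p => sq p ^+ k * rho (sq p)).
Proof.
move=> b; elim: N => [|N ih].
  rewrite big_ord0 -[RHS]pint0; apply: eq_pint => p.
  by rewrite /psum big_ord0 modulus0 expr0n mul0r.
have cs k : continuous (fun p : R * R => sq p ^+ k).
  by apply: (cont2_comp (h := fun s => s ^+ k)); [exact: exprn_continuous|exact: cont2_sq].
have ik k := pable_bump (cs k) b.
have iN := pable_bump (entire_cont2_modulus (psum_entire a N)) b.
have ire j (c : R[i]) : pable (fun p => complex.Re (c * (cpx p)^* ^+ j * cpx p ^+ N) * rho (sq p)).
  have [c1 c2] := entire_cont2 (@entireX R N).
  have [d1 d2] := entire_cont2 (@entireX R j).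
  apply: pable_bump b.
  rewrite (_ : (fun p => _) = fun p => (complex.Re c * complex.Re (cpx p ^+ j) +
     complex.Im c * complex.Im (cpx p ^+ j)) * complex.Re (cpx p ^+ N) -
    (complex.Im c * complex.Re (cpx p ^+ j) - complex.Re c * complex.Im (cpx p ^+ j))
      * complex.Im (cpx p ^+ N)).
    have cc := @cont2c R.
    by apply: cont2B; apply: cont2M => //; [apply: cont2D|apply: cont2B]; apply: cont2M.
  apply/funext => p; rewrite -rmorphXn !ReM !ImM; case: (cpx p ^+ j) => x y /=; ring.
pose F j p := complex.Re ((a j)^* * a N * (cpx p)^* ^+ j * cpx p ^+ N) * rho (sq p).
have iF (j : 'I_N) : pable (F j) by exact: ire.
have i2 : pable (fun p => 2 * \sum_(j < N) F j p) by apply: pableZ; exact: pable_sum.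
have i3 : pable (fun p => modulus (a N) ^+ 2 * (sq p ^+ N * rho (sq p))) by exact: pableZ.
transitivity (pint (fun p => modulus (psum a N (cpx p)) ^+ 2 * rho (sq p) +
    2 * (\sum_(j < N) F j p) + modulus (a N) ^+ 2 * (sq p ^+ N * rho (sq p)))).
  apply: eq_pint => p; rewrite {1}/psum big_ord_recr /= -/(psum a N (cpx p)) sqr_modulusD.
  rewrite [LHS]mulrDl [X in X + _]mulrDl; congr (_ + _ + _); last first.
    by rewrite modulusM modulusX exprMn -exprM mulnC exprM sqr_modulus_cpx mulrA.
  rewrite -[LHS]mulrA; congr (_ * _); rewrite -mulr_suml; congr (_ * _).
  rewrite -Re_sum; congr complex.Re; rewrite /psum rmorph_sum mulr_suml.
  by apply: eq_bigr => j _; rewrite rmorphM rmorphXn/=; ring.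
rewrite big_ord_recr/= -ih; have iD := pableD iN i2.
rewrite pintD// pintD// !pintZ//; last exact: pable_sum.
rewrite pint_sum// big1 ?mulr0 ?addr0// => j _.
exact: pint_orthogonal b.
Qed.

(** The absolute sums at radius t bound all partial sums on the disc that carries rho, so dominated
    convergence applies to [parseval_psum]. *)
Lemma parseval_bump a g (t r r0 : R) rho rho' : bump r0 rho rho' ->
  (forall s, 0 <= rho s) -> 0 <= t -> t < r -> r0 <= t ^+ 2 -> pser a g r ->
  pmeas (fun p => modulus (g (cpx p)) ^+ 2) ->
  (fun N => \sum_(k < N) modulus (a k) ^+ 2 * pint (fun p => sq p ^+ k * rho (sq p)))
   @ \oo --> pint (fun p => modulus (g (cpx p)) ^+ 2 * rho (sq p)).
Proof.
move=> b rho0 t0 tr r0t ag mg; have [_ _ bz] := b.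
have mt : modulus t%:C = t by rewrite modulus_real ger0_norm.
have [|[B BP] _] := ag t%:C; first by rewrite mt.
rewrite mt in BP.
have small (p : R * R) : sq p < r0 -> modulus (cpx p) <= t.
  by move=> pr; rewrite -ler_sqr ?nnegrE ?modulus_ge0// sqr_modulus_cpx (le_trans (ltW pr)).
under eq_fun do rewrite -(parseval_psum a _ b).
have crho : continuous (fun p : R * R => rho (sq p)).
  by apply: cont2_comp cont2_sq; exact: bump_continuous b.
have irho : pable (fun p => B ^+ 2 * rho (sq p)).
  by apply: pable_bump b; exact: cont2c.
apply: (proj2 (@pint_dct _ (fun N p => modulus (psum a N (cpx p)) ^+ 2 * rho (sq p)) _ _ _ _ _ irho)).
- move=> N; apply: continuous2_measurable; apply: cont2M => //.
  exact: entire_cont2_modulus (psum_entire a N).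
- move=> p; have [/bz[e _]|pr] := leP r0 (sq p).
    by under eq_fun do rewrite e mulr0; rewrite e mulr0; exact: cvg_cst.
  apply: cvgM; last exact: cvg_cst.
  have [_ [c1 c2]] := ag _ (le_lt_trans (small p pr) tr).
  under eq_fun do rewrite sqr_modulus !expr2.
  by rewrite sqr_modulus !expr2; apply: cvgD; apply: cvgM.
move=> N p; have [/bz[e _]|pr] := leP r0 (sq p); first by rewrite e !mulr0 normr0.
rewrite normrM (ger0_norm (sqr_ge0 _)) (ger0_norm (rho0 _)); apply: ler_wpM2r => //.
have h := le_trans (modulus_psum a N (small p pr)) (BP N).
by apply: lerXn2r => //; rewrite nnegrE ?modulus_ge0// (le_trans (modulus_ge0 _) h).
Qed.

(** Parseval's identity for the zero function makes a series of nonnegative terms sum to 0, and the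
    moments multiplying the |a_k|^2 are positive. *)
Lemma pser_zero a (r : R) : 0 < r -> pser a (fun=> 0) r -> forall k, a k = 0.
Proof.
move=> r0 ag k; pose q := (r / 2) ^+ 2.
have q0 : 0 < q by rewrite exprn_gt0// divr_gt0.
have b := bump_cutoff q0.
have pos j (p : R * R) : 0 <= sq p ^+ j * cutoff q (sq p).
  by apply: mulr_ge0; [apply: exprn_ge0; exact: sq_ge0|exact: cutoff_ge0].
have cs j : continuous (fun p : R * R => sq p ^+ j).
  by apply: (cont2_comp (h := fun s => s ^+ j)); [exact: exprn_continuous|exact: cont2_sq].
have gt0 j : 0 < pint (fun p : R * R => sq p ^+ j * cutoff q (sq p)).
  apply: (@pint_gt0 _ _ (r / 4, 0)) => //; first exact: pable_bump (cs j) b.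
    apply: cont2M; first exact: cs.
    by apply: cont2_comp cont2_sq; exact: bump_continuous b.
  have sp : sq (r / 4, 0) = (r / 4) ^+ 2 by rewrite /sq /= expr0n addr0.
  rewrite sp; apply: mulr_gt0; first by rewrite !exprn_gt0// divr_gt0.
  apply: cutoff_gt0 => //; rewrite /q -subr_gt0.
  by rewrite (_ : _ - _ = r ^+ 2 * (3 / 16)); [rewrite mulr_gt0 ?exprn_gt0//; lra|field].
have t0 : 0 <= r / 2 by rewrite divr_ge0// ltW.
have tr : r / 2 < r by lra.
have m0 : pmeas (fun p => modulus ((fun=> 0) (cpx p) : R[i]) ^+ 2).
  by rewrite modulus0 expr0n; exact: pmeas_cst.
have := parseval_bump b (cutoff_ge0 q) t0 tr (lexx _) ag m0.
rewrite (_ : pint _ = 0); last first.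
  by rewrite -[RHS](@pint0 R); apply: eq_pint => p; rewrite modulus0 expr0n mul0r.
set u := (X in X @ _ --> _) => cu.
have nd : nondecreasing_seq u.
  apply/nondecreasing_seqP => N; rewrite /u big_ord_recr/= lerDl.
  by rewrite mulr_ge0 ?sqr_ge0// ltW.
have := nondecreasing_cvgn_le nd (cvgP _ cu) k.+1.
rewrite (cvg_lim _ cu)// /u big_ord_recr/= => h.
apply/eqP; rewrite -modulus_eq0 -sqrf_eq0 eq_le sqr_ge0 andbT.
rewrite -(pmulr_lle0 _ (gt0 k)); apply: le_trans h; rewrite lerDr.
by apply: sumr_ge0 => j _; rewrite mulr_ge0 ?sqr_ge0// ltW.
Qed.

Lemma pser_le a g r r' : r' <= r -> pser a g r -> pser a g r'.
Proof. by move=> rr ag z zr; apply: ag; exact: lt_le_trans rr. Qed.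

Lemma ccvgD u v x y : ccvg u x -> ccvg v y -> ccvg (fun n => u n + v n) (x + y).
Proof.
move=> [a1 a2] [b1 b2]; split.
  by under eq_fun do rewrite ReD; rewrite ReD; exact: cvgD.
by under eq_fun do rewrite ImD; rewrite ImD; exact: cvgD.
Qed.

Lemma ccvgZ c u x : ccvg u x -> ccvg (fun n => c * u n) (c * x).
Proof.
move=> [a1 a2]; split.
  under eq_fun do rewrite ReM; rewrite ReM.
  by apply: cvgB; apply: cvgM => //; exact: cvg_cst.
under eq_fun do rewrite ImM; rewrite ImM.
by apply: cvgD; apply: cvgM => //; exact: cvg_cst.
Qed.

Lemma pser_lin c a b g h r : pser a g r -> pser b h r ->
  pser (fun k => c * a k + b k) (fun z => c * g z + h z) r.
Proof.
move=> ag bh z zr; have [[A AP] ca] := ag z zr; have [[B BP] cb] := bh z zr; split.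
  exists (modulus c * A + B) => N.
  have h1 := ler_wpM2l (modulus_ge0 c) (AP N).
  apply: le_trans (lerD h1 (BP N)); rewrite mulr_sumr -big_split /=.
  apply: ler_sum => k _; rewrite mulrA -mulrDl ler_wpM2r ?exprn_ge0 ?modulus_ge0//.
  by rewrite (le_trans (modulusD _ _))// modulusM.
rewrite (_ : (fun N => _) = fun N => c * psum a N z + psum b N z).
  by apply: ccvgD => //; exact: ccvgZ.
apply/funext => N; rewrite /psum mulr_sumr -big_split; apply: eq_bigr => k _ /=.
by rewrite mulrDl mulrA.
Qed.

Lemma pser_unique a b g r : 0 < r -> pser a g r -> pser b g r -> a = b.
Proof.
move=> r0 ag bg; apply/funext => k; have h := pser_lin (- 1) bg ag.
have /(pser_zero r0)/(_ k) : pser (fun k => -1 * b k + a k) (fun=> 0) r.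
  by rewrite (_ : (fun=> 0) = fun z => -1 * g z + g z)//; apply/funext => z; rewrite mulN1r addNr.
by rewrite mulN1r addrC => /eqP; rewrite subr_eq0 => /eqP.
Qed.

End PowerSeries.

(** * Taylor expansion of entire functions *)

Section Taylor.
Context {R : realType}.
Implicit Types (g h : R[i] -> R[i]) (z w a : R[i]) (r : R).

(** At a the quotient is continued by the derivative of g. Continuity is clear there but
    differentiability is not, which is why primitives were built with one exceptional point. *)
Lemma divided_difference g a : entire g -> exists K,
  [/\ forall z, ccont K z, forall z, z != a -> exists c, cderiv K z c
    & forall z, (z - a) * K z = g z - g a].
Proof.
move=> eg; have [c gc] := entire_cderiv a eg.
pose K z := if z == a then c else (g z - g a) * (z - a)^-1.
have dK z : z != a -> exists c, cderiv K z c.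
  move=> za; apply/derivable_cderivP.
  apply: (@near_eq_derivable _ R[i]^o R[i]^o (fun w => (g w - g a) * (w - a)^-1)).
    apply/nbhs_ballP; exists (modulus (z - a))%:C => /=.
      by rewrite ltcR modulus_gt0 subr_eq0.
    move=> w; rewrite /ball/= modulus_norm ltcR => zw; rewrite /K ifF//.
    by apply/eqP => wa; move: zw; rewrite wa ltxx.
  apply: (@derivableM _ R[i]^o (fun w => g w - g a) (fun w => (w - a)^-1)).
    by apply: (@derivableB _ R[i]^o R[i]^o g (cst (g a))); [exact: eg|exact: derivable_cst].
  apply: (@derivableV _ R[i]^o (fun w => w - a)); first by rewrite subr_eq0.
  by apply: (@derivableB _ R[i]^o R[i]^o id (cst a)); [exact: derivable_id|exact: derivable_cst].
exists K; split => //.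
- move=> z; have [->|/dK[d /cderiv_ccont]//] := eqVneq z a.
  move=> e e0; have e2 : 0 < e / 2 by rewrite divr_gt0.
  have [d d0 dP] := gc _ e2; exists d => // h hd.
  have [->|h0] := eqVneq h 0; first by rewrite addr0 subrr modulus0.
  rewrite /K eqxx ifF; last by rewrite -subr_eq0 addrC addKr (negbTE h0).
  rewrite [a + h - a]addrAC subrr add0r.
  rewrite (_ : _ - c = (g (a + h) - g a - c * h) * h^-1); last by rewrite [RHS]mulrBl mulfK.
  rewrite modulusM modulusV ltr_pdivrMr ?modulus_gt0//.
  by apply: le_lt_trans (dP h hd) _; rewrite ltr_pM2r ?modulus_gt0//; lra.
- move=> z; rewrite /K; case: eqVneq => [->|za]; first by rewrite !subrr mul0r.
  by field; rewrite subr_eq0.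
Qed.

(** A profile vanishing for s <= A; with A > 0, negative powers of z may be integrated against
    it. *)
Definition annulus (A B s : R) := Num.max 0 (s - A) ^+ 2 * Num.max 0 (B - s) ^+ 2.

Lemma annulus_ge0 A B s : 0 <= annulus A B s.
Proof. by rewrite mulr_ge0 ?sqr_ge0. Qed.

Lemma annulus_in A B s : s <= A -> annulus A B s = 0.
Proof. by move=> sA; rewrite /annulus max_l ?subr_le0// expr0n mul0r. Qed.

Lemma annulus_gt0 A B s : A < s -> s < B -> 0 < annulus A B s.
Proof.
by move=> sA sB; rewrite mulr_gt0// exprn_gt0// lt_max subr_gt0 ?sA ?sB orbT.
Qed.

Lemma bump_annulus A B : exists f, bump B (annulus A B) f.
Proof.
have h1 := c1_comp_affine (- A) 1 (@c1_sqmax R).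
have h2 := c1_comp_affine B (- 1) (@c1_sqmax R).
eexists; have [c d] := c1M h1 h2.
have e : annulus A B = fun s => Num.max 0 (- A + 1 * s) ^+ 2 * Num.max 0 (B + -1 * s) ^+ 2.
  by apply/funext => s; rewrite /annulus mulN1r mul1r [- A + s]addrC.
split; [exact: c|by rewrite e; exact: d|].
move=> s Bs; have m0 : Num.max 0 (B - s) = 0 by rewrite max_l// subr_le0.
by rewrite /annulus mulN1r m0 !expr0n !mulr0 addr0.
Qed.

(* s^-1 is replaced by a C^1 function that agrees with it for s >= A. *)
Lemma bump_annulusV A B k : 0 < A ->
  exists f, bump B (fun s => annulus A B s * s^-1 ^+ k) f.
Proof.
move=> A0; have [f bf] := bump_annulus A B.
pose D s : R := s + A^-1 * Num.max 0 (A - s) ^+ 2.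
have D0 s : 0 < D s.
  rewrite /D; have [As|sA] := leP A s; first by rewrite max_l ?subr_le0// expr0n mulr0 addr0; lra.
  have -> : Num.max 0 (A - s) = A - s by rewrite max_r// subr_ge0 ltW.
  rewrite [X in 0 < X](_ : _ = (A - s) + A^-1 * s ^+ 2); last by field; rewrite gt_eqF.
  by rewrite ltr_pwDl ?subr_gt0// mulr_ge0 ?sqr_ge0// invr_ge0 ltW.
have [D' cD] : exists D', c1 D D'.
  have h := c1D (@c1_id R) (c1Z A^-1 (c1_comp_affine A (- 1) (@c1_sqmax R))).
  by eexists; apply: eq_c1 h => s; rewrite ?mulN1r.
have [f' cf'] := c1X k (c1V D0 cD).
have [c d b0] := bumpM bf cf'.
have e : (fun s => annulus A B s * (D s)^-1 ^+ k) = fun s => annulus A B s * s^-1 ^+ k.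
  apply/funext => s; have [sA|As] := leP s A; first by rewrite annulus_in// !mul0r.
  by rewrite /D max_l ?subr_le0 ?ltW// expr0n mulr0 addr0.
eexists; split; [exact: c|by rewrite -e; exact: d|].
by move=> s /b0[h1 h2]; split => //; rewrite -[RHS]h1; exact: (esym (congr1 (@^~ s) e)).
Qed.

Lemma cpxV (p : R * R) : (cpx p)^-1 = (sq p)^-1%:C * (cpx p)^*.
Proof.
have [p0|p0] := eqVneq (cpx p) 0.
  by rewrite p0 invr0; apply: eq_complexP; rewrite ?ReM ?ImM /= ?oppr0 !(mulr0, mul0r) ?subr0 ?addr0.
have s0 : (sq p)%:C != 0 :> R[i] by rewrite -mulJ_sq mulf_neq0// conjc_eq0.
by apply: (mulfI p0); rewrite mulfV// mulrCA [cpx p * _]mulrC mulJ_sq -rmorphM mulVf// -(inj_eq (@complexI R)).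
Qed.

Lemma cpxVX_parts (p : R * R) k :
  complex.Re ((cpx p)^-1 ^+ k) = complex.Re (cpx p ^+ k) * (sq p)^-1 ^+ k /\
  complex.Im ((cpx p)^-1 ^+ k) = - complex.Im (cpx p ^+ k) * (sq p)^-1 ^+ k.
Proof.
rewrite cpxV exprMn -!rmorphXn /= ReM ImM /=.
by case: (cpx p ^+ k) => x y /=; split; ring.
Qed.

Section CauchyEstimate.
Variables (g : R[i] -> R[i]) (r : R).
Hypothesis (eg : entire g) (r0 : 0 < r).

Let A := r ^+ 2.
Let B := A + 1.
Let rho := annulus A B.

Let A0 : 0 < A. Proof. by rewrite exprn_gt0. Qed.

Let bk k : exists f, bump B (fun s => rho s * s^-1 ^+ k) f.
Proof. exact: bump_annulusV. Qed.

Let b0 : exists f, bump B rho f.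
Proof. exact: bump_annulus. Qed.

Let term k p := g (cpx p) * (cpx p)^-1 ^+ k * (rho (sq p))%:C.

Let cable_term h k : (forall z, ccont h z) ->
  cable (fun p => h (cpx p) * (cpx p)^-1 ^+ k * (rho (sq p))%:C).
Proof.
move=> /ccont_cont2[c d]; have [f bf] := bk k.
have [c1 c2] := entire_cont2 (@entireX R k).
split.
  apply: eq_pable (pable_bump (cont2D (cont2M c c1) (cont2M d c2)) bf) => p.
  by have [h1 h2] := cpxVX_parts p k; rewrite !ReM !ImM h1 h2 /=; ring.
apply: eq_pable (pable_bump (cont2B (cont2M d c1) (cont2M c c2)) bf) => p.
by have [h1 h2] := cpxVX_parts p k; rewrite !ImM !ReM h1 h2 /=; ring.
Qed.

(** A negative power of z is a conjugated positive power times a radial factor, which goes into the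
    profile. *)
Let cint_power k :
  cint (fun p => 1 * (cpx p)^-1 ^+ k.+1 * (rho (sq p))%:C) = 0.
Proof.
have [f bf] := bk k.+1; have [e1 e2] := pint_monomial k bf.
apply: eq_complexP => /=.
  rewrite -[RHS]e1; apply: eq_pint => p.
  by have [h1 h2] := cpxVX_parts p k.+1; rewrite mul1r ReM h1 /=; ring.
rewrite -[RHS](mulr0 (-1)) -[in RHS]e2 -pintZ; last first.
  by apply: pable_bump bf; case: (entire_cont2 (@entireX R k.+1)).
apply: eq_pint => p.
by have [h1 h2] := cpxVX_parts p k.+1; rewrite mul1r ImM h2 /=; ring.
Qed.

Let m0 := pint (fun p => rho (sq p)).

Let m0_gt0 : 0 < m0.
Proof.
have [f bf] := b0; have c : continuous (fun p : R * R => rho (sq p)).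
  by apply: cont2_comp cont2_sq; exact: bump_continuous bf.
have s : sq (Num.sqrt (A + 2^-1), 0) = A + 2^-1.
  by rewrite /sq /= expr0n addr0 sqr_sqrtr// addr_ge0 ?ltW.
apply: (@pint_gt0 _ _ (Num.sqrt (A + 2^-1), 0)).
- by apply: eq_pable (pable_bump (@cont2c R 1) bf) => p; rewrite mul1r.
- by move=> p; exact: annulus_ge0.
- exact: c.
- by rewrite s; apply: annulus_gt0; rewrite /B; lra.
Qed.

Let out p : rho (sq p) != 0 -> r < modulus (cpx p).
Proof.
apply: contra_neqT; rewrite -leNgt => h; apply: annulus_in.
rewrite -sqr_modulus_cpx /A; apply: lerXn2r => //; rewrite nnegrE ?modulus_ge0//.
exact: ltW.
Qed.

(** For fixed z, the mean of w (g w - g z) / (w - z) over the annulus vanishes. Expanding w / (w -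
    z) in powers of z / w yields the coefficients d k as means of g w / w^k, with a remainder
    carrying the factor (z / w)^(N+1). *)
Lemma cauchy_taylor_aux : exists d : nat -> R[i],
  (exists C : R, forall k, modulus (d k) * r ^+ k <= C) /\
  forall z, modulus z < r -> exists C : R, forall N,
    modulus (psum d N.+1 z - g z) <= C * (modulus z / r) ^+ N.+1.
Proof.
pose d k := cint (term k) / m0%:C.
have mm0 : modulus m0%:C = m0 by rewrite modulus_real gtr0_norm.
have m00 : m0%:C != 0 :> R[i] by rewrite -modulus_eq0 mm0 gt_eqF.
have [f bf] := b0.
exists d; split.
  (* A modulus is dominated by 1 plus its square, whose continuity is already known. *)
  pose b (p : R * R) := (1 + modulus (g (cpx p)) ^+ 2) * rho (sq p).
  have ib : pable b.
    by apply: pable_bump bf; apply: cont2D; [exact: cont2c|exact: entire_cont2_modulus].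
  have bE (p : R * R) : modulus (g (cpx p)) * rho (sq p) <= b p.
    rewrite /b ler_wpM2r ?annulus_ge0//; have := modulus_ge0 (g (cpx p)).
    by have := sqr_ge0 (modulus (g (cpx p)) - 1); set t := modulus _; nra.
  exists (2 * pint b / m0) => k; rewrite modulusM modulusV mm0 mulrAC ler_pM2r ?invr_gt0//.
  rewrite -ler_pdivlMr ?exprn_gt0// mulrC mulrCA -pintZ//.
  apply: modulus_cint; [exact: cable_term (fun z => entire_ccont z eg)|exact: pableZ|].
  move=> p; rewrite /term !modulusM modulusX modulusV modulus_real (ger0_norm (annulus_ge0 _ _ _)).
  have [e|/out rz] := eqVneq (rho (sq p)) 0.
    by rewrite /rho in e; rewrite /b /rho e !mulr0.
  rewrite mulrAC mulrC; apply: ler_pM; rewrite ?exprn_ge0 ?invr_ge0 ?modulus_ge0//.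
    by rewrite mulr_ge0 ?modulus_ge0 ?annulus_ge0.
  by rewrite -exprVn lerXn2r ?nnegrE ?invr_ge0 ?modulus_ge0 ?ltW// ltf_pV2 ?posrE// (lt_trans r0).
move=> z zr; have [K [cK dK KE]] := divided_difference z eg.
have [i1 i2] := pint_holomorphic cK dK bf.
have [cP cQ] := ccont_cont2 cK.
pose v p := cpx p * K (cpx p) * (rho (sq p))%:C.
have iv : cable v.
  have c1 := @cont2_fst R; have c2 := @cont2_snd R; split.
    apply: eq_pable (pable_bump (cont2B (cont2M c1 cP) (cont2M c2 cQ)) bf) => p.
    by rewrite /v !ReM !ImM /=; ring.
  apply: eq_pable (pable_bump (cont2D (cont2M c1 cQ) (cont2M c2 cP)) bf) => p.
  by rewrite /v !ImM !ReM /=; ring.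
have v0 : cint v = 0.
  apply: eq_complexP => /=; [rewrite -[RHS]i1|rewrite -[RHS]i2]; apply: eq_pint => p.
    by rewrite /v [in LHS]ReM /=; ring.
  by rewrite /v [in LHS]ImM /=; ring.
pose b (p : R * R) := (1 + sq p * (complex.Re (K (cpx p)) * complex.Re (K (cpx p)) +
   complex.Im (K (cpx p)) * complex.Im (K (cpx p)))) * rho (sq p).
have ib : pable b.
  apply: pable_bump bf; apply: cont2D; first exact: cont2c.
  by apply: cont2M; [exact: cont2_sq|apply: cont2D; apply: cont2M].
have bE p : modulus (v p) <= b p.
  rewrite /v /b !modulusM modulus_real (ger0_norm (annulus_ge0 _ _ _)) ler_wpM2r ?annulus_ge0//.
  rewrite -!expr2 -sqr_modulus -sqr_modulus_cpx -exprMn.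
  have := sqr_ge0 (modulus (cpx p) * modulus (K (cpx p)) - 1).
  have : 0 <= modulus (cpx p) * modulus (K (cpx p)) by rewrite mulr_ge0 ?modulus_ge0.
  by set t := _ * _; nra.
exists (2 * pint b / m0) => N.
pose q := modulus z / r.
(* With x = z / w, the relation x^(N+1) = 1 + (x - 1) S turns this into v minus the polynomial
   terms, as (x - 1) v = - (g w - g z) rho. *)
pose rem p := (z * (cpx p)^-1) ^+ N.+1 * v p.
have remE p : rem p = v p - \sum_(k < N.+1) (z ^+ k * term k p) +
    g z * \sum_(k < N.+1) z ^+ k * (1 * (cpx p)^-1 ^+ k * (rho (sq p))%:C).
  rewrite /rem /term /v; have [->|/out rp] := eqVneq (rho (sq p)) 0.
    by rewrite !mulr0 !big1 ?mulr0 ?subrr ?addr0// => k _; rewrite !mulr0.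
  have p0 : cpx p != 0 by rewrite -modulus_gt0 (lt_trans r0).
  have pz : cpx p - z != 0.
    by rewrite subr_eq0; apply: contraTneq zr => <-; rewrite -leNgt ltW.
  have Kz : K (cpx p) = (g (cpx p) - g z) / (cpx p - z) by rewrite -KE mulrAC mulfV// mul1r.
  pose x := z * (cpx p)^-1.
  rewrite (eq_bigr (fun k : 'I_N.+1 => g (cpx p) * (rho (sq p))%:C * x ^+ k)); last first.
    by move=> k _; rewrite /x exprMn; ring.
  rewrite [in X in _ + g z * X](eq_bigr (fun k : 'I_N.+1 => (rho (sq p))%:C * x ^+ k)); last first.
    by move=> k _; rewrite /x exprMn; ring.
  rewrite -!mulr_sumr; set S := \sum_(k < _) _.
  have SE : x ^+ N.+1 = 1 + (x - 1) * S by rewrite /S -subrX1 addrC subrK.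
  by rewrite Kz -/x SE /x; field; rewrite pz p0.
have it k : cable (fun p => z ^+ k * term k p).
  by apply: cableZ; exact: cable_term (fun z => entire_ccont z eg).
have io' k := cable_term k (h := fun=> 1) (fun z => entire_ccont z (@entire_cst R 1)).
have io k : cable (fun p => z ^+ k * (1 * (cpx p)^-1 ^+ k * (rho (sq p))%:C)).
  by apply: cableZ; exact: io'.
have h1 := cable_sum (index_enum 'I_N.+1) (fun k : 'I_N.+1 => it k).
have h2 := cable_sum (index_enum 'I_N.+1) (fun k : 'I_N.+1 => io k).
have remI : cint rem = m0%:C * (g z - psum d N.+1 z).
  rewrite (eq_cint remE); under eq_cint do rewrite -mulN1r.
  rewrite cintD; [|exact: cableD iv (cableZ (-1) h1)|exact: cableZ h2].
  rewrite cintD// ?cintZ// ?v0 ?add0r; last exact: cableZ.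
  (* Among the powers w^(-k) only k = 0 has nonzero mean. *)
  rewrite !cint_sum// [X in g z * X]big_ord_recl [X in _ + g z * (_ + X)]big1 ?addr0; last first.
    by move=> k _; rewrite cintZ ?cint_power ?mulr0//; exact: io'.
  have -> : cint (fun p => z ^+ 0 * (1 * (cpx p)^-1 ^+ 0 * (rho (sq p))%:C)) = m0%:C.
    rewrite (eq_cint (k := fun p => (rho (sq p))%:C)); first by rewrite /cint /= pint0.
    by move=> p; rewrite !expr0 !mul1r.
  rewrite mulrBr mulN1r addrC [g z * _]mulrC; congr (_ - _).
  rewrite /psum mulr_sumr; apply: eq_bigr => k _.
  rewrite cintZ; last by exact: cable_term (fun z => entire_ccont z eg).
  by rewrite /d; field.
have irem : cable rem.
  apply: eq_cable (cableD (cableD iv (cableZ (- 1) h1)) (cableZ (g z) h2)) => p.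
  by rewrite remE mulN1r.
have mrem p : modulus (rem p) <= q ^+ N.+1 * b p.
  have [e|/out rp] := eqVneq (rho (sq p)) 0.
    by rewrite /rem /v /b e !mulr0 modulus0.
  rewrite /rem modulusM modulusX; apply: ler_pM; rewrite ?exprn_ge0 ?modulus_ge0//.
  have q0 : 0 <= q by rewrite divr_ge0 ?modulus_ge0 ?ltW.
  apply: lerXn2r; rewrite ?nnegrE ?modulus_ge0//.
  rewrite modulusM modulusV /q; apply: ler_wpM2l; first exact: modulus_ge0.
  by rewrite lef_pV2 ?posrE ?(ltW rp)//; exact: lt_trans rp.
have := modulus_cint irem (pableZ (q ^+ N.+1) ib) mrem.
rewrite remI modulusM mm0 pintZ// => h.
rewrite -modulusN opprB mulrAC ler_pdivlMr// [leLHS]mulrC; apply: (le_trans h).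
by rewrite -[leRHS]mulrA [_ * q ^+ _]mulrC.
Qed.

End CauchyEstimate.

Lemma sum_geometric (q : R) N : 0 <= q -> q < 1 -> \sum_(k < N) q ^+ k <= (1 - q)^-1.
Proof.
move=> q0 q1; rewrite -[leRHS]mul1r ler_pdivlMr ?subr_gt0//.
have := subrX1 q N; set S := \sum_(_ < _) _ => e.
have : 0 <= q ^+ N by rewrite exprn_ge0.
lra.
Qed.

Lemma ccvg_geometric (u : nat -> R[i]) (l : R[i]) (C q : R) : 0 <= q -> q < 1 ->
  (forall N, modulus (u N.+1 - l) <= C * q ^+ N.+1) -> ccvg u l.
Proof.
move=> q0 q1 H.
have c0 : (fun N => C * q ^+ N.+1) @ \oo --> (0 : R).
  rewrite -(mulr0 C); apply: cvgM; first exact: cvg_cst.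
  by rewrite (cvg_shiftS (fun n => q ^+ n)); apply: cvg_expr; rewrite ger0_norm.
split; rewrite -cvg_shiftS.
  apply/cvgrPdist_le => e e0; have /cvgrPdist_le/(_ e e0) := c0.
  apply: filterS => N; rewrite sub0r normrN => h.
  rewrite distrC -ReB (le_trans (ler_Re_modulus _))// (le_trans (H N))//.
  exact: le_trans (ler_norm _) h.
apply/cvgrPdist_le => e e0; have /cvgrPdist_le/(_ e e0) := c0.
apply: filterS => N; rewrite sub0r normrN => h.
rewrite distrC -ImB (le_trans (ler_Im_modulus _))// (le_trans (H N))//.
exact: le_trans (ler_norm _) h.
Qed.

Lemma taylor_disc g r : entire g -> 0 < r -> exists a : nat -> R[i], pser a g r.
Proof.
move=> eg r0; have [d [[C CP] dP]] := cauchy_taylor_aux eg r0.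
exists d => z zr; pose q := modulus z / r.
have q0 : 0 <= q by rewrite divr_ge0 ?modulus_ge0 ?ltW.
have q1 : q < 1 by rewrite ltr_pdivrMr ?mul1r.
have C0 : 0 <= C by apply: le_trans (CP 0%N); rewrite mulr_ge0 ?modulus_ge0.
split; last by have [C' C'P] := dP z zr; exact: ccvg_geometric C'P.
exists (C * (1 - q)^-1) => N; apply: le_trans (ler_wpM2l C0 (sum_geometric N q0 q1)).
rewrite mulr_sumr; apply: ler_sum => k _; rewrite /q expr_div_n mulrA.
by rewrite ler_pdivlMr ?exprn_gt0// mulrAC ler_wpM2r ?exprn_ge0 ?modulus_ge0.
Qed.

(** The coefficients found on the unit disc agree with those of every larger disc, by uniqueness. *)
Lemma taylor g : entire g -> exists a : nat -> R[i], forall r, pser a g r.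
Proof.
move=> eg; have [a ag] := taylor_disc eg ltr01; exists a => r.
pose r' := Num.max 1 r; have r'0 : 0 < r' by rewrite lt_max ltr01.
have [b bg] := taylor_disc eg r'0.
have -> : a = b.
  by apply: pser_unique ltr01 ag _; apply: pser_le bg; rewrite le_max lexx.
by apply: pser_le bg; rewrite le_max lexx orbT.
Qed.

End Taylor.

(** * Everywhere convergent power series are entire *)

Section GlobalSeries.
Context {R : realType}.
Implicit Types (g h : R[i] -> R[i]) (z w : R[i]) (a b : nat -> R[i]) (r : R).

Definition gser a g := forall r : R, pser a g r.

Lemma gser_bound a g r : gser a g -> 0 <= r ->
  exists B : R, forall N, \sum_(k < N) modulus (a k) * r ^+ k <= B.
Proof.
move=> ag r0; have [|[B BP] _] := ag (r + 1) r%:C.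
  by rewrite modulus_real ger0_norm//; lra.
by exists B => N; have := BP N; rewrite modulus_real ger0_norm.
Qed.

Lemma gser_cvg a g z : gser a g -> ccvg (fun N => psum a N z) (g z).
Proof. by move=> ag; have [|_] := ag (modulus z + 1) z; [lra|]. Qed.

Lemma gser_lin c a b g h : gser a g -> gser b h ->
  gser (fun k => c * a k + b k) (fun z => c * g z + h z).
Proof. by move=> ag bh r; apply: pser_lin. Qed.

Lemma gser_unique a b g : gser a g -> gser b g -> a = b.
Proof. by move=> ag bg; exact: pser_unique ltr01 (ag 1) (bg 1). Qed.

Lemma ccvg_unique (u : nat -> R[i]) x y : ccvg u x -> ccvg u y -> x = y.
Proof.
move=> [a1 a2] [b1 b2]; apply: eq_complexP.
  exact: (cvg_unique (@Rhausdorff R) a1 b1).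
exact: (cvg_unique (@Rhausdorff R) a2 b2).
Qed.

Lemma gser_inj a g h : gser a g -> gser a h -> g = h.
Proof.
by move=> ag ah; apply/funext => z; exact: ccvg_unique (gser_cvg z ag) (gser_cvg z ah).
Qed.

Lemma abs_ccvg (u : nat -> R[i]) (B : R) :
  (forall N, \sum_(k < N) modulus (u k) <= B) ->
  exists l, ccvg (fun N => \sum_(k < N) u k) l.
Proof.
move=> uB; have key (v : nat -> R) : (forall k, `|v k| <= modulus (u k)) ->
    exists l : R, (fun N => \sum_(k < N) v k) @ \oo --> l.
  move=> vu; exists (limn (series v)).
  rewrite (_ : (fun N => _) = series v); last first.
    by apply/funext => N; rewrite /series/= big_mkord.
  suff h : cvgn (series v) by [].
  apply: normed_cvg; apply: nondecreasing_is_cvgn.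
    apply/nondecreasing_seqP => N. rewrite /normed_series_of /series/= !big_mkord big_ord_recr/= lerDl.
    exact: normr_ge0.
  exists B => _ [N _ <-]; rewrite /normed_series_of /series/= big_mkord; apply: le_trans (uB N).
  by apply: ler_sum => k _; exact: vu.
have [x xP] := key (fun k => complex.Re (u k)) (fun k => ler_Re_modulus _).
have [y yP] := key (fun k => complex.Im (u k)) (fun k => ler_Im_modulus _).
by exists (x +i* y); split => /=; [under eq_fun do rewrite Re_sum|under eq_fun do rewrite Im_sum].
Qed.

Lemma gser_exists a : (forall r, 0 <= r ->
    exists B : R, forall N, \sum_(k < N) modulus (a k) * r ^+ k <= B) ->
  exists g, gser a g.
Proof.
move=> aB; have key z : exists l, ccvg (fun N => psum a N z) l.
  have [B BP] := aB _ (modulus_ge0 z).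
  apply: (abs_ccvg (u := fun k => a k * z ^+ k) (B := B)) => N; apply: le_trans (BP N).
  by apply: ler_sum => k _; rewrite modulusM modulusX.
exists (fun z => xget 0 [set l | ccvg (fun N => psum a N z) l]) => r z zr.
split; first exact: aB (modulus_ge0 z).
by have [l lP] := key z; case: xgetP => // /(_ l); apply.
Qed.

Lemma modulus_ccvg_le (u : nat -> R[i]) (l : R[i]) (B : R) : ccvg u l ->
  (forall n, modulus (u n) <= B) -> modulus l <= B.
Proof.
move=> [c1 c2] uB; have B0 : 0 <= B by apply: le_trans (uB 0%N); exact: modulus_ge0.
rewrite -ler_sqr ?nnegrE ?modulus_ge0// sqr_modulus !expr2.
have c : (fun n => complex.Re (u n) * complex.Re (u n) + complex.Im (u n) * complex.Im (u n))
   @ \oo --> complex.Re l * complex.Re l + complex.Im l * complex.Im l.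
  by apply: cvgD; apply: cvgM.
apply: (cvgr_to_le c); near=> n.
rewrite -!expr2 -sqr_modulus.
by apply: lerXn2r => //; rewrite nnegrE ?modulus_ge0.
Unshelve. all: by end_near. Qed.

(** Enlarging the radius from |z| to |z| + 2 absorbs the factor k of the derived series and the
    quadratic remainders, so absolute convergence at that one radius serves both. *)
Let mulrn_exp_le (x : R) k : 0 <= x -> k%:R * x ^+ k.-1 <= (x + 2) ^+ k.
Proof.
move=> x0; elim: k => [|k ih]; first by rewrite mul0r expr0.
have x2 : x ^+ k <= (x + 2) ^+ k.
  by apply: lerXn2r; rewrite ?nnegrE; lra.
have h : x * (k%:R * x ^+ k.-1) = k%:R * x ^+ k.
  by case: k {ih x2} => [|k]; rewrite ?mul0r ?mulr0// exprS mulrCA.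
have h' := ler_wpM2l x0 ih; rewrite h in h'.
rewrite [k.+1.-1]/= -natr1 mulrDl mul1r exprS; apply: (le_trans (lerD h' x2)).
have : 0 <= (x + 2) ^+ k by rewrite exprn_ge0//; lra.
lra.
Qed.

Let taylor_remainder z w k : modulus w <= 1 ->
  modulus ((z + w) ^+ k - z ^+ k - k%:R * z ^+ k.-1 * w) <= modulus w ^+ 2 * (modulus z + 2) ^+ k.
Proof.
move=> w1; elim: k => [|k ih].
  by rewrite !expr0 subrr sub0r !mul0r oppr0 modulus0 mulr1 sqr_ge0.
have -> : (z + w) ^+ k.+1 - z ^+ k.+1 - k.+1%:R * z ^+ k.+1.-1 * w =
   (z + w) * ((z + w) ^+ k - z ^+ k - k%:R * z ^+ k.-1 * w) + k%:R * z ^+ k.-1 * w ^+ 2.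
  have h : z * (k%:R * z ^+ k.-1) = k%:R * z ^+ k.
    by case: k {ih} => [|k]; rewrite ?mul0r ?mulr0// exprS mulrCA.
  rewrite [k.+1.-1]/= !exprS -natr1 !mulrBr.
  rewrite (_ : (z + w) * (k%:R * z ^+ k.-1 * w) = (z * (k%:R * z ^+ k.-1)) * w + k%:R * z ^+ k.-1 * w ^+ 2); last by ring.
  by rewrite h; ring.
have zw := modulusD z w; have z0 := modulus_ge0 z.
apply: (le_trans (modulusD _ _)); rewrite !modulusM !modulusX.
have -> : modulus (k%:R : R[i]) = k%:R.
  by rewrite (_ : k%:R = (k%:R : R)%:C) ?modulus_real ?normr_nat// rmorph_nat.
have h1 : modulus (z + w) * modulus ((z + w) ^+ k - z ^+ k - k%:R * z ^+ k.-1 * w) <=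
    (modulus z + 1) * (modulus w ^+ 2 * (modulus z + 2) ^+ k).
  by apply: ler_pM; rewrite ?modulus_ge0//; lra.
have h2 := ler_wpM2r (sqr_ge0 (modulus w)) (mulrn_exp_le k z0).
apply: (le_trans (lerD h1 h2)); rewrite [_ ^+ k.+1]exprS.
by rewrite le_eqVlt; apply/orP; left; apply/eqP; ring.
Qed.

(** Termwise, the second-order remainder at z is at most |w|^2 (|z| + 2)^k, hence at most B |w|^2
    for the sum. *)
Lemma gser_entire a g : gser a g -> entire g.
Proof.
move=> ag z; apply/derivable_cderivP.
have z2 : 0 <= modulus z + 2 by rewrite addr_ge0 ?modulus_ge0.
have [B BP] := gser_bound ag z2.
have B0 : 0 <= B by apply: le_trans (BP 0%N); rewrite big_ord0.
have [|c cP] := @abs_ccvg (fun k => a k * (k%:R * z ^+ k.-1)) B.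
  move=> N; apply: le_trans (BP N); apply: ler_sum => k _.
  rewrite !modulusM modulusX (_ : modulus k%:R = k%:R); last first.
    by rewrite (_ : k%:R = (k%:R : R)%:C) ?modulus_real ?normr_nat// rmorph_nat.
  by rewrite ler_wpM2l ?modulus_ge0// mulrn_exp_le ?modulus_ge0.
exists c => e e0; exists (Num.min 1 (e / (B + 1))).
  by rewrite lt_min ltr01 divr_gt0//; lra.
move=> w; rewrite lt_min => /andP[w1 we].
have cv := ccvgD (ccvgD (gser_cvg (z + w) ag) (ccvgZ (-1) (gser_cvg z ag))) (ccvgZ (- w) cP).
have := modulus_ccvg_le (B := modulus w ^+ 2 * B) cv.
rewrite mulN1r mulNr [w * c]mulrC => h; apply: (le_trans (h _)) => [N|].
  rewrite [X in modulus X](_ : _ = \sum_(k < N) a k * ((z + w) ^+ k - z ^+ k - k%:R * z ^+ k.-1 * w)).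
    apply: le_trans (modulus_sum _ _) _.
    apply: le_trans (ler_wpM2l (sqr_ge0 (modulus w)) (BP N)).
    rewrite mulr_sumr; apply: ler_sum => k _; rewrite modulusM mulrCA.
    by rewrite ler_wpM2l ?modulus_ge0// taylor_remainder// ltW.
  rewrite mulN1r /psum mulr_sumr -sumrB -big_split; apply: eq_bigr => k _ /=.
  by ring.
rewrite expr2 -mulrA mulrC; apply: ler_wpM2r; first exact: modulus_ge0.
rewrite ltr_pdivlMr in we; last by lra.
by have := modulus_ge0 w; lra.
Qed.

Lemma entire_gser g : entire g -> exists a, gser a g.
Proof. exact: taylor. Qed.

End GlobalSeries.

(** * Parseval's identity for a weight without compact support *)

Section WeightedParseval.
Context {R : realType}.
Implicit Types (g h : R[i] -> R[i]) (a b : nat -> R[i]).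

Lemma pable_abs (u : R * R -> R) : pable u -> pable (fun p => `|u p|).
Proof. by move=> iu; apply: eq_integrable (integrable_abse iu). Qed.

Lemma pable_monotone (u_ : nat -> R * R -> R) (u : R * R -> R) (B : R) :
  (forall n, pable (u_ n)) -> (forall n p, 0 <= u_ n p) ->
  (forall p, nondecreasing_seq (u_ ^~ p)) -> (forall p, u_ ^~ p @ \oo --> u p) ->
  (forall n, pint (u_ n) <= B) -> pable u.
Proof.
move=> iu u0 nd cu uB.
have mu : pmeas u.
  by apply: (measurable_fun_cvg (fun n => pable_pmeas (iu n))) => p _; exact: cu.
have u0' p : 0 <= u p.
  by apply: (cvgr_to_ge (cu p)); apply: nearW => n; exact: u0.
apply/(pable_ge0P mu u0').
have m1 n : measurable_fun setT (EFin \o u_ n).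
  by apply/measurable_EFinP; exact: pable_pmeas (iu n).
have h := @cvg_monotone_convergence _ _ R (@area R) setT measurableT
  (fun n => EFin \o u_ n) m1.
have {}h : (\int[@area R]_p (u_ n p)%:E)%E @[n --> \oo] --> (\int[@area R]_p (u p)%:E)%E.
  rewrite (_ : (\int[@area R]_p (u p)%:E)%E = (\int[@area R]_(p in setT) limn (fun n => (u_ n p)%:E))%E).
    apply: h; first by move=> n p _; rewrite lee_fin.
    by move=> p _ n m nm; rewrite lee_fin; exact: nd.
  apply: eq_integral => p _; apply/esym/cvg_lim => //.
  by apply/fine_cvgP; split; [exact: nearW|exact: cu].
have : (\int[@area R]_p (u p)%:E <= B%:E)%E.
  rewrite -(cvg_lim _ h)//; apply: lime_le; first exact: cvgP h.
  by apply: nearW => n; rewrite pintE// lee_fin.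
by move=> /le_lt_trans; apply; exact: ltry.
Qed.

Lemma cutoff_cvg1 (s : R) : (fun n => cutoff n.+1%:R s) @ \oo --> (1 : R).
Proof.
have h0 : (fun n => n.+1%:R^-1 * s) @ \oo --> (0 * s : R).
  by apply: cvgM; [exact: cvg_harmonic|exact: cvg_cst].
have h : (fun n => 1 - n.+1%:R^-1 * s) @ \oo --> (1 - 0 * s : R).
  by apply: cvgB => //; exact: cvg_cst.
have c : {for (1 - 0 * s), continuous (fun t : R => Num.max 0 t ^+ 2)}.
  exact: (c1_continuous (@c1_sqmax R)).
have := cvg_comp _ _ h c.
by rewrite mul0r subr0 (max_r ler01) expr1n; apply.
Qed.

Variables (W W' : R -> R).
Hypothesis cW : c1 W W'.
Hypothesis W0 : forall s, 0 <= W s.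
Hypothesis iW : forall k, pable (fun p : R * R => sq p ^+ k * W (sq p)).

Definition moment k := pint (fun p : R * R => sq p ^+ k * W (sq p)).

Lemma moment_ge0 k : 0 <= moment k.
Proof. by apply: pint_ge0 => p; rewrite mulr_ge0 ?exprn_ge0 ?W0 ?sq_ge0. Qed.

Let rho n s := cutoff n.+1%:R s * W s.

Let bump_rho n : exists f, bump n.+1%:R (rho n) f.
Proof. by eexists; apply: bumpM cW; apply: bump_cutoff. Qed.

Let rho_ge0 n s : 0 <= rho n s.
Proof. by rewrite mulr_ge0 ?cutoff_ge0. Qed.

Let rho_le n s : 0 <= s -> rho n s <= W s.
Proof. by move=> s0; rewrite -[leRHS]mul1r ler_wpM2r// cutoff_le1. Qed.

Let rho_nd s : 0 <= s -> nondecreasing_seq (rho ^~ s).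
Proof.
by move=> s0 m n mn; rewrite ler_wpM2r// cutoff_homo// ler_nat ltnS.
Qed.

Let rho_cvg s : rho ^~ s @ \oo --> W s.
Proof. by rewrite -[W s]mul1r; apply: cvgM; [exact: cutoff_cvg1|exact: cvg_cst]. Qed.

Let trunc_cvg (u : R * R -> R) p : (fun n => u p * rho n (sq p)) @ \oo --> u p * W (sq p).
Proof. by apply: cvgM; [exact: cvg_cst|exact: rho_cvg]. Qed.

Let pint_trunc (u : R * R -> R) : pmeas u -> pable (fun p => u p * W (sq p)) ->
  (fun n => pint (fun p => u p * rho n (sq p))) @ \oo --> pint (fun p => u p * W (sq p)).
Proof.
move=> mu iu; have iu' : pable (fun p => `|u p * W (sq p)|).
  exact: pable_abs iu.
have h n : pmeas (fun p => u p * rho n (sq p)).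
  have [f bf] := bump_rho n; apply: pmeasM => //.
  apply: pmeas_compc (@pmeas_sq R); exact: bump_continuous bf.
have bd n p : `|u p * rho n (sq p)| <= `|u p * W (sq p)|.
  by rewrite 2!(normrM (u p)) ler_wpM2l// (ger0_norm (rho_ge0 _ _)) (ger0_norm (W0 _)) rho_le// sq_ge0.
have [_] := @pint_dct R (fun n p => u p * rho n (sq p)) _ _ h (@trunc_cvg u) bd iu'.
exact.
Qed.

Let cut_parseval a g n : gser a g ->
  (fun N => \sum_(k < N) modulus (a k) ^+ 2 * pint (fun p => sq p ^+ k * rho n (sq p))) @ \oo -->
  pint (fun p => modulus (g (cpx p)) ^+ 2 * rho n (sq p)).
Proof.
move=> ag; have [f bf] := bump_rho n.
apply: (@parseval_bump R a g n.+1%:R (n.+1%:R + 1) n.+1%:R (rho n) f bf (rho_ge0 n)) => //.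
- lra.
- by rewrite expr2 ler_peMr// ler1n.
- by apply: continuous2_measurable; exact: entire_cont2_modulus (gser_entire ag).
Qed.

Let cut_moment_ge0 n k : 0 <= pint (fun p => sq p ^+ k * rho n (sq p)).
Proof. by apply: pint_ge0 => p; rewrite mulr_ge0// exprn_ge0// sq_ge0. Qed.

Let pmeas_sqX k : pmeas (fun p : R * R => sq p ^+ k).
Proof. by apply: pmeasX; exact: pmeas_sq. Qed.

Let pable_cut (u : R * R -> R) n : continuous u -> pable (fun p => u p * rho n (sq p)).
Proof. by move=> cu; have [f bf] := bump_rho n; exact: pable_bump cu bf. Qed.

Let cut_moment_le n k : pint (fun p => sq p ^+ k * rho n (sq p)) <= moment k.
Proof.
apply: le_pint => //.
  apply: pable_cut; apply: (cont2_comp (h := fun s => s ^+ k)); last exact: cont2_sq.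
  exact: exprn_continuous.
by move=> p; rewrite ler_wpM2l ?exprn_ge0 ?sq_ge0// rho_le// sq_ge0.
Qed.

(** Parseval's identity for the cut weight bounds all cut integrals by B, and they increase to the
    full one. *)
Lemma parseval_bounded a g (B : R) : gser a g ->
  (forall N, \sum_(k < N) modulus (a k) ^+ 2 * moment k <= B) ->
  pable (fun p => modulus (g (cpx p)) ^+ 2 * W (sq p)).
Proof.
move=> ag aB; have cg := entire_cont2_modulus (gser_entire ag).
apply: (@pable_monotone (fun n p => modulus (g (cpx p)) ^+ 2 * rho n (sq p)) _ B).
- by move=> n; exact: pable_cut.
- by move=> n p; rewrite mulr_ge0// sqr_ge0.
- by move=> p m n mn; rewrite ler_wpM2l ?sqr_ge0// rho_nd// sq_ge0.
- exact: trunc_cvg.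
- move=> n; apply: (cvgr_to_le (@cut_parseval _ _ n ag)); apply: nearW => N.
  apply: le_trans (aB N); apply: ler_sum => k _.
  by rewrite ler_wpM2l ?sqr_ge0.
Qed.

(** Two increasing limits are exchanged, the cutoff radius and the number of terms; each inequality
    fixes one index and lets the other grow. *)
Lemma parseval a g : gser a g ->
  pable (fun p => modulus (g (cpx p)) ^+ 2 * W (sq p)) ->
  (fun N => \sum_(k < N) modulus (a k) ^+ 2 * moment k) @ \oo -->
  pint (fun p => modulus (g (cpx p)) ^+ 2 * W (sq p)).
Proof.
move=> ag ig; have cg := entire_cont2_modulus (gser_entire ag).
have mg := continuous2_measurable cg.
set S := (X in X @ _ --> _); set I := pint _.
have ndS : nondecreasing_seq S.
  apply/nondecreasing_seqP => N; rewrite /S big_ord_recr/= lerDl.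
  by rewrite mulr_ge0 ?sqr_ge0// moment_ge0.
have SI N : S N <= I.
  have c : (fun n => \sum_(k < N) modulus (a k) ^+ 2 * pint (fun p => sq p ^+ k * rho n (sq p)))
      @ \oo --> S N.
    rewrite /S; elim: N => [|N ih].
      by under eq_fun do rewrite big_ord0; rewrite big_ord0; exact: cvg_cst.
    under eq_fun do rewrite big_ord_recr/=.
    rewrite big_ord_recr/=; apply: cvgD => //; apply: cvgM; first exact: cvg_cst.
    exact: pint_trunc.
  apply: (cvgr_to_le c); apply: nearW => n.
  have h := @cut_parseval _ _ n ag; have hc := cvgP _ h.
  have nd : nondecreasing_seq (fun N =>
      \sum_(k < N) modulus (a k) ^+ 2 * pint (fun p => sq p ^+ k * rho n (sq p))).
    by apply/nondecreasing_seqP => M; rewrite big_ord_recr/= lerDl mulr_ge0 ?sqr_ge0.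
  have := nondecreasing_cvgn_le nd hc N; rewrite (cvg_lim _ h)// => /le_trans; apply.
  apply: le_pint => //; first exact: pable_cut.
  by move=> p; rewrite ler_wpM2l ?sqr_ge0// rho_le// sq_ge0.
have cS : cvgn S.
  by apply: nondecreasing_is_cvgn => //; exists I => _ [N _ <-].
have -> : I = limn S; last by [].
apply/eqP; rewrite eq_le; apply/andP; split; last by apply: limr_le => //; exact: nearW.
apply: (cvgr_to_le (@pint_trunc _ mg ig)); apply: nearW => n.
apply: (cvgr_to_le (@cut_parseval _ _ n ag)); apply: nearW => N.
apply: le_trans (nondecreasing_cvgn_le ndS cS N); apply: ler_sum => k _.
by rewrite ler_wpM2l ?sqr_ge0.
Qed.

Lemma sqr_modulusB_le z w : modulus (z - w) ^+ 2 <= 2 * modulus z ^+ 2 + 2 * modulus w ^+ 2 :> R.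
Proof.
rewrite !sqr_modulus ReB ImB; have := sqr_ge0 (complex.Re z + complex.Re w).
by have := sqr_ge0 (complex.Im z + complex.Im w); nra.
Qed.

Lemma polarization (z w : R[i]) :
  complex.Re (z * w^*) = 4^-1 * (modulus (z + w) ^+ 2 - modulus (z - w) ^+ 2).
Proof.
by rewrite !sqr_modulus ReB ImB ReD ImD ReM; case: z => x y; case: w => u v /=; field.
Qed.

Let pable_lin g h : entire g -> entire h ->
  pable (fun p => modulus (g (cpx p)) ^+ 2 * W (sq p)) ->
  pable (fun p => modulus (h (cpx p)) ^+ 2 * W (sq p)) ->
  pable (fun p => modulus (g (cpx p) - h (cpx p)) ^+ 2 * W (sq p)).
Proof.
move=> eg eh ig ih; apply: (le_pable (v := fun p =>
    2 * (modulus (g (cpx p)) ^+ 2 * W (sq p)) + 2 * (modulus (h (cpx p)) ^+ 2 * W (sq p)))).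
- apply: pmeasM; last by apply: pmeas_compc (@pmeas_sq R); exact: c1_continuous cW.
  have [c1 c2] := entire_cont2 eg; have [d1 d2] := entire_cont2 eh.
  rewrite (_ : (fun p => _) = fun p => (complex.Re (g (cpx p)) - complex.Re (h (cpx p))) ^+ 2
     + (complex.Im (g (cpx p)) - complex.Im (h (cpx p))) ^+ 2).
    by apply: pmeasD; apply: pmeasX; apply: pmeasB; exact: continuous2_measurable.
  by apply/funext => p; rewrite sqr_modulus ReB ImB.
- move=> p /=; rewrite ger0_norm; last by rewrite mulr_ge0 ?sqr_ge0.
  apply: le_trans (ler_wpM2r (W0 (sq p)) (sqr_modulusB_le _ _)) _.
  by rewrite le_eqVlt; apply/orP; left; apply/eqP; ring.
- by apply: pableD; exact: pableZ.
Qed.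

Definition cvg_inner a b (I : R) := 
  (fun N => \sum_(k < N) complex.Re (a k * (b k)^*%C) * moment k) @ \oo --> I.

Lemma parseval_inner a b g h : gser a g -> gser b h ->
  pable (fun p => modulus (g (cpx p)) ^+ 2 * W (sq p)) ->
  pable (fun p => modulus (h (cpx p)) ^+ 2 * W (sq p)) ->
  pable (fun p => complex.Re (g (cpx p) * (h (cpx p))^*%C) * W (sq p)) /\
  cvg_inner a b (pint (fun p => complex.Re (g (cpx p) * (h (cpx p))^*%C) * W (sq p))).
Proof.
move=> ag bh ig ih; have eg := gser_entire ag; have eh := gser_entire bh.
have agD := gser_lin 1 ag bh.
have agB := gser_lin (- 1) bh ag.
have iB := pable_lin eg eh ig ih.
have eNh : entire (fun z => - h z).
  have := entireM (@entire_cst R (-1)) eh.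
  by rewrite (_ : (fun z => _) = fun z => - h z)//; apply/funext => z; rewrite mulN1r.
have iNh : pable (fun p => modulus (- h (cpx p)) ^+ 2 * W (sq p)).
  by apply: eq_pable ih => p; rewrite modulusN.
have iD := pable_lin eg eNh ig iNh.
have iD' : pable (fun p => modulus (1 * g (cpx p) + h (cpx p)) ^+ 2 * W (sq p)).
  by apply: eq_pable iD => p; rewrite mul1r opprK.
have iB' : pable (fun p => modulus (-1 * h (cpx p) + g (cpx p)) ^+ 2 * W (sq p)).
  by apply: eq_pable iB => p; rewrite mulN1r addrC.
have e (p : R * R) : 4^-1 * (modulus (1 * g (cpx p) + h (cpx p)) ^+ 2 * W (sq p)
     - modulus (-1 * h (cpx p) + g (cpx p)) ^+ 2 * W (sq p)) =
   complex.Re (g (cpx p) * (h (cpx p))^*) * W (sq p).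
  by rewrite polarization mulN1r mul1r [- _ + _]addrC; ring.
rewrite /cvg_inner; split; first by apply: eq_pable e _; apply: pableZ; exact: pableB.
rewrite -(eq_pint e) pintZ; last exact: pableB.
rewrite pintB//.
rewrite (_ : (fun N => _) = fun N => 4^-1 *
   (\sum_(k < N) modulus (1 * a k + b k) ^+ 2 * moment k -
    \sum_(k < N) modulus (-1 * b k + a k) ^+ 2 * moment k)).
  apply: cvgM; first exact: cvg_cst.
  by apply: cvgB; [exact: (@parseval _ _ agD iD')|exact: (@parseval _ _ agB iB')].
apply/funext => N; rewrite -sumrB mulr_sumr; apply: eq_bigr => k _.
by rewrite polarization mulN1r mul1r [- _ + _]addrC; ring.
Qed.

End WeightedParseval.

(** * Euler's identity without compact support *)

Section EulerGlobal.
Context {R : realType}.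

Lemma c1_comp (h h' f f' : R -> R) : c1 h h' -> c1 f f' ->
  c1 (fun s => h (f s)) (fun s => h' (f s) * f' s).
Proof.
move=> ch cf; have cf0 := c1_continuous cf; move: ch cf => [ch dh] [cf df].
split=> s; last first.
  have d1 := dh (f s); have d2 := df s.
  exact: (is_derive1_comp (f := h) (g := f)).
apply: cvgM; last exact: cf.
by apply: (continuous_comp (f := f) (g := h')); [exact: cf0|exact: ch].
Qed.

(** The cutoff adds the term s c_n'(s) Psi. Its factor is -2 y max (0, 1 - y) with y = s / (n + 1):
    uniformly bounded and tending to 0 pointwise, so dominated convergence removes it. *)
Lemma pint_euler_global (Psi Psi' : R -> R) : c1 Psi Psi' ->
  pable (fun p : R * R => Psi (sq p)) -> pable (fun p : R * R => sq p * Psi' (sq p)) ->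
  pint (fun p : R * R => Psi (sq p) + sq p * Psi' (sq p)) = 0.
Proof.
move=> cP iP iP'; have cP0 := c1_continuous cP; have [cP' _] := cP.
pose r n : R := n.+1%:R; have r0 n : 0 < r n by [].
pose c' n s : R := - (r n)^-1 * (2 * Num.max 0 (1 - (r n)^-1 * s)).
pose F n s := cutoff (r n) s * Psi s + s * (c' n s * Psi s + cutoff (r n) s * Psi' s).
have F0 n : pint (fun p : R * R => F n (sq p)) = 0.
  exact: pint_euler (bumpM (bump_cutoff (r0 n)) cP).
have sc0 (s : R) n : 0 <= s -> `|s * c' n s| <= 1.
  move=> s0; rewrite /c' normrM mulNr normrN mulrCA.
  have y0 : 0 <= (r n)^-1 * s by rewrite mulr_ge0// invr_ge0 ltW.
  rewrite -normrM (_ : s * _ = 2 * ((r n)^-1 * s) * Num.max 0 (1 - (r n)^-1 * s)); last by ring.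
  move: y0; set y := (r n)^-1 * s => y0.
  rewrite ger0_norm; last by apply: mulr_ge0; [exact: mulr_ge0|rewrite le_max lexx].
  have [y1|y1] := leP 1 y; first by rewrite max_l ?subr_le0// mulr0.
  by rewrite max_r ?subr_ge0 ?ltW//; have := sqr_ge0 (y - 2^-1); nra.
have cr s : (fun n => (r n)^-1 * s) @ \oo --> (0 * s : R).
  by apply: cvgM; [exact: cvg_harmonic|exact: cvg_cst].
have cc s : (fun n => s * c' n s) @ \oo --> (0 : R).
  have h : (fun n => Num.max 0 (1 - (r n)^-1 * s)) @ \oo --> Num.max 0 (1 - 0 * s).
    have h1 : (fun n => 1 - (r n)^-1 * s) @ \oo --> (1 - 0 * s : R).
      by apply: cvgB => //; exact: cvg_cst.
    have h2 : {for (1 - 0 * s), continuous (fun t : R => Num.max 0 t)} by exact: cont_max0.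
    exact: cvg_comp h1 h2.
  have h3 : (fun n => - 2 * ((r n)^-1 * s * Num.max 0 (1 - (r n)^-1 * s))) @ \oo -->
      (- 2 * (0 * s * Num.max 0 (1 - 0 * s)) : R).
    by apply: cvgM; [exact: cvg_cst|apply: cvgM; [exact: cr|exact: h]].
  rewrite !mul0r mulr0 in h3; rewrite (_ : (fun n => _) = fun n =>
    - 2 * ((r n)^-1 * s * Num.max 0 (1 - (r n)^-1 * s)))//.
  by apply/funext => n; rewrite /c'; ring.
have cF p : (fun n => F n (sq p)) @ \oo --> Psi (sq p) + sq p * Psi' (sq p).
  rewrite (_ : (fun n => _) = fun n => cutoff (r n) (sq p) * (Psi (sq p) + sq p * Psi' (sq p)) +
    (sq p * c' n (sq p)) * Psi (sq p)); last by apply/funext => n; rewrite /F; ring.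
  rewrite -[X in _ --> X]addr0 -[X in _ --> X + _]mul1r -[X in _ --> _ + X](mul0r (Psi (sq p))).
  by apply: cvgD; apply: cvgM; [exact: cutoff_cvg1|exact: cvg_cst|exact: cc|exact: cvg_cst].
have ig : pable (fun p : R * R => 2 * `|Psi (sq p)| + `|sq p * Psi' (sq p)|).
  by apply: pableD; [apply: pableZ|]; exact: pable_abs.
have mF n : pmeas (fun p : R * R => F n (sq p)).
  have m1 (h : R -> R) : continuous h -> pmeas (fun p : R * R => h (sq p)).
    by move=> ch; apply: pmeas_compc => //; exact: pmeas_sq.
  have [cc' _ _] := bump_cutoff (r0 n).
  have ccut := bump_continuous (bump_cutoff (r0 n)).
  apply: pmeasD; first by apply: pmeasM; exact: m1.
  by apply: pmeasM; [exact: pmeas_sq|apply: pmeasD; apply: pmeasM; exact: m1].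
have bF n p : `|F n (sq p)| <= 2 * `|Psi (sq p)| + `|sq p * Psi' (sq p)|.
  have s0 := sq_ge0 p; rewrite /F (_ : _ + _ = (cutoff (r n) (sq p) + sq p * c' n (sq p)) * Psi (sq p)
     + cutoff (r n) (sq p) * (sq p * Psi' (sq p))); last by ring.
  have k1 : `|cutoff (r n) (sq p)| <= 1 by rewrite ger0_norm ?cutoff_ge0// cutoff_le1.
  apply: (le_trans (ler_normD _ _)); apply: lerD; rewrite normrM.
    apply: ler_wpM2r => //; apply: (le_trans (ler_normD _ _)).
    by have := sc0 _ n s0; lra.
  by rewrite -[leRHS]mul1r; apply: ler_wpM2r.
have [_] := @pint_dct R (fun n p => F n (sq p)) _ _ mF cF bF ig.
rewrite (_ : _ \o _ = fun=> 0); last by apply/funext => n; exact: F0.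
by move=> h; exact: (cvg_unique (@Rhausdorff R) h (cvg_cst 0)).
Qed.

End EulerGlobal.

(** * The oscillating weight *)

Section Weight.
Context {R : realType}.
Implicit Types (s t nu : R).

(* The weight is phi z = G (|z|^2) with 2 G' = 3/2 + sin (ln (1 + s) / 4) / 2.
   [ell] is a C^1 extension of 1 + s from s >= 0 to a positive function on R. *)
Definition ell s : R := 1 + s + Num.max 0 (- s) ^+ 2.
Definition ell' s : R := 1 - 2 * Num.max 0 (- s).
Definition slow s : R := ln (ell s) / 4.
(** With u = 1 + s and L = ln u / 4, the derivative of u (sin L - cos L / 4) is (17 / 16) sin L;
    hence 4 / 17 for the summand sin L / 4 of G'. *)
Definition Gfun s : R :=
  3 / 4 * s + 4 / 17 * ell s * (sin (slow s) - cos (slow s) / 4).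
Definition gfun s : R := 3 / 4 + sin (slow s) / 4.
(** The factor (1 + s)^(-nu) makes multiplication by the symbol a change of weight, from nu = 0 to
    nu = beta / 2. *)
Definition Wfun nu s : R := expR (- (2 * Gfun s) - nu * ln (ell s)).

Lemma ellE s : 0 <= s -> ell s = 1 + s.
Proof. by move=> s0; rewrite /ell max_l ?oppr_le0// expr0n addr0. Qed.

Lemma ell'E s : 0 <= s -> ell' s = 1.
Proof. by move=> s0; rewrite /ell' max_l ?oppr_le0// mulr0 subr0. Qed.

Lemma ell_gt0 s : 0 < ell s.
Proof.
have [s0|s0] := leP 0 s; first by rewrite ellE//; lra.
by rewrite /ell max_r ?oppr_ge0 ?(ltW s0)//; have := sqr_ge0 (s + 2^-1); nra.
Qed.

Lemma c1_ell : c1 ell ell'.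
Proof.
have h := c1D (c1D (c1_cst 1) (@c1_id R)) (c1_comp_affine 0 (-1) (@c1_sqmax R)).
have e s : 0 + -1 * s = - s by rewrite add0r mulN1r.
apply: eq_c1 h => s; first by rewrite /ell e.
by rewrite /ell' e add0r mulN1r.
Qed.

Lemma c1_sin : c1 (@sin R) cos.
Proof. by split; [exact: continuous_cos|move=> s; exact: is_derive_sin]. Qed.

Lemma c1_cos : c1 (@cos R) (fun s => - sin s).
Proof.
by split=> [s|s]; [apply: cvgN; exact: continuous_sin|exact: is_derive_cos].
Qed.

Lemma c1_expR : c1 (@expR R) expR.
Proof. by split; [exact: continuous_expR|move=> s; exact: is_derive_expR]. Qed.

Lemma c1_ln_ell : c1 (fun s => ln (ell s)) (fun s => (ell s)^-1 * ell' s).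
Proof.
have ce := c1_continuous c1_ell; have [c d] := c1_ell.
split=> s; last first.
  have d1 := is_derive1_ln (ell_gt0 s); have d2 := d s.
  exact: (is_derive1_comp (f := @ln R) (g := ell)).
apply: cvgM; last exact: c.
by apply: cvgV; [rewrite gt_eqF// ell_gt0|exact: ce].
Qed.

Definition slow' s : R := (ell s)^-1 * ell' s / 4.

Lemma c1_slow : c1 slow slow'.
Proof. by apply: eq_c1 (c1Z 4^-1 c1_ln_ell) => s; rewrite mulrC. Qed.

Definition gfun' s : R := cos (slow s) * slow' s / 4.

Lemma c1_gfun : c1 gfun gfun'.
Proof.
apply: eq_c1 (c1D (c1_cst (3 / 4)) (c1Z 4^-1 (c1_comp c1_sin c1_slow))) => s.
  by rewrite /gfun; ring.
by rewrite /gfun'; ring.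
Qed.

Lemma c1_Gfun : c1 Gfun (fun s => 3 / 4 + ell' s * sin (slow s) / 4).
Proof.
have h1 := c1_comp c1_sin c1_slow; have h2 := c1_comp c1_cos c1_slow.
have h3 := c1M c1_ell (c1D h1 (c1Z (- 4^-1) h2)).
apply: eq_c1 (c1D (c1Z (3 / 4) (@c1_id R)) (c1Z (4 / 17) h3)) => s.
  by rewrite /Gfun; ring.
rewrite /slow'; have : ell s != 0 by rewrite gt_eqF// ell_gt0.
by set e := ell s => e0; field.
Qed.

Definition Wfun' nu s := Wfun nu s *
  (- (2 * (3 / 4 + ell' s * sin (slow s) / 4)) - nu * ((ell s)^-1 * ell' s)).

Lemma c1_Wfun nu : c1 (Wfun nu) (Wfun' nu).
Proof.
have h := c1_comp c1_expR (c1D (c1Z (-2) c1_Gfun) (c1Z (- nu) c1_ln_ell)).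
by apply: eq_c1 h => s; rewrite /Wfun' /Wfun !mulNr.
Qed.

Lemma Wfun_gt0 nu s : 0 < Wfun nu s. Proof. exact: expR_gt0. Qed.

Lemma WfunE nu s : Wfun nu s = Wfun 0 s * ell s `^ (- nu).
Proof.
by rewrite /Wfun mul0r subr0 expRD /powR gt_eqF ?ell_gt0// mulNr.
Qed.

Lemma gfun_bounds s : 1 / 2 <= gfun s <= 1.
Proof.
have := sin_le1 (slow s); have := sin_geN1 (slow s).
by rewrite /gfun => *; apply/andP; split; lra.
Qed.

(** For s >= 0 the quotient s ell' / ell is at most 1; the factor 3 also covers s < 0, so that
    [qfun'] is bounded below on the whole line. *)
Lemma sgfun'_bound s : `|s * gfun' s| <= 3 / 16.
Proof.
have e0 := ell_gt0 s.
have h : `|s * ell' s| <= 3 * ell s.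
  have [s0|s0] := leP 0 s; first by rewrite ell'E// ellE// mulr1 ger0_norm//; lra.
  rewrite /ell' /ell max_r ?oppr_ge0 ?(ltW s0)//.
  by rewrite ler_norml; apply/andP; split; have := sqr_ge0 (s + 1); have := sqr_ge0 s; nra.
rewrite /gfun' /slow' (_ : s * _ = cos (slow s) * ((s * ell' s) / ell s) * 16^-1); last first.
  by field; rewrite gt_eqF.
rewrite normrM [X in _ * X]ger0_norm// ler_pM2r ?invr_gt0// normrM -[leRHS]mul1r.
apply: ler_pM => //; first by rewrite ler_norml cos_geN1 cos_le1.
by rewrite normrM normfV (gtr0_norm e0) ler_pdivrMr.
Qed.

Definition qfun s : R := 2 * s * gfun s.
Definition qfun' s : R := 2 * gfun s + 2 * s * gfun' s.

Lemma c1_qfun : c1 qfun qfun'.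
Proof.
by apply: eq_c1 (c1M (c1Z 2 (@c1_id R)) c1_gfun) => s; rewrite /qfun /qfun' ?mulr1.
Qed.

Lemma qfun'_bounds s : 1 / 2 <= qfun' s <= 3.
Proof.
have /andP[g1 g2] := gfun_bounds s; have := sgfun'_bound s.
by rewrite /qfun' -mulrA ler_norml => /andP[h1 h2]; apply/andP; split; lra.
Qed.

Lemma qfun_bounds s : 0 <= s -> s <= qfun s <= 2 * s.
Proof.
move=> s0; have /andP[g1 g2] := gfun_bounds s; rewrite /qfun.
by apply/andP; split; nra.
Qed.

(** As q' >= 1/2, a small deviation of q (s) localises s itself. *)
Lemma qfun_expanding s t : `|s - t| <= 2 * `|qfun s - qfun t|.
Proof.
have [_ dq] := c1_qfun; have [c _ e] := mvt_step t (s - t) dq.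
rewrite subrKC in e; rewrite e normrM mulrA; have /andP[q1 q2] := qfun'_bounds c.
rewrite -[leLHS]mul1r ler_wpM2r// ger0_norm; lra.
Qed.

Lemma Gfun_ge s : 0 <= s -> s / 2 - 1 / 17 <= Gfun s.
Proof.
move=> s0; have [c d] := c1_Gfun.
have G0 : Gfun 0 = - (1 / 17).
  by rewrite /Gfun /slow ellE// addr0 ln1 mul0r sin0 cos0; field.
have cG := c1_continuous c1_Gfun.
have [u] := @MVT_segment R Gfun _ 0 s s0 (fun x _ => d x) (continuous_subspaceT cG).
rewrite in_itv/= => /andP[u0 us]; rewrite G0 subr0 => e.
have {}e : Gfun s - - (1 / 17) = gfun u * s by rewrite e ell'E// mul1r.
have /andP[g1 g2] := gfun_bounds u.
have : s / 2 <= gfun u * s by nra.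
by rewrite -e; lra.
Qed.

Lemma exprn_le_fact_expR (x : R) n : 0 <= x -> x ^+ n.+1 <= n.+1`!%:R * expR x.
Proof.
move=> x0; rewrite mulrC -ler_pdivrMr ?ltr0n ?fact_gt0//.
by apply: le_trans (expR_ge1Dxn n x0); rewrite lerDr.
Qed.

Lemma pable_weight nu (u : R -> R) m (C : R) : 0 <= nu -> measurable_fun setT u ->
  (forall s, 0 <= s -> `|u s| <= C * (1 + s) ^+ m) ->
  pable (fun p : R * R => u (sq p) * Wfun nu (sq p)).
Proof.
move=> nu0 mu uC; have C0 : 0 <= C.
  by have := uC 0 (lexx _); rewrite addr0 expr1n mulr1; apply: le_trans.
(* From x^(m+2) <= (m+2)! e^x at x = 1 + s and W <= e^(2/17 - s); the exponents add up to 1 +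
   2/17. *)
apply: (@pable_dom _ _ (C * ((m.+2)`!%:R * expR (2 / 17 + 1)))).
  apply: pmeasM; first by apply: pmeas_comp => //; exact: pmeas_sq.
  by apply: pmeas_compc (@pmeas_sq R); exact: c1_continuous (c1_Wfun nu).
move=> p; have := sq_ge0 p; set s := sq p => s0.
rewrite normrM (gtr0_norm (Wfun_gt0 _ _)) ler_pdivlMr; last by rewrite exprn_gt0//; lra.
have W1 : Wfun nu s <= expR (2 / 17 - s).
  rewrite /Wfun ler_expR ellE//; have := Gfun_ge s0.
  have : 0 <= nu * ln (1 + s) by rewrite mulr_ge0// ln_ge0// lerDl.
  lra.
have e1 := exprn_le_fact_expR m.+1 (addr_ge0 ler01 s0).
have s1 : 0 <= (1 + s) ^+ 2 by exact: sqr_ge0.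
apply: (@le_trans _ _ (C * (1 + s) ^+ m * expR (2 / 17 - s) * (1 + s) ^+ 2)).
  by rewrite ler_wpM2r//; apply: ler_pM => //; [exact: ltW (Wfun_gt0 _ _)|exact: uC].
rewrite (_ : C * _ * _ * _ = C * ((1 + s) ^+ m.+2 * expR (2 / 17 - s))); last by rewrite !exprS; ring.
apply: ler_wpM2l => //; rewrite (_ : 2 / 17 + 1 = (1 + s) + (2 / 17 - s)); last by ring.
by rewrite [X in _ <= _ * X]expRD mulrA ler_wpM2r// expR_ge0.
Qed.

End Weight.

(** * Averages over the radial densities *)

Section Moments.
Context {R : realType}.
Implicit Types (s t nu : R) (n k : nat) (h u : R -> R).

(** Not normalised: the mean over the n-th density is [avg n h / gam n]. *)
Definition avg n h : R := pint (fun p : R * R => h (sq p) * sq p ^+ n * Wfun 0 (sq p)).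

(** A class closed under sums and products on which all averages converge, so that integrability
    reduces to membership. *)
Definition poly_growth h : Prop := measurable_fun setT h /\
  exists C : R, exists m, forall s, 0 <= s -> `|h s| <= C * (1 + s) ^+ m.

Lemma pable_avg n h nu : 0 <= nu -> poly_growth h ->
  pable (fun p : R * R => h (sq p) * sq p ^+ n * Wfun nu (sq p)).
Proof.
move=> nu0 [mh [C [m hC]]].
apply: (@pable_weight _ nu (fun s => h s * s ^+ n) (m + n) C) => //.
  by apply: measurable_funM => //; exact: measurable_funX.
move=> s s0; rewrite normrM normrX (ger0_norm s0) exprD mulrA.
apply: ler_pM => //; [exact: exprn_ge0|exact: hC|].
by apply: lerXn2r; rewrite ?nnegrE; lra.
Qed.

Lemma poly_growth_c1 h h' (C : R) m : c1 h h' ->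
  (forall s, 0 <= s -> `|h s| <= C * (1 + s) ^+ m) -> poly_growth h.
Proof.
move=> ch hC; split; last by exists C, m.
by apply: continuous_measurable_fun; exact: c1_continuous ch.
Qed.

Lemma poly_growthD h u : poly_growth h -> poly_growth u -> poly_growth (fun s => h s + u s).
Proof.
move=> [mh [C [m hC]]] [mu [D [k uD]]]; split; first exact: measurable_funD.
exists (`|C| + `|D|), (m + k)%N => s s0; have s1 : 1 <= 1 + s by rewrite lerDl.
apply: (le_trans (ler_normD _ _)); rewrite mulrDl; apply: lerD.
  apply: (le_trans (hC s s0)); rewrite exprD; apply: (@le_trans _ _ (`|C| * (1 + s) ^+ m)).
    by rewrite ler_wpM2r ?ler_norm// exprn_ge0//; lra.
  by rewrite ler_wpM2l// ler_peMr ?exprn_ege1// exprn_ge0//; lra.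
apply: (le_trans (uD s s0)); rewrite exprD; apply: (@le_trans _ _ (`|D| * (1 + s) ^+ k)).
  by rewrite ler_wpM2r ?ler_norm// exprn_ge0//; lra.
by rewrite ler_wpM2l// ler_peMl ?exprn_ege1// exprn_ge0//; lra.
Qed.

Lemma poly_growthM h u : poly_growth h -> poly_growth u -> poly_growth (fun s => h s * u s).
Proof.
move=> [mh [C [m hC]]] [mu [D [k uD]]]; split; first exact: measurable_funM.
exists (C * D), (m + k)%N => s s0; rewrite normrM exprD.
rewrite (_ : C * D * _ = (C * (1 + s) ^+ m) * (D * (1 + s) ^+ k)); last by ring.
by apply: ler_pM => //; [exact: hC|exact: uD].
Qed.

Lemma poly_growth_cst (c : R) : poly_growth (fun=> c).
Proof.
split; first exact: measurable_cst.
by exists `|c|, 0%N => s _; rewrite expr0 mulr1.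
Qed.

Lemma poly_growth_id : poly_growth (fun s => s).
Proof.
split; first exact: measurable_id.
by exists 1, 1%N => s s0; rewrite ger0_norm//; lra.
Qed.

Lemma poly_growthX h n : poly_growth h -> poly_growth (fun s => h s ^+ n).
Proof.
move=> gh; elim: n => [|n ih]; first exact: poly_growth_cst.
rewrite (_ : (fun s => _) = fun s => h s * h s ^+ n); first exact: poly_growthM.
by apply/funext => s; rewrite exprS.
Qed.

Lemma poly_growth_q : poly_growth (@qfun R).
Proof.
apply: (poly_growth_c1 (C := 2) (m := 1) (@c1_qfun R)) => s s0.
by have /andP[q1 q2] := qfun_bounds s0; rewrite ger0_norm; lra.
Qed.

Lemma poly_growth_q' : poly_growth (@qfun' R).
Proof.
have [c _] := @c1_qfun R; split; first exact: continuous_measurable_fun.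
exists 3, 0%N => s _; have /andP[q1 q2] := qfun'_bounds s.
by rewrite expr0 mulr1 ger0_norm; lra.
Qed.

Lemma poly_growth_ell nu : 0 <= nu -> poly_growth (fun s => ell s `^ (- nu)).
Proof.
move=> nu0; split.
  apply: (measurableT_comp (f := fun x => x `^ (- nu)) (g := ell)); first exact: measurable_powR.
  by apply: continuous_measurable_fun; exact: c1_continuous (@c1_ell R).
exists 1, 0%N => s s0; rewrite expr0 mulr1 ger0_norm ?powR_ge0// powRN invf_le1 ?powR_gt0 ?ell_gt0//.
by rewrite -[leLHS](powRr0 (ell s)) ler_powR// ellE// lerDl.
Qed.

Lemma avgD n h u : poly_growth h -> poly_growth u ->
  avg n (fun s => h s + u s) = avg n h + avg n u.
Proof.
move=> gh gu; rewrite /avg -pintD; [|exact: pable_avg|exact: pable_avg].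
by apply: eq_pint => p; ring.
Qed.

Lemma avgZ n c h : poly_growth h -> avg n (fun s => c * h s) = c * avg n h.
Proof.
move=> gh; rewrite /avg -pintZ; last exact: pable_avg.
by apply: eq_pint => p; ring.
Qed.

Lemma le_avg n h u : poly_growth h -> poly_growth u ->
  (forall s, 0 <= s -> h s <= u s) -> avg n h <= avg n u.
Proof.
move=> gh gu hu; apply: le_pint; [exact: pable_avg|exact: pable_avg|].
move=> p; have s0 := sq_ge0 p; rewrite ler_wpM2r ?(ltW (Wfun_gt0 _ _))//.
by rewrite ler_wpM2r ?exprn_ge0 ?hu.
Qed.

Lemma eq_avg n h u : (forall s, 0 <= s -> h s = u s) -> avg n h = avg n u.
Proof. by move=> hu; apply: eq_pint => p; rewrite hu ?sq_ge0. Qed.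

Definition gam n : R := avg n (fun=> 1).

Lemma avg_cst n c : avg n (fun=> c) = c * gam n.
Proof.
rewrite /gam -avgZ; last exact: poly_growth_cst.
by apply: eq_avg => s _; rewrite mulr1.
Qed.

Lemma gamE n : gam n = moment (Wfun 0) n.
Proof. by apply: eq_pint => p; rewrite mul1r. Qed.

Lemma gam_gt0 n : 0 < gam n.
Proof.
rewrite gamE; have cW := c1_continuous (c1_Wfun (R := R) 0).
apply: (@pint_gt0 _ _ (1, 0)).
- by apply: eq_pable (pable_avg n (lexx 0) (poly_growth_cst 1)) => p; rewrite mul1r.
- by move=> p; rewrite mulr_ge0 ?exprn_ge0 ?sq_ge0// ltW// Wfun_gt0.
- have : continuous (fun p : R * R => sq p ^+ n * Wfun 0 (sq p)); last exact.
  apply: cont2M; last by apply: cont2_comp => //; exact: cont2_sq.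
  by apply: (cont2_comp (h := fun s => s ^+ n)); [exact: exprn_continuous|exact: cont2_sq].
- by rewrite mulr_gt0 ?Wfun_gt0// /sq /= expr1n expr0n addr0 expr1n.
Qed.

Lemma c1Xn n : c1 (fun s => s ^+ n) (fun s => n%:R * s ^+ n.-1).
Proof.
elim: n => [|n ih]; first by apply: eq_c1 (c1_cst 1) => s; rewrite ?mulr0n ?mul0r.
apply: eq_c1 (c1M (@c1_id R) ih) => s; first by rewrite exprS.
case: n {ih} => [|n] /=; first by ring.
by rewrite mul1r mulrCA -exprS -[in RHS]natr1 mulrDl mul1r addrC.
Qed.

(** Euler's identity for Psi = h s^n exp (-2 G): s Psi' brings down n from the power, -q from the
    weight and s h' from h, and Psi itself supplies one more h. *)
Lemma avg_by_parts n h h' : c1 h h' -> poly_growth h -> poly_growth (fun s => s * h' s) ->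
  n.+1%:R * avg n h + avg n (fun s => s * h' s) = avg n (fun s => qfun s * h s).
Proof.
move=> ch gh gh'; have gq := poly_growthM poly_growth_q gh.
have cP := c1M (c1M ch (c1Xn n)) (c1_Wfun (R := R) 0).
have E (s : R) : 0 <= s ->
    s * ((h' s * s ^+ n + h s * (n%:R * s ^+ n.-1)) * Wfun 0 s + h s * s ^+ n * Wfun' 0 s) =
    (s * h' s + n%:R * h s + - 1 * (qfun s * h s)) * s ^+ n * Wfun 0 s.
  move=> s0; have e : s * (n%:R * s ^+ n.-1) = n%:R * s ^+ n.
    by case: n {cP} => [|n]; rewrite ?mul0r ?mulr0// exprS mulrCA.
  rewrite (_ : s * _ = (s * h' s * s ^+ n + h s * (s * (n%:R * s ^+ n.-1))) * Wfun 0 s +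
    s * h s * s ^+ n * Wfun' 0 s); last by ring.
  by rewrite e /Wfun' ell'E// /qfun /gfun; ring.
have gn : poly_growth (fun s => n%:R * h s) by apply: poly_growthM => //; exact: poly_growth_cst.
have gq' : poly_growth (fun s => - 1 * (qfun s * h s)).
  by apply: poly_growthM => //; exact: poly_growth_cst.
have g1 := poly_growthD gh' gn; have g2 := poly_growthD g1 gq'.
have iP := pable_avg n (lexx 0) gh.
have i2 := pable_avg n (lexx 0) g2.
have iP' : pable (fun p : R * R => sq p * ((h' (sq p) * sq p ^+ n + h (sq p) * (n%:R * sq p ^+ n.-1))
   * Wfun 0 (sq p) + h (sq p) * sq p ^+ n * Wfun' 0 (sq p))).
  by apply: eq_pable i2 => p; rewrite -E// sq_ge0.
have := pint_euler_global cP iP iP'; rewrite pintD// -/(avg n h).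
rewrite (_ : pint _ = avg n (fun s => s * h' s + n%:R * h s + - 1 * (qfun s * h s))); last first.
  by apply: eq_pint => p; rewrite E// sq_ge0.
rewrite avgD// avgD// !avgZ// -natr1; lra.
Qed.

Lemma avg_q n : avg n qfun = n.+1%:R * gam n.
Proof.
have := avg_by_parts n (c1_cst 1) (poly_growth_cst 1).
rewrite (_ : (fun s => s * 0) = fun=> 0); last by apply/funext => s; rewrite mulr0.
move=> /(_ (poly_growth_cst 0)); rewrite (avg_cst n 0) mul0r addr0 -/(gam n) => ->.
by apply: eq_avg => s _; rewrite mulr1.
Qed.

(** Integration by parts with h = q identifies the variance with the mean of s q'; since q' <= 3 and
    s <= q, this is at most three times the mean of q. *)
Lemma avg_variance n : avg n (fun s => (qfun s - n.+1%:R) ^+ 2) <= 3 * n.+1%:R * gam n.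
Proof.
have gq := poly_growth_q; have gq' := poly_growthM poly_growth_id poly_growth_q'.
have gqq := poly_growthM gq gq.
have e := avg_by_parts n (@c1_qfun R) gq gq'.
have g1 : poly_growth (fun s => - 2 * n.+1%:R * qfun s) by apply: poly_growthM => //; exact: poly_growth_cst.
have g2 := poly_growth_cst (n.+1%:R ^+ 2).
rewrite (@eq_avg n _ (fun s => qfun s * qfun s + (- 2 * n.+1%:R * qfun s + n.+1%:R ^+ 2))); last first.
  by move=> s _; ring.
rewrite avgD//; last exact: poly_growthD.
rewrite avgD// avgZ// avg_cst -e avg_q.
have : avg n (fun s => s * qfun' s) <= avg n (fun s => 3 * qfun s).
  apply: le_avg => // [|s s0]; first by apply: poly_growthM => //; exact: poly_growth_cst.
  have /andP[a1 a2] := qfun_bounds s0; have /andP[b1 b2] := qfun'_bounds s.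
  by nra.
by rewrite avgZ// avg_q; lra.
Qed.

Lemma avg_id n : avg n (fun s => s) = gam n.+1.
Proof. by apply: eq_pint => p; rewrite exprS; ring. Qed.

(** The bound q <= 2 s turns the mean value n + 1 of q into a lower bound for consecutive masses. *)
Lemma gam_step n : n.+1%:R / 2 * gam n <= gam n.+1.
Proof.
have : avg n qfun <= avg n (fun s => 2 * s).
  apply: le_avg; [exact: poly_growth_q|apply: poly_growthM; [exact: poly_growth_cst|exact: poly_growth_id]|].
  by move=> s s0; have /andP[] := qfun_bounds s0.
by rewrite avgZ ?avg_q ?avg_id; [lra|exact: poly_growth_id].
Qed.

Lemma gam_steps n j : (j <= n)%N -> ((n - j).+1%:R / 2) ^+ j * gam (n - j) <= gam n.
Proof.
elim: j => [|j ih] jn; first by rewrite expr0 mul1r subn0.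
apply: le_trans (ih (ltnW jn)).
have e : (n - j = (n - j.+1).+1)%N by rewrite subnSK.
rewrite e exprSr -mulrA; apply: ler_pM.
- by rewrite exprn_ge0// divr_ge0.
- by rewrite mulr_ge0 ?divr_ge0// ltW// gam_gt0.
- by apply: lerXn2r; rewrite ?nnegrE ?divr_ge0// ler_wpM2r// ler_nat.
- exact: gam_step.
Qed.

(** Iterating [gam_step] gives gam k >= k! gam 0 / 2^k, so the exponential series of 2 r dominates.
    This will make square-summable coefficients a power series of infinite radius. *)
Lemma gam_growth (r : R) : 0 <= r ->
  exists B : R, forall N, \sum_(k < N) r ^+ k / gam k <= B.
Proof.
move=> r0; exists (expR (2 * r) / gam 0) => N.
have r2 : 0 <= 2 * r by rewrite mulr_ge0.
have g0 := gam_gt0.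
have key k : k`!%:R / 2 ^+ k * gam 0 <= gam k.
  elim: k => [|k ih]; first by rewrite fact0 expr0 divr1 mul1r.
  apply: le_trans (gam_step k).
  rewrite factS natrM exprS (_ : _ * gam 0 = k.+1%:R / 2 * (k`!%:R / 2 ^+ k * gam 0)).
    by rewrite ler_wpM2l// divr_ge0.
  by field; rewrite expf_neq0.
have nd : nondecreasing_seq (series (exp_coeff (2 * r))).
  by apply: nondecreasing_series => k _ _; exact: exp_coeff_ge0.
have := nondecreasing_cvgn_le nd (is_cvg_series_exp_coeff (2 * r)) N.
rewrite -/(expR (2 * r)) /series/= big_mkord => h.
apply: le_trans (ler_wpM2r _ h); last by rewrite invr_ge0 ltW.
rewrite mulr_suml; apply: ler_sum => k _; rewrite /exp_coeff/=.
rewrite ler_pdivrMr//; apply: (le_trans _ (ler_wpM2l _ (key k))).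
  rewrite le_eqVlt; apply/orP; left; apply/eqP; rewrite exprMn; field.
  by rewrite expf_neq0//= gt_eqF//= pnatr_eq0 -lt0n fact_gt0.
apply: mulr_ge0; last by rewrite invr_ge0 ltW.
by apply: mulr_ge0; rewrite ?invr_ge0 ?exprn_ge0.
Qed.

(** The squared norm of z^n for the weight with exponent nu over that for the original weight: the
    n-th eigenvalue of T_f when nu = beta / 2. *)
Definition lam nu n : R := moment (Wfun nu) n / gam n.

Lemma momentE nu n : moment (Wfun nu) n = avg n (fun s => ell s `^ (- nu)).
Proof. by apply: eq_pint => p; rewrite WfunE; ring. Qed.

Lemma avg_gt0 n h s : poly_growth h -> (forall t, 0 <= t -> 0 <= h t) ->
  continuous h -> 0 < s -> 0 < h s -> 0 < avg n h.
Proof.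
move=> gh h0 ch s0 hs; have cW := c1_continuous (c1_Wfun (R := R) 0).
have sE : sq (Num.sqrt s, 0) = s by rewrite /sq/= expr0n addr0 sqr_sqrtr// ltW.
have cc (u : R -> R) : continuous u -> continuous (fun p : R * R => u (sq p)).
  by move=> cu; apply: cont2_comp => //; exact: cont2_sq.
apply: (@pint_gt0 _ _ (Num.sqrt s, 0)); first exact: pable_avg.
- by move=> p; rewrite mulr_ge0 ?(ltW (Wfun_gt0 _ _))// mulr_ge0 ?h0 ?exprn_ge0 ?sq_ge0.
- have : continuous (fun p : R * R => h (sq p) * sq p ^+ n * Wfun 0 (sq p)); last exact.
  apply: cont2M; last exact: cc.
  by apply: cont2M; [exact: cc|apply: (cc (fun s => s ^+ n)); exact: exprn_continuous].
- by rewrite sE mulr_gt0 ?Wfun_gt0// mulr_gt0// exprn_gt0.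
Qed.

Lemma c1_ell_powR nu : exists f, c1 (fun s => ell s `^ (- nu)) f.
Proof.
have h := c1_comp (@c1_expR R) (c1Z (- nu) (@c1_ln_ell R)).
by eexists; apply: eq_c1 h => s; first by rewrite /powR gt_eqF ?ell_gt0.
Qed.

Lemma lam_gt0 nu n : 0 <= nu -> 0 < lam nu n.
Proof.
move=> nu0; rewrite divr_gt0 ?gam_gt0// momentE.
have [f cf] := c1_ell_powR nu.
apply: (@avg_gt0 n _ 1) => //; first exact: poly_growth_ell.
- by move=> t _; exact: powR_ge0.
- exact: c1_continuous cf.
- by rewrite powR_gt0// ell_gt0.
Qed.

(** With c the mean of s, the two factors of [D] change sign together at c, so [D] has positive
    mean. The part with the constant ell c^(-nu) averages to 0, and what remains compares the means
    of s ell^(-nu) and c ell^(-nu). *)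
Lemma lam_decreasing nu n : 0 < nu -> lam nu n.+1 < lam nu n.
Proof.
move=> nu0; pose c := gam n.+1 / gam n.
have g0 := gam_gt0 n; have g1 := gam_gt0 n.+1.
have c0 : 0 < c by rewrite divr_gt0.
have ge := poly_growth_ell (ltW nu0).
have pd s t : 0 <= s -> s < t -> ell t `^ (- nu) < ell s `^ (- nu).
  move=> s0 st; rewrite !powRN ltf_pV2 ?posrE ?powR_gt0 ?ell_gt0//.
  by apply: gt0_ltr_powR => //; rewrite ?nnegrE ?(ltW (ell_gt0 _))// !ellE; lra.
pose D s := (ell c `^ (- nu) + - 1 * ell s `^ (- nu)) * (s + - c).
have gD : poly_growth D.
  apply: poly_growthM; apply: poly_growthD => //; try exact: poly_growth_cst.
    by apply: poly_growthM => //; exact: poly_growth_cst.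
  exact: poly_growth_id.
have D0 s : 0 <= s -> 0 <= D s.
  move=> s0; rewrite /D mulN1r; have [sc|cs|->] := ltgtP s c; last by rewrite !subrr mulr0.
    by rewrite mulr_le0// subr_le0 ltW// pd.
  by rewrite mulr_ge0 ?subr_ge0 ?(ltW cs)// ltW// pd// ltW.
have [f cf] := c1_ell_powR nu.
have cD : continuous D.
  have := c1M (c1D (c1_cst (ell c `^ (- nu))) (c1Z (- 1) cf)) (c1D (@c1_id R) (c1_cst (- c))).
  exact: c1_continuous.
have Dc : 0 < D (c + 1).
  by rewrite /D mulN1r mulr_gt0 ?subr_gt0 ?pd ?ltrDl// ltW.
have := @avg_gt0 n D (c + 1) gD D0 cD (addr_gt0 c0 ltr01) Dc.
have gA := poly_growthM (poly_growth_cst (ell c `^ (- nu))) poly_growth_id.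
have gB := poly_growthM (poly_growth_cst c) ge.
have gC := poly_growthM (poly_growth_cst (- 1)) (poly_growthM ge poly_growth_id).
have gK := poly_growth_cst (- (ell c `^ (- nu) * c)).
rewrite (@eq_avg n D (fun s => (ell c `^ (- nu) * s + c * ell s `^ (- nu)) +
  ((- 1) * (ell s `^ (- nu) * s) + - (ell c `^ (- nu) * c)))); last first.
  by move=> s _; rewrite /D; ring.
rewrite avgD; [|exact: poly_growthD|exact: poly_growthD].
rewrite (avgD n gA gB) (avgD n gC gK) avg_cst (avgZ _ _ poly_growth_id) avg_id.
rewrite (avgZ _ _ ge) (avgZ _ _ (poly_growthM ge poly_growth_id)).
have -> : avg n (fun s => ell s `^ (- nu) * s) = moment (Wfun nu) n.+1.
  by rewrite momentE; apply: eq_pint => p; rewrite exprS; ring.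
rewrite -momentE => h.
rewrite /lam ltr_pdivrMr// mulrAC ltr_pdivlMr//.
have cg : c * gam n = gam n.+1 by rewrite /c divfK// gt_eqF.
have {}h : moment (Wfun nu) n.+1 < c * moment (Wfun nu) n by move: h; rewrite -cg; lra.
have := h; rewrite -(ltr_pM2r g0) mulrAC cg [_ * moment _ _]mulrC.
by [].
Qed.

End Moments.

(** * Concentration with an explicit error *)

Section Asymptotics.
Context {R : realType}.
Implicit Types (s t nu : R) (n k M : nat).

(** As nu <= M, x^M is at least as far from 1 as x^nu, and x^M - 1 factors through a geometric sum.
    Integer powers are wanted because the negative moments below are integral. *)
Lemma powR_dev (x nu : R) M : 0 < x -> 0 <= nu -> nu <= M%:R ->
  `|x `^ nu - 1| <= `|x - 1| * (M%:R * (1 + x ^+ M)).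
Proof.
move=> x0 nu0 nuM; have xM : 0 <= x ^+ M by rewrite exprn_ge0// ltW.
apply: (@le_trans _ _ `|x ^+ M - 1|).
  rewrite -(powR_mulrn _ (ltW x0)); have [x1|x1] := leP 1 x.
    have h1 : 1 <= x `^ nu by rewrite -[leLHS](powRr0 x) ler_powR.
    have h2 : x `^ nu <= x `^ M%:R by rewrite ler_powR.
    by rewrite !ger0_norm; lra.
  have x01 : 0 < x <= 1 by rewrite x0 ltW.
  have h1 : x `^ nu <= 1 by rewrite -[leRHS](powRr0 x) ger_powR.
  have h2 : x `^ M%:R <= x `^ nu by rewrite ger_powR.
  by rewrite !ler0_norm; lra.
rewrite subrX1 normrM ler_wpM2l// ger0_norm; last first.
  by apply: sumr_ge0 => i _; rewrite exprn_ge0// ltW.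
apply: (@le_trans _ _ (\sum_(i < M) (1 + x ^+ M))); last first.
  by rewrite sumr_const card_ord mulr_natl.
apply: ler_sum => i _; have [x1|x1] := leP 1 x.
  by apply: (@le_trans _ _ (x ^+ M)); [rewrite ler_weXn2l// ltnW|rewrite lerDr].
by apply: (@le_trans _ _ 1); [rewrite exprn_ile1// ltW|rewrite lerDl].
Qed.

(* The square of s - t is traded against the variance of qfun. *)
Lemma ratio_dev s t nu (eta X : R) M n : 0 <= s -> 0 <= t -> 0 <= nu -> nu <= M%:R ->
  0 < eta -> `|qfun t - n.+1%:R| <= 1 ->
  X = (1 + t) / (1 + s) ->
  `|X `^ nu - 1| <= M%:R * (eta * (X ^+ 2 + X ^+ (2 * M.+1)) +
     (4 * (qfun s - n.+1%:R) ^+ 2 + 4) / (eta * (1 + t) ^+ 2)).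
Proof.
move=> s0 t0 nu0 nuM eta0 qt XE.
have s1 : 0 < 1 + s by lra.
have t1 : 0 < 1 + t by lra.
have X0 : 0 < X by rewrite XE divr_gt0.
apply: (le_trans (powR_dev X0 nu0 nuM)); rewrite mulrCA ler_wpM2l//.
have -> : X - 1 = X * ((t - s) / (1 + t)) by rewrite XE; field; rewrite !gt_eqF.
rewrite normrM (gtr0_norm X0) mulrAC.
set a := X * (1 + X ^+ M); set b := `|(t - s) / (1 + t)|.
have a2 : a ^+ 2 <= 2 * (X ^+ 2 + X ^+ (2 * M.+1)).
  have -> : X ^+ (2 * M.+1) = X ^+ 2 * (X ^+ M) ^+ 2.
    by rewrite mulnC exprM [X ^+ M.+1]exprS exprMn.
  rewrite /a exprMn.
  have := sqr_ge0 (1 - X ^+ M); have := sqr_ge0 X; set u := X ^+ 2; set v := X ^+ M.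
  by move=> u0 w0; have := mulr_ge0 u0 w0; nra.
have b2 : b ^+ 2 <= (8 * (qfun s - n.+1%:R) ^+ 2 + 8) / (1 + t) ^+ 2.
  rewrite /b real_normK ?num_real// expr_div_n ler_wpM2r ?invr_ge0 ?sqr_ge0//.
  have h := qfun_expanding t s; have tsE : (t - s) ^+ 2 = `|t - s| ^+ 2 by rewrite real_normK ?num_real.
  have qE : (qfun t - qfun s) ^+ 2 = `|qfun t - qfun s| ^+ 2 by rewrite real_normK ?num_real.
  have h2 : (t - s) ^+ 2 <= 4 * (qfun t - qfun s) ^+ 2.
    rewrite tsE qE; have := normr_ge0 (t - s); move: h.
    by set x := `|t - s|; set y := `|qfun t - qfun s| => ? ?; nra.
  apply: (le_trans h2); move: qt; rewrite ler_norml => /andP[q1 q2].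
  set a' := qfun t - n.+1%:R in q1 q2; set b' := qfun s - n.+1%:R.
  rewrite (_ : qfun t - qfun s = a' - b'); last by rewrite /a' /b'; ring.
  have := sqr_ge0 (a' + b'); nra.
(* The arithmetic-geometric mean inequality with weight eta, left free so that the two terms can be
   balanced after averaging. *)
have ab : a * b <= (eta * a ^+ 2 + b ^+ 2 / eta) / 2.
  have h := sqr_ge0 (eta * a - b); rewrite ler_pdivlMr//.
  have hB : (b ^+ 2 / eta) * eta = b ^+ 2 by rewrite divfK ?gt_eqF.
  by rewrite -(ler_pM2l eta0); move: hB h; set B := b ^+ 2 / eta => hB h; nra.
apply: (le_trans ab); rewrite ler_pdivrMr// mulrDl; apply: lerD.
  by have := ler_wpM2l (ltW eta0) a2; lra.
rewrite ler_pdivrMr//; apply: (le_trans b2).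
rewrite le_eqVlt; apply/orP; left; apply/eqP; field.
by rewrite !gt_eqF.
Qed.

(** As s <= 1 + s, each negative power of 1 + s costs at most one unit of the index n. *)
Lemma avg_ell_inv n j : (j <= n)%N -> avg n (fun s => (ell s)^-1 ^+ j) <= gam (R := R) (n - j).
Proof.
move=> jn; have gi : poly_growth (fun s : R => (ell s)^-1).
  have := poly_growth_ell (R := R) ler01.
  rewrite (_ : (fun s => _) = fun s => (ell s)^-1)//; apply/funext => s.
  by rewrite powR_inv1// ltW// ell_gt0.
have gX := poly_growthX j gi.
apply: le_pint; first exact: (pable_avg n (lexx 0) gX).
  exact: (pable_avg (n - j) (lexx 0) (poly_growth_cst 1)).
move=> p; have s0 := sq_ge0 p; set s := sq p in s0 *.
rewrite mul1r ler_wpM2r ?(ltW (Wfun_gt0 _ _))// -[in leLHS](subnKC jn) exprD mulrA -exprMn.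
rewrite -[leRHS]mul1r ler_wpM2r ?exprn_ge0// exprn_ile1//.
  by rewrite mulr_ge0// invr_ge0 ltW// ell_gt0.
by rewrite mulrC ler_pdivrMr ?ell_gt0// ellE// mul1r; lra.
Qed.

(** From q (t) >= t one has 1 + t <= n + 3, and each step down in n gains a factor of at most 2 / (n
    - j + 1) <= 4 / (n + 1). The product 4 (n + 3) / (n + 1) is at most 6 once n >= 3. *)
Lemma avg_ratio n j t : (3 <= n)%N -> (2 * j <= n)%N -> 0 <= t -> qfun t <= n.+2%:R ->
  avg n (fun s => ((1 + t) / ell s) ^+ j) <= 6 ^+ j * gam n.
Proof.
move=> n3 jn t0 qt; have jn' : (j <= n)%N by lia.
have gi : poly_growth (fun s : R => (ell s)^-1 ^+ j).
  apply: poly_growthX; have := poly_growth_ell (R := R) ler01.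
  rewrite (_ : (fun s => _) = fun s => (ell s)^-1)//; apply/funext => s.
  by rewrite powR_inv1// ltW// ell_gt0.
rewrite (@eq_avg _ n _ (fun s => (1 + t) ^+ j * (ell s)^-1 ^+ j)); last first.
  by move=> s _; rewrite exprMn.
rewrite avgZ//; have t1 : 0 <= (1 + t) ^+ j by rewrite exprn_ge0//; lra.
apply: (le_trans (ler_wpM2l t1 (avg_ell_inv jn'))).
have h := gam_steps (R := R) jn'.
have h6 := ler_wpM2l (exprn_ge0 j (ler0n R 6)) h.
apply: (le_trans _ h6); rewrite mulrA ler_wpM2r ?(ltW (gam_gt0 _))// -exprMn.
have /andP[q1 _] := qfun_bounds t0.
have nj : (n.+1 <= (n - j).+1 * 2)%N by lia.
have nj' : n.+1%:R <= (n - j).+1%:R * 2 :> R by rewrite -natrM ler_nat.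
have n2 : n.+2%:R = n.+1%:R + 1 :> R by rewrite -natr1.
have n1 : 4 <= n.+1%:R :> R by rewrite ler_nat.
by apply: lerXn2r; rewrite ?nnegrE; lra.
Qed.

(** [ratio_dev] is averaged: negative moments control the powers of X, which are large at small s,
    and the variance controls the rest. The condition 4 (M + 1) <= n leaves room for j = 2 (M + 1)
    in [avg_ratio]. *)
Lemma lam_estimate nu M : 0 <= nu -> nu <= M%:R -> exists2 K : R, 0 < K &
  forall n t (eta : R), (4 * M.+1 <= n)%N -> 0 <= t -> 0 < eta ->
    `|qfun t - n.+1%:R| <= 1 ->
    `|(1 + t) `^ nu * lam nu n - 1| <= K * (eta + (eta * n.+1%:R)^-1).
Proof.
(* The first two summands bound the two negative moments. For 64 = 16 * 4, the variance gives 4 * 3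
   + 4 = 16 and [D2 * n.+1%:R] is at most 4 / (eta (n + 1)). *)
move=> nu0 nuM; pose c : R := 36 + 6 ^+ (2 * M.+1) + 64.
have c0 : 0 < c by have := exprn_gt0 (2 * M.+1) (ltr0Sn R 5); rewrite /c; lra.
exists (M%:R * c + 1) => [|n t eta Mn t0 eta0 qt]; first by have := mulr_ge0 (ler0n R M) (ltW c0); lra.
have [n3 n4 nM] : [/\ 3 <= n, 2 * 2 <= n & 2 * (2 * M.+1) <= n]%N by clear -Mn; split; lia.
have t1 : 0 < 1 + t by lra.
have g0 := gam_gt0 (R := R) n.
pose X s := (1 + t) / ell s.
have X0 s : 0 < X s by rewrite divr_gt0 ?ell_gt0.
have gX : poly_growth X.
  apply: poly_growthM; first exact: poly_growth_cst.
  have := poly_growth_ell (R := R) ler01.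
  rewrite (_ : (fun s => _) = fun s => (ell s)^-1)//; apply/funext => s.
  by rewrite powR_inv1// ltW// ell_gt0.
have ge := poly_growth_ell (R := R) nu0.
have gXnu : poly_growth (fun s => X s `^ nu).
  rewrite (_ : (fun s => _) = fun s => (1 + t) `^ nu * ell s `^ (- nu)).
    by apply: poly_growthM => //; exact: poly_growth_cst.
  apply/funext => s; rewrite /X powRM ?invr_ge0 ?(ltW t1) ?(ltW (ell_gt0 _))//.
  by rewrite -powR_inv1 ?(ltW (ell_gt0 _))// -powRrM mulN1r.
have lE : (1 + t) `^ nu * lam nu n = avg n (fun s => X s `^ nu) / gam n.
  rewrite /lam mulrA momentE -avgZ//; congr (_ / _); apply: eq_avg => s _.
  rewrite /X powRM ?invr_ge0 ?(ltW t1) ?(ltW (ell_gt0 _))//.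
  by rewrite -powR_inv1 ?(ltW (ell_gt0 _))// -powRrM mulN1r.
have gD : poly_growth (fun s => X s `^ nu + - 1) by apply: poly_growthD => //; exact: poly_growth_cst.
pose D2 : R := (eta * (1 + t) ^+ 2)^-1.
have D20 : 0 <= D2 by rewrite invr_ge0 mulr_ge0 ?sqr_ge0// ltW.
pose q2 s := (qfun s - n.+1%:R) ^+ 2.
have gq2 : poly_growth q2.
  apply: poly_growthX; apply: poly_growthD; [exact: poly_growth_q|exact: poly_growth_cst].
pose bnd s := (M%:R * eta) * (X s ^+ 2 + X s ^+ (2 * M.+1)) + (M%:R * D2) * (4 * q2 s + 4).
have gb1 := poly_growthD (poly_growthX 2 gX) (poly_growthX (2 * M.+1) gX).
have g4 := poly_growthM (poly_growth_cst 4) gq2.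
have gb2 := poly_growthD g4 (poly_growth_cst 4).
have gb : poly_growth bnd by apply: poly_growthD; apply: poly_growthM => //; exact: poly_growth_cst.
have Xb s : 0 <= s -> `|X s `^ nu + - 1| <= bnd s.
  move=> s0; have := @ratio_dev s t nu eta (X s) M n s0 t0 nu0 nuM eta0 qt.
  rewrite /X (ellE s0) => /(_ erefl) /le_trans; apply; rewrite /bnd /q2 -/D2 /X (ellE s0) le_eqVlt; apply/orP; left; apply/eqP; ring.
have avgb : avg n bnd <= (M%:R * c) * (eta + (eta * n.+1%:R)^-1) * gam n.
  rewrite avgD; [|by apply: poly_growthM => //; exact: poly_growth_cst..].
  rewrite (avgZ n (M%:R * eta) gb1) (avgZ n (M%:R * D2) gb2).
  rewrite (avgD n (poly_growthX 2 gX) (poly_growthX (2 * M.+1) gX)).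
  rewrite (avgD n g4 (poly_growth_cst 4)) avg_cst (avgZ _ _ gq2).
  have qn2 : qfun t <= n.+2%:R by move: qt; rewrite ler_norml -natr1 -natr1 => /andP[_]; lra.
  have x2 : avg n (fun s => X s ^+ 2) <= 36 * gam n.
    have := @avg_ratio n 2 t n3 n4 t0 qn2; rewrite (_ : 6 ^+ 2 = 36); last by ring.
    by apply.
  have xM : avg n (fun s => X s ^+ (2 * M.+1)) <= 6 ^+ (2 * M.+1) * gam n.
    exact: (@avg_ratio n (2 * M.+1) t n3 nM t0 qn2).
  have v := avg_variance (R := R) n; rewrite -/q2 in v.
  have n1 : 1 <= n.+1%:R :> R by rewrite ler1n.
  have tn : n.+1%:R <= 2 * (1 + t).
    by have /andP[_ q1] := qfun_bounds t0; move: qt; rewrite ler_norml => /andP[]; lra.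
  have D2b : D2 * n.+1%:R <= 4 * (eta * n.+1%:R)^-1.
    rewrite /D2 mulrC ler_pdivrMr ?mulr_gt0 ?exprn_gt0//.
    rewrite (_ : 4 * _ * _ = 4 * (1 + t) ^+ 2 / n.+1%:R); last by field; rewrite !gt_eqF.
    rewrite ler_pdivlMr// -expr2 (_ : 4 * (1 + t) ^+ 2 = (2 * (1 + t)) ^+ 2); last by ring.
    by apply: lerXn2r; rewrite ?nnegrE; lra.
  have h1 : M%:R * eta * (avg n (fun s => X s ^+ 2) + avg n (fun s => X s ^+ (2 * M.+1))) <=
     M%:R * eta * (c * gam n).
    apply: ler_wpM2l; first by rewrite mulr_ge0// ltW.
    by rewrite /c; lra.
  have h2 : M%:R * D2 * (4 * avg n q2 + 4 * gam n) <= M%:R * ((eta * n.+1%:R)^-1 * (c * gam n)).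
    apply: (@le_trans _ _ (M%:R * (16 * (D2 * n.+1%:R) * gam n))).
      rewrite -mulrA ler_wpM2l//.
      rewrite (_ : 16 * _ * _ = D2 * (16 * n.+1%:R * gam n)); last by ring.
      rewrite ler_wpM2l//; have : 0 <= ((n.+1%:R : R) - 1) * gam n by apply: mulr_ge0; [lra|exact: ltW].
      lra.
    rewrite ler_wpM2l//; have i0 : 0 <= (eta * n.+1%:R)^-1 by apply/ltW; rewrite invr_gt0; apply: mulr_gt0.
    have h := ler_wpM2r (ltW g0) D2b.
    have c64 : 0 <= (c - 64) * ((eta * n.+1%:R)^-1 * gam n).
      apply: mulr_ge0; last by apply: mulr_ge0 => //; exact: ltW.
      by rewrite /c; have := exprn_gt0 (2 * M.+1) (ltr0Sn R 5); lra.
    move: h c64; clear; move: (D2 * _) (eta * _)^-1 (gam n) c => u v g d; lra.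
  have h12 := lerD h1 h2; apply: (le_trans h12); rewrite le_eqVlt; apply/orP; left; apply/eqP; ring.
have e1 : avg n (fun s => X s `^ nu + - 1) = avg n (fun s => X s `^ nu) - gam n.
  by rewrite avgD//; [rewrite avg_cst mulN1r|exact: poly_growth_cst].
have up : avg n (fun s => X s `^ nu + - 1) <= avg n bnd.
  by apply: le_avg => // s s0; apply: le_trans (Xb s s0); exact: ler_norm.
have dn : - avg n bnd <= avg n (fun s => X s `^ nu + - 1).
  rewrite -[leLHS]mulN1r -(avgZ n (-1) gb); apply: le_avg => // [|s s0].
    by apply: poly_growthM => //; exact: poly_growth_cst.
  by have := Xb s s0; rewrite ler_norml mulN1r => /andP[].
have rw : (1 + t) `^ nu * lam nu n - 1 = (avg n (fun s => X s `^ nu) - gam n) / gam n.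
  by rewrite lE mulrBl divff// gt_eqF.
rewrite rw -e1 normrM normfV (gtr0_norm g0) ler_pdivrMr//.
have fin : 0 <= (eta + (eta * n.+1%:R)^-1) * gam n.
  apply: mulr_ge0; last exact: ltW.
  by apply: addr_ge0; apply: ltW => //; rewrite invr_gt0 mulr_gt0.
have -> : (M%:R * c + 1) * (eta + (eta * n.+1%:R)^-1) * gam n =
  M%:R * c * (eta + (eta * n.+1%:R)^-1) * gam n + (eta + (eta * n.+1%:R)^-1) * gam n by ring.
move: up dn avgb fin; clear; move: (avg _ _) (avg _ _) (_ * _) (_ * _) => a b u v ? ? ? ?.
by rewrite ler_norml; apply/andP; split; lra.
Qed.

End Asymptotics.

(** * Subsequential limits of the eigenvalues *)

Section AsymptoticSubsequences.
Context {R : realType}.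
Implicit Types (s t nu : R) (n k M : nat).

Lemma cvg_powR1 nu (x : nat -> R) : (forall k, 0 < x k) ->
  x @ \oo --> (1 : R) -> (fun k => x k `^ nu) @ \oo --> (1 : R).
Proof.
move=> x0 cx; rewrite (_ : (fun k => _) = fun k => expR (nu * ln (x k))); last first.
  by apply/funext => k; rewrite /powR gt_eqF.
suff : (fun k => expR (nu * ln (x k))) @ \oo --> expR (nu * ln 1) by rewrite ln1 mulr0 expR0.
apply: (@continuous_cvg _ _ _ _ _ (fun k => nu * ln (x k)) expR); first exact: continuous_expR.
apply: cvgMl_tmp. apply: continuous_cvg => //.
exact: continuous_ln.
Qed.

Lemma homo_ltn_ge (sg : nat -> nat) : {homo sg : m n / (m < n)%N} -> forall k, (k <= sg k)%N.
Proof. by move=> h; elim=> [//|k ih]; apply: leq_ltn_trans ih (h _ _ _). Qed.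

(** By [lam_estimate], (1 + tau)^nu lam tends to 1, so only the limit a of the index over 1 + tau
    matters. *)
Lemma lam_along nu (tau : nat -> R) (sg : nat -> nat) (a : R) : 0 <= nu -> 0 < a ->
  {homo sg : m n / (m < n)%N} -> (forall k, 0 <= tau k) ->
  (forall k, `|qfun (tau k) - (sg k).+1%:R| <= 1) ->
  (fun k => (sg k).+1%:R / (a * (1 + tau k))) @ \oo --> (1 : R) ->
  (fun k => (sg k).+1%:R `^ nu * lam nu (sg k)) @ \oo --> a `^ nu.
Proof.
move=> nu0 a0 hs t0 q1 cx; have t1 k : 0 < 1 + tau k by have := t0 k; lra.
have cx1 := cvg_powR1 nu (fun k => divr_gt0 (ltr0Sn R (sg k)) (mulr_gt0 a0 (t1 k))) cx.
have cy : (fun k => (1 + tau k) `^ nu * lam nu (sg k)) @ \oo --> (1 : R).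
  have nuM : nu <= (Num.truncn nu).+1%:R by rewrite ltW// truncnS_gt.
  have [K K0 hK] := lam_estimate nu0 nuM.
  (* Once n + 1 >= eta^(-2), the bound K (eta + 1 / (eta (n + 1))) is at most 2 K eta = e. *)
  apply/cvgrPdist_le => e e0; pose eta := e / (2 * K).
  have eta0 : 0 < eta by rewrite divr_gt0// mulr_gt0.
  have [N hN] : exists N : nat, (eta ^+ 2)^-1 <= N%:R.
    by exists (Num.truncn (eta ^+ 2)^-1).+1; rewrite ltW// truncnS_gt.
  near=> k.
  have kN : (N <= sg k)%N by apply: leq_trans (homo_ltn_ge hs k); near: k; exact: nbhs_infty_ge.
  have kM : (4 * (Num.truncn nu).+2 <= sg k)%N.
    by apply: leq_trans (homo_ltn_ge hs k); near: k; exact: nbhs_infty_ge.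
  rewrite distrC; apply: (le_trans (hK (sg k) (tau k) eta kM (t0 k) eta0 (q1 k))).
  have h : (eta * (sg k).+1%:R)^-1 <= eta.
    rewrite invfM mulrC ler_pdivrMr// mulrC -expr2 -[leRHS]invrK lef_pV2 ?posrE ?invr_gt0 ?exprn_gt0//.
    by apply: (le_trans hN); rewrite ler_nat ltnW.
  apply: (@le_trans _ _ (K * (eta + eta))); first by rewrite ler_wpM2l ?(ltW K0)// lerD2l.
  by rewrite le_eqVlt; apply/orP; left; apply/eqP; rewrite /eta; field; rewrite gt_eqF.
rewrite (_ : (fun k => _) = fun k => a `^ nu * (((sg k).+1%:R / (a * (1 + tau k))) `^ nu *
   ((1 + tau k) `^ nu * lam nu (sg k)))).
  by have := cvgMl_tmp (a := a `^ nu) (cvgM cx1 cy); rewrite !mulr1; apply.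
apply/funext => k; move: (lam nu (sg k)) => y; rewrite !mulrA; congr (_ * y).
have x0 : 0 <= (sg k).+1%:R / (a * (1 + tau k)) by rewrite divr_ge0// ltW// mulr_gt0.
rewrite -(powRM _ (ltW a0) x0) -(powRM _ (mulr_ge0 (ltW a0) x0) (ltW (t1 k))).
by congr (_ `^ _); field; rewrite !gt_eqF.
Unshelve. all: by end_near.
Qed.

(** At points tau where ln (1 + tau) / 4 is theta modulo 2 pi, the sine is constant and q (tau) = a
    tau exactly. *)
Lemma lam_subseq nu (theta : R) : 0 <= nu -> 0 <= theta ->
  subseq_limit (fun k => k.+1%:R `^ nu * lam nu k) ((3 / 2 + sin theta / 2) `^ nu).
Proof.
move=> nu0 th0; pose a : R := 3 / 2 + sin theta / 2.
pose L k : R := theta + (pi *+ 2) *+ k; pose tau k : R := expR (4 * L k) - 1.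
have a1 : 1 <= a by have := sin_geN1 theta; rewrite /a; lra.
have a2 : a <= 2 by have := sin_le1 theta; rewrite /a; lra.
have pi0 := pi_ge2 R.
have Lk k : theta + 4 * k%:R <= L k.
  rewrite /L lerD2l -mulrnA -[leRHS]mulr_natr natrM; have : 0 <= k%:R :> R by []; nra.
have tk k : k%:R <= tau k.
  have := expR_ge1Dx (4 * L k); have := Lk k; have : 0 <= k%:R :> R by []; rewrite /tau; lra.
have t0 k : 0 <= tau k by apply: le_trans (tk k).
have tS k : tau k + 1 <= tau k.+1.
  have e : 4 * L k.+1 = 4 * L k + 4 * (pi *+ 2) by rewrite /L mulrSr; ring.
  have := expR_ge1Dx (4 * (pi *+ 2) : R); have := t0 k; rewrite /tau e expRD.
  by set x := expR (4 * L k); set y := expR _; rewrite mulr2n; nra.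
(* With n = sg k, a tau lies between n and n + 1, hence within 1 of n + 1. The indices increase
   strictly because tau grows by at least 1 per step and a >= 1. *)
pose sg k := Num.truncn (a * tau k).
have at0 k : 0 <= a * tau k by rewrite mulr_ge0//; lra.
have sgP k := truncn_itv (at0 k).
have hsg : {homo sg : m n / (m < n)%N}.
  apply: homo_ltn => [|k]; first exact: ltn_trans.
  rewrite truncn_ge_nat// -natr1; have /andP[h _] := sgP k.
  apply: (@le_trans _ _ (a * tau k + 1)); first by rewrite lerD2r.
  have := tS k; nra.
exists sg; split => //; apply: (@lam_along nu tau sg a) => //; first lra.
- move=> k; have -> : qfun (tau k) = a * tau k.
    rewrite /qfun /gfun /slow ellE// /tau subrKC expRK.
    rewrite (_ : 4 * L k / 4 = L k); last by field.
    by rewrite /L (periodicn (@sinD2pi R)) /a; field.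
  have /andP[h1 h2] := sgP k; rewrite /sg ler_norml -natr1; move: h1 h2; rewrite -natr1.
  by move=> h1 h2; apply/andP; split; lra.
apply/cvgrPdist_le => e e0; near=> k.
have t1 : 0 < 1 + tau k by have := t0 k; lra.
have h : 2 <= e * (1 + tau k).
  have : 2 / e <= k%:R by near: k; exact: nbhs_infty_ger.
  rewrite ler_pdivrMr// mulrC => h; apply: (le_trans h); rewrite ler_pM2l//.
  by have := tk k; lra.
have at1 : 0 < a * (1 + tau k) by rewrite mulr_gt0//; lra.
have /andP[h1 h2] := sgP k; move: h2; rewrite /sg -natr1 => h2.
rewrite distrC ler_distl ler_pdivlMr// ler_pdivrMr//.
have h3 : 2 <= e * (a * (1 + tau k)) by rewrite mulrCA; nra.
by apply/andP; split; nra.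
Unshelve. all: by end_near.
Qed.

(** By monotonicity one subsequence suffices, and along it (n + 1)^nu lam is eventually bounded. *)
Lemma lam_cvg0 nu : 0 < nu -> lam nu @ \oo --> (0 : R).
Proof.
move=> nu0; have [sg [hs cs]] := lam_subseq (ltW nu0) (lexx (0 : R)).
pose l : R := (3 / 2 + sin 0 / 2) `^ nu; have l0 : 0 <= l by exact: powR_ge0.
have dec : {homo lam (R := R) nu : m n / (m <= n)%N >-> n <= m}.
  by apply/nonincreasing_seqP => n; exact/ltW/lam_decreasing.
apply/cvgrPdist_le => e e0.
have ev : \forall k \near \oo, (sg k).+1%:R `^ nu * lam nu (sg k) <= l + 1 /\
    ((l + 1) / e) `^ nu^-1 <= k%:R.
  near=> k; split; last by near: k; exact: nbhs_infty_ger.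
  by near: k; apply: (cvgr_le l cs); lra.
have [k _ /(_ k (leqnn k)) /= [h1 h2]] := ev.
have h3 : (l + 1) / e <= (sg k).+1%:R `^ nu.
  have le0 : 0 <= (l + 1) / e by rewrite divr_ge0 ?(ltW e0)//; lra.
  have -> : (l + 1) / e = (((l + 1) / e) `^ nu^-1) `^ nu by rewrite -powRrM mulVf ?gt_eqF// powRr1.
  apply: ge0_ler_powR; rewrite ?nnegrE ?powR_ge0 ?(ltW nu0)//.
  by apply: (le_trans h2); rewrite ler_nat ltnW// ltnS homo_ltn_ge.
have p0 : 0 < (sg k).+1%:R `^ nu :> R by rewrite powR_gt0.
near=> n; rewrite sub0r normrN ger0_norm ?(ltW (lam_gt0 n (ltW nu0)))//.
apply: (@le_trans _ _ (lam nu (sg k))); first by apply: dec; near: n; exact: nbhs_infty_ge.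
rewrite -(ler_pM2l p0); apply: (le_trans h1).
by rewrite -ler_pdivrMr.
Unshelve. all: by end_near.
Qed.

End AsymptoticSubsequences.

(** * Smoothness and Hessian of the weight *)

Section SmoothWeight.
Context {R : realType}.
Implicit Types (p v : R * R) (i j : 'I_2).

Definition coord i p : R := if i == 0 then p.1 else p.2.

(* A class of functions closed under partial derivatives that contains the
   weight. *)
Inductive term : Type :=
  | Cst of R | Coord of 'I_2 | EllInv | SinSlow | CosSlow
  | Add of term & term | Mul of term & term.

Fixpoint eval (t : term) p : R :=
  match t with
  | Cst c => c
  | Coord i => coord i p
  | EllInv => (ell (sq p))^-1
  | SinSlow => sin (slow (sq p))
  | CosSlow => cos (slow (sq p))
  | Add t1 t2 => eval t1 p + eval t2 p
  | Mul t1 t2 => eval t1 p * eval t2 p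
  end.

(** As s = sq p >= 0, the partial derivative of [ell] along x_i is 2 x_i and that of [slow] is x_i /
    (2 (1 + s)); these give the constants. *)
Fixpoint deriv i (t : term) : term :=
  match t with
  | Cst _ => Cst 0
  | Coord j => Cst (i == j)%:R
  | EllInv => Mul (Cst (-2)) (Mul (Coord i) (Mul EllInv EllInv))
  | SinSlow => Mul (Cst (1 / 2)) (Mul CosSlow (Mul (Coord i) EllInv))
  | CosSlow => Mul (Cst (- (1 / 2))) (Mul SinSlow (Mul (Coord i) EllInv))
  | Add t1 t2 => Add (deriv i t1) (deriv i t2)
  | Mul t1 t2 => Add (Mul (deriv i t1) t2) (Mul t1 (deriv i t2))
  end.

Lemma coord_line i j p h : coord j (h *: evec i + p) = coord j p + (i == j)%:R * h.
Proof.
case: p => x y; rewrite /coord /evec; case: i => [[|[|//]] hi]; case: j => [[|[|//]] hj];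
  rewrite /= ?scaler0 ?add0r ?mul0r ?addr0 ?mul1r ?[_%:R]/1%R //= /GRing.scale /=; ring.
Qed.

Lemma c1_coord_line i j p :
  c1 (fun h => coord j (h *: evec i + p)) (fun=> (i == j)%:R).
Proof.
apply: eq_c1 (c1D (c1_cst (coord j p)) (c1Z (i == j)%:R (@c1_id R))) => h.
  by rewrite coord_line.
by rewrite add0r mulr1.
Qed.

Lemma sq_coord p : sq p = coord 0 p * coord 0 p + coord 1 p * coord 1 p.
Proof. by rewrite /sq /coord/= -!expr2. Qed.

Lemma c1_sq_line i p :
  c1 (fun h => sq (h *: evec i + p)) (fun h => 2 * coord i (h *: evec i + p)).
Proof.
have h0 := c1_coord_line i 0 p; have h1 := c1_coord_line i 1 p.
apply: eq_c1 (c1D (c1M h0 h0) (c1M h1 h1)) => h; first by rewrite sq_coord.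
by rewrite /coord; case: i {h0 h1} => [[|[|//]] hi] /=; ring.
Qed.

Lemma c1_slow_line i p : c1 (fun h => slow (sq (h *: evec i + p)))
  (fun h => (ell (sq (h *: evec i + p)))^-1 * coord i (h *: evec i + p) / 2).
Proof.
apply: eq_c1 (c1_comp (@c1_slow R) (c1_sq_line i p)) => h //.
by rewrite /slow' ell'E ?sq_ge0//; field; rewrite gt_eqF// ell_gt0.
Qed.

Lemma c1_eval_line i p t :
  c1 (fun h => eval t (h *: evec i + p)) (fun h => eval (deriv i t) (h *: evec i + p)).
Proof.
elim: t => [c|j||||t1 h1 t2 h2|t1 h1 t2 h2] /=.
- exact: c1_cst.
- exact: c1_coord_line.
- have h := c1_comp (c1V (@ell_gt0 R) (@c1_ell R)) (c1_sq_line i p).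
  apply: eq_c1 h => h //.
  by rewrite ell'E ?sq_ge0//; field; rewrite gt_eqF// ell_gt0.
- apply: eq_c1 (c1_comp (@c1_sin R) (c1_slow_line i p)) => h //.
  by field; rewrite gt_eqF// ell_gt0.
- apply: eq_c1 (c1_comp (@c1_cos R) (c1_slow_line i p)) => h //.
  by field; rewrite gt_eqF// ell_gt0.
- exact: c1D.
- exact: c1M.
Qed.

(** Transfers the one-variable [c1] calculus on lines to directional derivatives in the plane. *)
Lemma is_derive_line (u : R * R -> R) p v (d : R) :
  is_derive (0 : R) (1 : R) (fun h : R => u (h *: v + p)) d -> is_derive p v u d.
Proof.
have e : (fun h : R => h^-1 *: (((fun h : R => u (h *: v + p)) \o shift 0) (h *: (1 : R)) -
    u ((0 : R) *: v + p))) =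
  (fun h : R => h^-1 *: ((u \o shift p) (h *: v) - u p)).
  apply/funext => h /=.
  by rewrite (_ : h *: (1 : R) + 0 = h) ?scale0r ?add0r// addr0 /GRing.scale/= mulr1.
by move=> [dd de]; split; move: dd de; rewrite /derivable /derive e.
Qed.

Lemma is_derive_eval i p t : is_derive p (evec i) (eval t) (eval (deriv i t) p).
Proof.
have [_ /(_ 0)] := c1_eval_line i p t; rewrite scale0r add0r.
exact: is_derive_line.
Qed.

Lemma continuous_eval t : continuous (eval t).
Proof.
have ce := c1_continuous (@c1_ell R); have cs := c1_continuous (@c1_slow R).
have csq := cont2_comp cs (@cont2_sq R).
elim: t => [c|j||||t1 h1 t2 h2|t1 h1 t2 h2] /=.
- exact: cont2c.
- by rewrite /coord; case: (j == 0); [exact: cont2_fst|exact: cont2_snd].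
- have := c1_continuous (c1V (@ell_gt0 R) (@c1_ell R)).
  by move=> h; exact: (cont2_comp h (@cont2_sq R)).
- exact: (cont2_comp (c1_continuous (@c1_sin R)) csq).
- exact: (cont2_comp (c1_continuous (@c1_cos R)) csq).
- exact: cont2D.
- exact: cont2M.
Qed.

Lemma partial_eval i t : partial i (eval t) = eval (deriv i t).
Proof. by apply/funext => p; case: (is_derive_eval i p t). Qed.

Lemma Ck_eval n t : Ck n (eval t).
Proof.
elim: n t => [|n ih] t /=; first exact: continuous_eval.
split=> [|i p|i]; first exact: continuous_eval.
  by case: (is_derive_eval i p t).
by rewrite partial_eval.
Qed.

Definition phi (z : R[i]) : R := Gfun (modulus z ^+ 2).

Definition phi_term : term :=
  let s := Add (Mul (Coord 0) (Coord 0)) (Mul (Coord 1) (Coord 1)) in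
  Add (Mul (Cst (3 / 4)) s) (Mul (Mul (Cst (4 / 17)) (Add (Cst 1) s))
      (Add SinSlow (Mul (Cst (- (1 / 4))) CosSlow))).

Definition grad_term i : term :=
  Mul (Coord i) (Add (Cst (3 / 2)) (Mul (Cst (1 / 2)) SinSlow)).

Lemma phi_cpx p : phi (cpx p) = Gfun (sq p).
Proof. by rewrite /phi sqr_modulus_cpx. Qed.

Lemma phiE : phi \o cpx = eval phi_term.
Proof.
apply/funext => p; rewrite /= phi_cpx -sq_coord /Gfun ellE ?sq_ge0//.
by field.
Qed.

Lemma smooth_phi : smooth phi.
Proof. by move=> n; rewrite phiE; exact: Ck_eval. Qed.

Lemma radial_phi : radial phi.
Proof. by move=> z w zw; rewrite /phi zw. Qed.

Lemma partial_phi i : partial i (phi \o cpx) = eval (grad_term i).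
Proof.
apply/funext => p; have h := c1_comp (@c1_Gfun R) (c1_sq_line i p).
have [_ /(_ 0)] := h; rewrite scale0r add0r => h'.
have [_ d] := @is_derive_line (fun q => Gfun (sq q)) p (evec i) _ h'.
rewrite /partial (_ : phi \o cpx = fun q => Gfun (sq q)); last first.
  by apply/funext => q; rewrite /= phi_cpx.
by rewrite d; rewrite ell'E ?sq_ge0//=; field.
Qed.

Lemma hessianE (z : R[i]) i j : let p := (complex.Re z, complex.Im z) in
  hessian phi z i j = (i == j)%:R * (2 * gfun (sq p)) +
    coord i p * coord j p * (cos (slow (sq p)) / (4 * ell (sq p))).
Proof.
move=> p; rewrite mxE partial_phi partial_eval -/p /=.
by rewrite /gfun; field; rewrite gt_eqF// ell_gt0.
Qed.

Lemma quadratic_form2 (A : 'M[R]_2) (v : 'cV[R]_2) :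
  (v^T *m A *m v) 0 0 = \sum_i \sum_j A i j * (v i 0 * v j 0).
Proof.
rewrite mxE exchange_big /=; apply: eq_bigr => j _.
by rewrite mxE mulr_suml; apply: eq_bigr => i _; rewrite mxE; ring.
Qed.

(** The quadratic form is 2 G' |v|^2 + c (p . v)^2. Here 2 G' lies in [1, 2], and the second term is
    at most s |c| |v|^2 in absolute value, where s |c| <= 1/4 as s <= 1 + s. *)
Lemma hessian_bounds (z : R[i]) : loewner_le (3 / 4)%:M (hessian phi z) /\
  loewner_le (hessian phi z) (9 / 4)%:M.
Proof.
pose p := (complex.Re z, complex.Im z).
have e0 := ell_gt0 (sq p).
pose c := cos (slow (sq p)) / (4 * ell (sq p)).
have sE : sq p = p.1 ^+ 2 + p.2 ^+ 2 by [].
have c1 : - (1 / 4) <= sq p * c.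
  rewrite /c mulrA ler_pdivlMr ?mulr_gt0//; have := cos_geN1 (slow (sq p)).
  by have := sq_ge0 p; move: e0; rewrite ellE ?sq_ge0//; nra.
have c2 : sq p * c <= 1 / 4.
  rewrite /c mulrA ler_pdivrMr ?mulr_gt0//; have := cos_le1 (slow (sq p)).
  by have := sq_ge0 p; move: e0; rewrite ellE ?sq_ge0//; nra.
have /andP[g1 g2] : 1 <= 2 * gfun (sq p) <= 2 by have /andP[? ?] := gfun_bounds (sq p); lra.
have H (v : 'cV[R]_2) : (v^T *m hessian phi z *m v) 0 0 =
    2 * gfun (sq p) * (v 0 0 ^+ 2 + v 1 0 ^+ 2) + c * (p.1 * v 0 0 + p.2 * v 1 0) ^+ 2.
  rewrite quadratic_form2 !big_ord_recl !big_ord0 !hessianE /coord /= -/p -/c.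
  by rewrite (_ : lift ord0 ord0 = 1); [ring|exact/val_inj].
have S (k : R) (v : 'cV[R]_2) : (v^T *m k%:M *m v) 0 0 = k * (v 0 0 ^+ 2 + v 1 0 ^+ 2).
  rewrite quadratic_form2 !big_ord_recl !big_ord0 !mxE /=.
  by rewrite (_ : lift ord0 ord0 = 1); [rewrite ?mulr1n ?mulr0n; ring|exact/val_inj].
(* Cauchy-Schwarz *)
have CS (v : 'cV[R]_2) : (p.1 * v 0 0 + p.2 * v 1 0) ^+ 2 <= sq p * (v 0 0 ^+ 2 + v 1 0 ^+ 2).
  by have := sqr_ge0 (p.1 * v 1 0 - p.2 * v 0 0); rewrite sE; nra.
(* For either sign of c, one side uses x >= 0 and the other the upper bound of x. *)
have B (n x : R) : 0 <= n -> 0 <= x -> x <= sq p * n -> - (n / 4) <= c * x <= n / 4.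
  move=> n0 x0 xs; have h1 := ler_wpM2r n0 c1; have h2 := ler_wpM2r n0 c2.
  have [c0|c0] := leP 0 c; apply/andP; split.
  - by have := mulr_ge0 c0 x0; lra.
  - by have := ler_wpM2l c0 xs; lra.
  - by have := ler_wnM2l (ltW c0) xs; lra.
  - by have := ler_wnM2l (ltW c0) x0; rewrite mulr0; lra.
split=> v; rewrite H S; set n := v 0 0 ^+ 2 + v 1 0 ^+ 2; set x := (_ + _) ^+ 2;
  have n0 : 0 <= n by [rewrite addr_ge0 ?sqr_ge0];
  have /andP[b1 b2] := B n x n0 (sqr_ge0 _) (CS v).
  by have := ler_wpM2r n0 g1; lra.
by have := ler_wpM2r n0 g2; lra.
Qed.

End SmoothWeight.

(** * The Fock space as a weighted sequence space *)

Section Coefficients.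
Context {R : realType}.
Implicit Types (g h : R[i] -> R[i]) (a b c : nat -> R[i]) (nu : R) (n m N k : nat).
Local Notation phi := (@phi R).

Lemma weight_cpx (p : R * R) : weight phi (cpx p) = Wfun 0 (sq p).
Proof. by rewrite /weight phi_cpx /Wfun mul0r subr0. Qed.

Lemma Wfun_ge0 nu (s : R) : 0 <= Wfun nu s.
Proof. exact/ltW/Wfun_gt0. Qed.

Lemma pable_moment nu j : 0 <= nu -> pable (fun p : R * R => sq p ^+ j * Wfun nu (sq p)).
Proof.
move=> nu0; apply: eq_pable (pable_avg j nu0 (poly_growth_cst 1)) => p.
by rewrite mul1r.
Qed.

(** The weights gam k are the squared norms of the monomials, and bounded partial sums express
    summability. *)
Definition coefs a g := gser a g /\
  exists B : R, forall N, \sum_(k < N) modulus (a k) ^+ 2 * gam k <= B.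

Definition sqint nu g := pable (fun p : R * R => modulus (g (cpx p)) ^+ 2 * Wfun nu (sq p)).

Lemma sqint_le nu g : 0 <= nu -> entire g -> sqint 0 g -> sqint nu g.
Proof.
move=> nu0 eg; apply: le_pable.
  apply: pmeasM; first by apply: continuous2_measurable; exact: entire_cont2_modulus.
  by apply: pmeas_compc (@pmeas_sq R); exact: c1_continuous (c1_Wfun nu).
move=> p; rewrite ger0_norm ?mulr_ge0 ?exprn_ge0 ?modulus_ge0 ?Wfun_ge0//.
rewrite ler_wpM2l ?sqr_ge0// WfunE -[leRHS]mulr1 ler_wpM2l ?Wfun_ge0//.
rewrite -[leRHS](powRr0 (ell (sq p))) ler_powR ?oppr_le0//.
by rewrite ellE ?sq_ge0// lerDl sq_ge0.
Qed.

Lemma coefs_sqint nu a g : 0 <= nu -> coefs a g -> sqint nu g.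
Proof.
move=> nu0 [ag [B aB]]; apply: sqint_le => //; first exact: gser_entire ag.
apply: (parseval_bounded (c1_Wfun 0) (Wfun_ge0 0) (fun j => pable_moment j (lexx 0)) ag (B := B)).
by move=> N; apply: le_trans (aB N); apply: ler_sum => i _; rewrite gamE.
Qed.

(** Taylor expansion with Parseval's identity gives coefficients; conversely [parseval_bounded]
    gives square integrability. All later statements on F^2 go through this equivalence. *)
Lemma F2P g : F2 phi g <-> exists a, coefs a g.
Proof.
have eq1 : (fun p : R * R => (modulus (g (cpx p)) ^+ 2 * weight phi (cpx p))%:E) =
    (fun p => (modulus (g (cpx p)) ^+ 2 * Wfun 0 (sq p))%:E).
  by apply/funext => p; rewrite weight_cpx.
split=> [[[_]]|[a ca]].
  rewrite eq1 => fin eg; have [a ag] := entire_gser eg; exists a; split=> //.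
  have ig : sqint 0 g.
    apply/pable_ge0P => //; last by move=> p; rewrite mulr_ge0 ?exprn_ge0 ?modulus_ge0 ?Wfun_ge0.
    apply: pmeasM; first by apply: continuous2_measurable; exact: entire_cont2_modulus.
    by apply: pmeas_compc (@pmeas_sq R); exact: c1_continuous (c1_Wfun 0).
  have cv := parseval (c1_Wfun 0) (Wfun_ge0 0) (fun j => pable_moment j (lexx 0)) ag ig.
  exists (pint (fun p : R * R => modulus (g (cpx p)) ^+ 2 * Wfun 0 (sq p))) => N.
  have /nondecreasing_cvgn_le/(_ (cvgP _ cv) N) : nondecreasing_seq
      (fun N => \sum_(k < N) modulus (a k) ^+ 2 * moment (Wfun 0) k).
    apply/nondecreasing_seqP => n; rewrite big_ord_recr/= lerDl mulr_ge0 ?sqr_ge0//.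
    exact: (moment_ge0 (Wfun_ge0 0)).
  by rewrite (cvg_lim (@Rhausdorff R) cv); apply: le_trans; apply: ler_sum => i _; rewrite gamE.
have eg : entire g by case: ca => /gser_entire.
split=> //; split; first by have [c d] := entire_cont2 eg; split; exact: continuous2_measurable.
have ig := coefs_sqint (lexx 0) ca; rewrite eq1; apply/pable_ge0P => //; first exact: pable_pmeas.
by move=> p; rewrite mulr_ge0 ?exprn_ge0 ?modulus_ge0 ?Wfun_ge0.
Qed.

Lemma coefs_norm a g : coefs a g ->
  (fun N => \sum_(k < N) modulus (a k) ^+ 2 * gam k) @ \oo --> L2norm phi g ^+ 2.
Proof.
move=> ca; have ig := coefs_sqint (lexx 0) ca; have [ag _] := ca.
have cv := parseval (c1_Wfun 0) (Wfun_ge0 0) (fun j => pable_moment j (lexx 0)) ag ig.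
rewrite /L2norm sqr_sqrtr.
  rewrite (_ : Rintegral _ _ _ = pint (fun p : R * R => modulus (g (cpx p)) ^+ 2 * Wfun 0 (sq p))).
    by under eq_fun do under eq_bigr do rewrite gamE.
  by apply: eq_pint => p; rewrite weight_cpx.
by apply: pint_ge0 => p; rewrite weight_cpx mulr_ge0 ?exprn_ge0 ?modulus_ge0 ?Wfun_ge0.
Qed.

Lemma coefs_normP a g (B : R) : 0 <= B -> coefs a g ->
  L2norm phi g <= B <-> forall N, \sum_(k < N) modulus (a k) ^+ 2 * gam k <= B ^+ 2.
Proof.
move=> B0 ca; have cv := coefs_norm ca.
have n0 : 0 <= L2norm phi g by exact: sqrtr_ge0.
rewrite -(ler_sqr (x := L2norm phi g)) ?nnegrE//; split=> [h N|h].
  apply: (le_trans _ h); have /nondecreasing_cvgn_le/(_ (cvgP _ cv) N) : nondecreasing_seq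
      (fun N => \sum_(k < N) modulus (a k) ^+ 2 * gam k).
    by apply/nondecreasing_seqP => n; rewrite big_ord_recr/= lerDl mulr_ge0 ?sqr_ge0// ltW// gam_gt0.
  by rewrite (cvg_lim (@Rhausdorff R) cv).
by apply: (cvgr_to_le cv); apply: nearW.
Qed.

(** The inequality 2 |a_k| r^k <= |a_k|^2 gam k + r^(2k) / gam k and [gam_growth] yield absolute
    convergence at every radius. *)
Lemma coefs_exists a : (exists B : R, forall N, \sum_(k < N) modulus (a k) ^+ 2 * gam k <= B) ->
  exists g, coefs a g.
Proof.
move=> hB; have [B aB] := hB; suff [g ag] : exists g, gser a g by exists g.
apply: gser_exists => r r0; have [D hD] := gam_growth (exprn_ge0 2 r0).
exists ((B + D) / 2) => N; rewrite ler_pdivlMr// mulr_suml.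
apply: le_trans (lerD (aB N) (hD N)); rewrite -big_split/=; apply: ler_sum => k _.
have g0 := gam_gt0 (R := R) k; set x := modulus (a k); set y := r ^+ k.
rewrite -exprM mulnC exprM -/y.
have h := sqr_ge0 (x * gam k - y).
rewrite -(ler_pM2r g0) mulrDl [y ^+ 2 / _ * _]divfK ?gt_eqF//; nra.
Qed.

Lemma coefs_le a b (K : R) : 0 <= K -> (forall k, modulus (a k) <= K * modulus (b k)) ->
  (exists g, coefs b g) -> exists g, coefs a g.
Proof.
move=> K0 ab [g [_ [B bB]]]; apply: coefs_exists; exists (K ^+ 2 * B) => N.
apply: le_trans (ler_wpM2l (sqr_ge0 K) (bB N)); rewrite mulr_sumr; apply: ler_sum => k _.
rewrite mulrA -exprMn ler_wpM2r ?(ltW (gam_gt0 _))//.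
by apply: lerXn2r; rewrite ?nnegrE ?mulr_ge0 ?modulus_ge0.
Qed.

Lemma eq_gser a b g h : a =1 b -> g =1 h -> gser a g -> gser b h.
Proof. by move=> /funext-> /funext->. Qed.

Lemma eq_coefs a b g h : a =1 b -> g =1 h -> coefs a g -> coefs b h.
Proof. by move=> /funext-> /funext->. Qed.

Lemma coefsD a b g h : coefs a g -> coefs b h ->
  coefs (fun k => a k + b k) (fun z => g z + h z).
Proof.
move=> [ag [A hA]] [bh [B hB]]; split.
  by apply: eq_gser (gser_lin 1 ag bh) => k; rewrite mul1r.
exists (2 * A + 2 * B) => N.
apply: le_trans (lerD (ler_wpM2l (ler0n R 2) (hA N)) (ler_wpM2l (ler0n R 2) (hB N))).
rewrite !mulr_sumr -big_split/=; apply: ler_sum => k _.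
have := sqr_modulusB_le (a k) (- b k); rewrite opprK modulusN => h'.
by have := ler_wpM2r (ltW (gam_gt0 k)) h'; lra.
Qed.

Lemma coefsZ (t : R[i]) a g : coefs a g -> coefs (fun k => t * a k) (fun z => t * g z).
Proof.
move=> [ag [A hA]]; have z0 : gser (fun=> 0) (fun=> 0 : R[i]).
  by apply: eq_gser (gser_lin (-1) ag ag) => k; rewrite mulN1r addNr.
split.
  by apply: eq_gser (gser_lin t ag z0) => k; rewrite addr0.
exists (modulus t ^+ 2 * A) => N; apply: le_trans (ler_wpM2l (sqr_ge0 (modulus t)) (hA N)).
rewrite mulr_sumr; apply: ler_sum => k _; rewrite modulusM le_eqVlt; apply/orP; left; apply/eqP; ring.
Qed.

Lemma coefsB a b g h : coefs a g -> coefs b h ->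
  coefs (fun k => a k - b k) (fun z => g z - h z).
Proof.
by move=> ca /(coefsZ (-1)) cb; apply: eq_coefs (coefsD ca cb) => k; rewrite mulN1r.
Qed.

Lemma coefs_unique a b g : coefs a g -> coefs b g -> a = b.
Proof. by move=> [ag _] [bg _]; exact: gser_unique ag bg. Qed.

Lemma coefs_inj a g h : coefs a g -> coefs a h -> g = h.
Proof. by move=> [ag _] [ah _]; exact: gser_inj ag ah. Qed.

Lemma coefs_monomial m : coefs (fun k => (k == m)%:R) (fun z => z ^+ m).
Proof.
have [|g cg] := @coefs_exists (fun k => (k == m)%:R).
  exists (gam m) => N; elim: N => [|N ih]; first by rewrite big_ord0 ltW// gam_gt0.
  rewrite big_ord_recr/=; have [->|Nm] := eqVneq N m; last first.
    by rewrite modulus0 expr0n mul0r addr0.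
  rewrite modulus1 expr1n mul1r big1 ?add0r// => k _.
  by rewrite ltn_eqF// modulus0 expr0n mul0r.
suff -> : (fun z => z ^+ m) = g by [].
apply/funext => z; have [cg' _] := cg; apply: (ccvg_unique _ (gser_cvg z cg')).
have e N : (m < N)%N -> psum (fun k => (k == m)%:R) N z = z ^+ m.
  move=> mN; rewrite /psum (bigD1 (Ordinal mN))//= eqxx mul1r big1 ?addr0// => i im.
  by rewrite (negbTE (_ : (i : nat) != m)) ?mul0r.
split; apply: cvg_near_cst; exists m.+1 => // N mN; rewrite e//.
Qed.

(** Only real parts are paired; replacing h by i h recovers the imaginary part of the inner
    product. *)
Definition re_form nu g h : R :=
  pint (fun p : R * R => complex.Re (g (cpx p) * (h (cpx p))^*%C) * Wfun nu (sq p)).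

Lemma re_form_cvg nu a b g h : 0 <= nu -> coefs a g -> coefs b h ->
  (fun N => \sum_(k < N) complex.Re (a k * (b k)^*%C) * (lam nu k * gam k)) @ \oo --> re_form nu g h.
Proof.
move=> nu0 ca cb; have [ag _] := ca; have [bh _] := cb.
have [_] := parseval_inner (c1_Wfun nu) (Wfun_ge0 nu) (fun j => pable_moment j nu0) ag bh
  (coefs_sqint nu0 ca) (coefs_sqint nu0 cb).
rewrite /cvg_inner (_ : (fun N => _) = (fun N => \sum_(k < N)
  complex.Re (a k * (b k)^*%C) * (lam nu k * gam k)))//.
apply/funext => N; apply: eq_bigr => k _.
by rewrite /lam divfK// gt_eqF// gam_gt0.
Qed.

Lemma re_form_pable nu a b g h : 0 <= nu -> coefs a g -> coefs b h ->
  pable (fun p : R * R => complex.Re (g (cpx p) * (h (cpx p))^*%C) * Wfun nu (sq p)).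
Proof.
move=> nu0 ca cb; have [ag _] := ca; have [bh _] := cb.
by have [] := parseval_inner (c1_Wfun nu) (Wfun_ge0 nu) (fun j => pable_moment j nu0) ag bh
  (coefs_sqint nu0 ca) (coefs_sqint nu0 cb).
Qed.

Lemma coefs_lam nu a g : 0 < nu -> coefs a g ->
  exists h, coefs (fun k => (lam nu k)%:C * a k) h.
Proof.
move=> nu0 ca; apply: (coefs_le (b := a) (K := lam nu 0)); last by exists g.
  exact/ltW/lam_gt0/ltW.
move=> k; rewrite modulusM ler_wpM2r ?modulus_ge0//.
rewrite modulus_real ger0_norm ?(ltW (lam_gt0 _ (ltW nu0)))//.
elim: k => [//|k ih]; exact: le_trans (ltW (lam_decreasing k nu0)) ih.
Qed.

Lemma lam0 k : lam 0 k = 1 :> R.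
Proof. by rewrite /lam -gamE divff// gt_eqF// gam_gt0. Qed.

(* Multiplication by the symbol turns the form of weight exponent 0 into that
   of exponent nu, i.e. acts on coefficients by lam nu. *)
Lemma re_form_lam nu a b g g' h : 0 < nu -> coefs a g ->
  coefs (fun k => (lam nu k)%:C * a k) g' -> coefs b h -> re_form nu g h = re_form 0 g' h.
Proof.
move=> nu0 ca ca' cb; have c1 := re_form_cvg (ltW nu0) ca cb.
have := re_form_cvg (lexx 0) ca' cb.
rewrite (_ : (fun N => _) = (fun N => \sum_(k < N)
  complex.Re (a k * (b k)^*%C) * (lam nu k * gam k))); last first.
  apply/funext => N; apply: eq_bigr => k _; rewrite lam0 mul1r -mulrA ReM/= mul0r subr0.
  by ring.
by move=> c2; exact: (cvg_unique (@Rhausdorff R) c1 c2).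
Qed.

Lemma re_form_sym nu g h : re_form nu g h = re_form nu h g.
Proof.
by apply: eq_pint => p; congr (_ * _); rewrite !ReM; case: (g _) (h _) => x y [u v] /=; ring.
Qed.

(** Testing on g - h itself makes its norm, hence every coefficient, vanish. This supplies
    uniqueness for both the projection and the adjoint. *)
Lemma re_form_inj a b g h : coefs a g -> coefs b h ->
  (forall c f, coefs c f -> re_form 0 g f = re_form 0 h f) -> g = h.
Proof.
move=> ca cb gh; have cd := coefsB ca cb.
have c1 := re_form_cvg (lexx 0) ca cd; have := re_form_cvg (lexx 0) cb cd.
rewrite -(gh _ _ cd) => c2.
pose S N : R := \sum_(k < N) modulus (a k - b k) ^+ 2 * gam k.
have cS : S @ \oo --> (0 : R).
  rewrite -(subrr (re_form 0 g (fun z => g z - h z))).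
  rewrite (_ : S = fun N => (\sum_(k < N) complex.Re (a k * ((a k - b k)^*)%C) * (lam 0 k * gam k)) -
    (\sum_(k < N) complex.Re (b k * ((a k - b k)^*)%C) * (lam 0 k * gam k))); first exact: cvgB.
  apply/funext => N; rewrite /S -sumrB; apply: eq_bigr => k _.
  rewrite lam0 mul1r -mulrBl sqr_modulus !ReM; congr (_ * _).
  by case: (a k) (b k) => x y [u v] /=; ring.
have S0 N : S N <= 0.
  rewrite -(cvg_lim (@Rhausdorff R) cS); apply: nondecreasing_cvgn_le; last exact: cvgP cS.
  by apply/nondecreasing_seqP => n; rewrite /S big_ord_recr/= lerDl mulr_ge0 ?sqr_ge0// ltW// gam_gt0.
suff e : a = b by move: cb; rewrite -e; exact: coefs_inj.
apply/funext => k; apply/eqP; rewrite -subr_eq0 -modulus_eq0 -sqrf_eq0.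
have Sk : 0 <= S k by apply: sumr_ge0 => i _; rewrite mulr_ge0 ?sqr_ge0// ltW// gam_gt0.
have := S0 k.+1; rewrite /S big_ord_recr/= -/(S k) => h'.
rewrite eq_le sqr_ge0 andbT -(pmulr_lle0 _ (gam_gt0 k)) mulrC; lra.
Qed.

Lemma re_form_I nu g h : re_form nu g (fun z => 'i%C * h z) =
  pint (fun p : R * R => complex.Im (g (cpx p) * (h (cpx p))^*%C) * Wfun nu (sq p)).
Proof.
apply: eq_pint => p; congr (_ * _); rewrite ReM ImM.
by case: (g _) (h _) => x y [u v] /=; ring.
Qed.

End Coefficients.

(** * Diagonalisation of the Toeplitz operator *)

Section ToeplitzOperator.
Context {R : realType}.
Variable beta : R.
Hypothesis beta0 : 0 < beta.
Implicit Types (g h : R[i] -> R[i]) (a b c : nat -> R[i]) (n m N k : nat).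
Local Notation phi := (@phi R).
Local Notation nu := (beta / 2).
Local Notation T := (toeplitz phi (fun z => (symbol beta z)%:C)).

Lemma nu_gt0 : 0 < nu. Proof. by rewrite divr_gt0. Qed.

Lemma symbol_weight (p : R * R) : symbol beta (cpx p) * Wfun 0 (sq p) = Wfun nu (sq p).
Proof. by rewrite /symbol sqr_modulus_cpx -ellE ?sq_ge0// mulrC -WfunE. Qed.

Lemma Re_scale (z : R[i]) (x : R) : complex.Re (z * x%:C) = complex.Re z * x.
Proof. by rewrite ReM; case: z => u v /=; rewrite mulr0 subr0. Qed.

Lemma Im_scale (z : R[i]) (x : R) : complex.Im (z * x%:C) = complex.Im z * x.
Proof. by rewrite ImM; case: z => u v /=; rewrite mulr0 add0r. Qed.

Lemma innerE g h : inner phi g h = re_form 0 g h +i* re_form 0 g (fun z => 'i%C * h z).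
Proof.
rewrite re_form_I; apply: eq_complexP => /=; apply: eq_pint => p.
  by rewrite weight_cpx Re_scale.
by rewrite weight_cpx Im_scale.
Qed.

Lemma inner_residual a b c g g' h : coefs a g -> coefs c g' -> coefs b h ->
  inner phi (fun z => (symbol beta z)%:C * g z - g' z) h =
  (re_form nu g h - re_form 0 g' h) +i*
  (re_form nu g (fun z => 'i%C * h z) - re_form 0 g' (fun z => 'i%C * h z)).
Proof.
move=> ca cc cb; have cib := coefsZ 'i%C cb; have n0 := ltW nu_gt0.
rewrite innerE; congr (_ +i* _); rewrite -pintB.
- by apply: eq_pint => p; rewrite -symbol_weight !ReM !(ReB, ImB) !ReM !ImM /=; ring.
- exact: re_form_pable n0 ca cb.
- exact: re_form_pable (lexx 0) cc cb.
- by apply: eq_pint => p; rewrite -symbol_weight !ReM !(ReB, ImB) !ReM !ImM /=; ring.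
- exact: re_form_pable n0 ca cib.
- exact: re_form_pable (lexx 0) cc cib.
Qed.

(** By [re_form_lam] h satisfies the orthogonality relations selecting the projection; two solutions
    have the same pairings with F^2, hence coincide. *)
Lemma toeplitzE a g h : coefs a g -> coefs (fun k => (lam nu k)%:C * a k) h -> T g = h.
Proof.
move=> ca ch; rewrite /toeplitz /projF2; apply: xget_subset1 => [|x y].
  split; first by apply/F2P; eexists; exact: ch.
  move=> k /F2P[b cb]; rewrite (inner_residual ca ch cb).
  by rewrite (re_form_lam nu_gt0 ca ch cb) (re_form_lam nu_gt0 ca ch (coefsZ 'i%C cb)) !subrr.
move=> [/F2P[c cx] hx] [/F2P[d dy] hy]; apply: (re_form_inj cx dy) => b f cb.
have F2f : F2 phi f by apply/F2P; exists b.
have := hx _ F2f; have := hy _ F2f; rewrite (inner_residual ca cx cb) (inner_residual ca dy cb).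
by move=> [e1 _] [e2 _]; move/eqP: e1; move/eqP: e2; rewrite !subr_eq0 => /eqP <- /eqP.
Qed.

Lemma toeplitz_coefs a g : coefs a g -> coefs (fun k => (lam nu k)%:C * a k) (T g).
Proof.
by move=> ca; have [h ch] := coefs_lam nu_gt0 ca; rewrite (toeplitzE ca ch).
Qed.

Lemma inner_lam a b g g' h h' : coefs a g -> coefs (fun k => (lam nu k)%:C * a k) g' ->
  coefs b h -> coefs (fun k => (lam nu k)%:C * b k) h' -> inner phi g' h = inner phi g h'.
Proof.
have key a1 b1 g1 g1' h1 h1' : coefs a1 g1 -> coefs (fun k => (lam nu k)%:C * a1 k) g1' ->
    coefs b1 h1 -> coefs (fun k => (lam nu k)%:C * b1 k) h1' ->
    re_form 0 g1' h1 = re_form 0 g1 h1'.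
  move=> ca ca' cb cb'; rewrite -(re_form_lam nu_gt0 ca ca' cb) re_form_sym.
  by rewrite (re_form_lam nu_gt0 cb cb' ca) re_form_sym.
move=> ca ca' cb cb'; rewrite !innerE (key _ _ _ _ _ _ ca ca' cb cb'); congr (_ +i* _).
apply: (key _ _ _ _ _ _ ca ca' (coefsZ 'i%C cb)).
by apply: eq_coefs (coefsZ 'i%C cb') => // k; rewrite mulrCA.
Qed.

(** Since the eigenvalues are real, T is symmetric on F^2, and the relation defining the adjoint has
    at most one solution. *)
Lemma adjoint_toeplitzE b h : F2 phi h -> adjoint phi T h = T h.
Proof.
move=> /F2P[{}b cb]; have ch := toeplitz_coefs cb.
rewrite /adjoint; apply: xget_subset1 => [|x y].
  split; first by apply/F2P; eexists; exact: ch.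
  by move=> g /F2P[a ca]; exact: inner_lam ca (toeplitz_coefs ca) cb ch.
move=> [/F2P[c cx] hx] [/F2P[d dy] hy]; apply: (re_form_inj cx dy) => a f ca.
have F2f : F2 phi f by apply/F2P; exists a.
by move: (hx _ F2f); rewrite (hy _ F2f) !innerE => -[e _]; rewrite re_form_sym -e re_form_sym.
Qed.

Lemma toeplitz_linear : linear_on_F2 phi T.
Proof.
split=> [g /F2P[a ca]|t g h /F2P[a ca] /F2P[b cb]].
  by apply/F2P; eexists; exact: toeplitz_coefs ca.
apply: (toeplitzE (coefsD (coefsZ t ca) cb)).
apply: eq_coefs (coefsD (coefsZ t (toeplitz_coefs ca)) (toeplitz_coefs cb)) => // k.
by rewrite /=; ring.
Qed.

Lemma eigenspace_coefs (mu : R) a g : coefs a g ->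
  Defs.eigenspace phi (fun g => adjoint phi T (T g)) mu g <->
  forall k, (lam nu k ^+ 2)%:C * a k = mu%:C * a k.
Proof.
move=> ca; have c1 := toeplitz_coefs ca; have c2 := toeplitz_coefs c1.
have F1 : F2 phi (T g) by apply/F2P; eexists; exact: c1.
have cmu := coefsZ mu%:C ca; split=> [[_]|h].
  rewrite adjoint_toeplitzE// => e; rewrite e in c2; have := coefs_unique c2 cmu.
  by move=> /funeqP h k; rewrite -h mulrA -rmorphM -expr2.
split; first by apply/F2P; exists a.
rewrite adjoint_toeplitzE//; apply: coefs_inj c2 _; apply: eq_coefs cmu => // k.
by rewrite -h mulrA -rmorphM -expr2.
Qed.

Lemma lam_inj k m : lam nu k = lam nu m -> k = m.
Proof.
have dec : {homo lam (R := R) nu : i j / (i < j)%N >-> j < i}.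
  by apply: homo_ltn => [y x z yx zy|i]; [exact: lt_trans zy yx|exact/lam_decreasing/nu_gt0].
by case: (ltngtP k m) => // h e; have := dec _ _ h; rewrite e ltxx.
Qed.

(** Strict monotonicity makes the eigenvalues of T^* T simple: an eigenfunction has at most one
    nonzero coefficient, so an eigenspace is spanned by one monomial or is zero. *)
Lemma toeplitz_singular_values : singular_values phi T (lam nu).
Proof.
have l0 k : 0 < lam nu k by exact/lam_gt0/ltW/nu_gt0.
split=> [||| mu mu0].
- by apply/nonincreasing_seqP => n; exact/ltW/lam_decreasing/nu_gt0.
- by move=> k; exact/ltW.
- exact/lam_cvg0/nu_gt0.
have zero a k g : Defs.eigenspace phi (fun g => adjoint phi T (T g)) (mu ^+ 2) g -> coefs a g ->
    lam nu k != mu -> a k = 0.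
  move=> Eg ca km; have /(_ k)/eqP := (eigenspace_coefs _ ca).1 Eg.
  rewrite -subr_eq0 -mulrBl mulf_eq0 => /orP[|/eqP//].
  rewrite -rmorphB -modulus_eq0 modulus_real normr_eq0 subr_eq0 => /eqP e.
  by case/eqP: km; apply: (@pexpIrn R 2) => //; rewrite ?nnegrE; exact: ltW.
have [[m mE]|noex] := pselect (exists m, lam nu m = mu).
  exists 1%N; split; last first.
    rewrite (_ : [set k | lam nu k = mu] = [set m]); first exact: card_set1.
    by apply/seteqP; split=> k /= => [|->//]; rewrite -mE => /lam_inj.
  exists (fun _ z => z ^+ m); split=> [_|c h i|g Eg].
  - apply/(eigenspace_coefs _ (coefs_monomial m)) => k.
    by have [->|_] := eqVneq k m; [rewrite mE|rewrite !mulr0].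
  - by have := h 1; rewrite big_ord_recl big_ord0 addr0 expr1n mulr1 (ord1 i) => <-; congr c; exact: val_inj.
  - have [/F2P[a ca] _] := Eg; exists (fun=> a m) => z.
    rewrite big_ord_recl big_ord0 addr0; have := coefsZ (a m) (coefs_monomial m) => cm.
    have e : a = (fun k => a m * (k == m)%:R).
      apply/funext => k; have [->|km] := eqVneq k m; first by rewrite mulr1.
      by rewrite mulr0; apply: zero Eg ca _; apply: contra km => /eqP; rewrite -mE => /lam_inj ->.
    by rewrite e in ca; rewrite (coefs_inj ca cm).
exists 0%N; split.
  exists (fun _ z => 0); split=> [[]//|_ _ []//|g Eg].
  exists (fun=> 0) => z; rewrite big_ord0.
  have [/F2P[a ca] _] := Eg.
  have e : a = (fun k => 0 * a k).
    apply/funext => k; rewrite mul0r; apply: zero Eg ca _.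
    by apply/eqP => km; apply: noex; exists k.
  have := coefsZ 0 ca; rewrite -e => c0; rewrite (coefs_inj ca c0) mul0r//.
rewrite (_ : [set k | lam nu k = mu] = set0); first by rewrite II0.
by apply/seteqP; split=> k //= km; apply: noex; exists k.
Qed.

End ToeplitzOperator.

(** * Compactness *)

Section Compactness.
Context {R : realType}.
Variable beta : R.
Hypothesis beta0 : 0 < beta.
Implicit Types (g h : R[i] -> R[i]) (a b c : nat -> R[i]) (n m N M k : nat).
Local Notation phi := (@phi R).
Local Notation nu := (beta / 2).
Local Notation T := (toeplitz phi (fun z => (symbol beta z)%:C)).

(** The rows lie in a product of compact intervals and have a cluster point there by Tychonoff's
    theorem; indices are then chosen one at a time, each approaching it in more coordinates. *)
Lemma diagonal_subsequence (x : nat -> nat -> R) (B : nat -> R) :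
  (forall n j, `|x n j| <= B j) -> exists (sg : nat -> nat) (y : nat -> R),
  {homo sg : m n / (m < n)%N} /\ forall j, (fun n => x (sg n) j) @ \oo --> y j.
Proof.
move=> xB; pose K : set (prod_topology (fun _ : nat => R : topologicalType)) :=
  [set f | forall j, `[- B j, B j]%classic (f j)].
have cK : compact K.
  exact: (@tychonoff nat (fun _ => R : topologicalType) (fun j => `[- B j, B j]%classic)
    (fun j => @segment_compact R _ _)).
have FF : ProperFilter (x @ \oo) by exact: fmap_proper_filter.
have xK n : K (x n) by move=> j /=; rewrite in_itv/= -ler_norml.
have [y [_ cy]] := cK (x @ \oo) FF (ex_intro2 _ _ 0%N I (fun n _ => xK n)).
have nb (e : R) j : 0 < e -> nbhs (y : prod_topology (fun _ : nat => R : topologicalType))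
    [set f | forall i, (i <= j)%N -> `|f i - y i| < e].
  move=> e0; have n1 i : nbhs (y : prod_topology (fun _ : nat => R : topologicalType))
      [set f | `|f i - y i| < e].
    have nA : nbhs (y i : R) [set t : R | `|t - y i| < e].
      by apply/nbhs_ballP; exists e => // t; rewrite /ball/= distrC.
    exact: (@proj_continuous nat (fun _ => R : topologicalType) i y _ nA).
  have Fy : Filter (nbhs (y : prod_topology (fun _ : nat => R : topologicalType))).
    exact: nbhs_filter.
  elim: j => [|j ih].
    by apply: (@filterS _ _ Fy _ _ _ (n1 0%N)) => f f0 i; rewrite leqn0 => /eqP ->.
  apply: (@filterS _ _ Fy _ _ _ (@filterI _ _ Fy _ _ ih (n1 j.+1))) => f [f1 f2] i.
  by rewrite leq_eqVlt => /orP[/eqP->//|]; rewrite ltnS; exact: f1.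
(* The first component is the index to exceed; the second fixes both the coordinates treated and the
   precision. *)
have pick (q : nat * nat) : exists n, (q.1 < n)%N /\
    forall i, (i <= q.2)%N -> `|x n i - y i| < q.2.+1%:R^-1.
  have q0 : (0 : R) < q.2.+1%:R^-1 by rewrite invr_gt0.
  have xA : (x @ \oo) [set f | exists2 n, (q.1 < n)%N & x n = f].
    by exists q.1.+1 => // n /= qn; exists n.
  have [f [[n Nn <-] fB]] := cy _ _ xA (nb q.2.+1%:R^-1 q.2 q0).
  by exists n.
have [s hs] := choice pick.
pose sg := fix sg n := if n is m.+1 then s (sg m, m.+1) else s (0%N, 0%N).
exists sg, y; split.
  by apply: homo_ltn => [|n]; [exact: ltn_trans|have [] := hs (sg n, n.+1)].
have hsg n i : (i <= n)%N -> `|x (sg n) i - y i| < n.+1%:R^-1.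
  by case: n => [|n] /=; [have [_] := hs (0%N, 0%N)|have [_] := hs (sg n, n.+1)]; apply.
move=> j; apply/cvgrPdist_le => e e0.
near=> n; rewrite distrC ltW//; apply: (lt_le_trans (hsg n j _)).
  by near: n; exact: nbhs_infty_ge.
have h : e^-1 <= n.+1%:R by apply: (@le_trans _ _ n%:R); [near: n; exact: nbhs_infty_ger|rewrite ler_nat].
by rewrite -[leRHS]invrK lef_pV2 ?posrE ?invr_gt0.
Unshelve. all: by end_near.
Qed.

(** Real and imaginary parts are interleaved by parity into one real sequence. The free sequence c
    serves twice: c = 0 bounds b, and c = b gives convergence. *)
Lemma coefs_subsequence (a : nat -> nat -> R[i]) :
  (forall n N, \sum_(k < N) modulus (a n k) ^+ 2 * gam k <= 1) ->
  exists (sg : nat -> nat) b, {homo sg : m n / (m < n)%N} /\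
    forall c N, (fun n => \sum_(k < N) modulus (a (sg n) k - c k) ^+ 2 * gam k) @ \oo -->
      \sum_(k < N) modulus (b k - c k) ^+ 2 * gam k.
Proof.
move=> a1; have g0 k := gam_gt0 (R := R) k.
pose x n j := if odd j then complex.Im (a n j./2) else complex.Re (a n j./2).
have xB n j : `|x n j| <= Num.sqrt (gam j./2)^-1.
  have h : modulus (a n j./2) <= Num.sqrt (gam j./2)^-1.
    rewrite -[leLHS](ger0_norm (modulus_ge0 _)) -sqrtr_sqr ler_wsqrtr//.
    rewrite -[leRHS]mul1r ler_pdivlMr//; apply: le_trans (a1 n (j./2).+1).
    rewrite big_ord_recr/= lerDr; apply: sumr_ge0 => i _.
    by rewrite mulr_ge0 ?sqr_ge0// ltW.
  by rewrite /x; case: (odd j); apply: le_trans h; [exact: ler_Im_modulus|exact: ler_Re_modulus].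
have [sg [y [hs cy]]] := diagonal_subsequence xB.
exists sg, (fun k => y k.*2 +i* y k.*2.+1); split=> // c N.
have cR k : (fun n => complex.Re (a (sg n) k)) @ \oo --> y k.*2.
  by have := cy k.*2; rewrite /x odd_double doubleK.
have cI k : (fun n => complex.Im (a (sg n) k)) @ \oo --> y k.*2.+1.
  by have := cy k.*2.+1; rewrite /x /= odd_double /= uphalf_double.
have cF k : (fun n => modulus (a (sg n) k - c k) ^+ 2 * gam k) @ \oo -->
    modulus ((y k.*2 +i* y k.*2.+1) - c k) ^+ 2 * gam k.
  apply: cvgMr_tmp; rewrite sqr_modulus ReB ImB !expr2 /=.
  rewrite (_ : (fun n => _) = fun n =>
    (complex.Re (a (sg n) k) - complex.Re (c k)) * (complex.Re (a (sg n) k) - complex.Re (c k)) +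
    (complex.Im (a (sg n) k) - complex.Im (c k)) * (complex.Im (a (sg n) k) - complex.Im (c k))); last first.
    by apply/funext => n; rewrite sqr_modulus ReB ImB !expr2.
  have dR : (fun n => complex.Re (a (sg n) k) - complex.Re (c k)) @ \oo --> y k.*2 - complex.Re (c k).
    by apply: cvgB => //; exact: cvg_cst.
  have dI : (fun n => complex.Im (a (sg n) k) - complex.Im (c k)) @ \oo --> y k.*2.+1 - complex.Im (c k).
    by apply: cvgB => //; exact: cvg_cst.
  by apply: cvgD; apply: cvgM.
elim: N => [|N ih].
  rewrite big_ord0 (_ : (fun n => _) = fun=> 0); first exact: cvg_cst.
  by apply/funext => n; rewrite big_ord0.
rewrite big_ord_recr (_ : (fun n => _) = (fun n => \sum_(k < N) modulus (a (sg n) k - c k) ^+ 2 * gam k +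
    modulus (a (sg n) N - c N) ^+ 2 * gam N)); last by apply/funext => n; rewrite big_ord_recr.
exact: cvgD ih (cF N).
Qed.

(** Coefficientwise convergence becomes norm convergence of the images, because lam k tends to 0 and
    damps the tail uniformly. *)
Lemma toeplitz_compact : compact_op phi T.
Proof.
split; first exact: toeplitz_linear.
move=> u hu; have g0 k := gam_gt0 (R := R) k; have n0 := nu_gt0 beta0.
have l0 k : 0 < lam nu k by exact/lam_gt0/ltW.
have ldec : {homo lam (R := R) nu : m n / (m <= n)%N >-> n <= m}.
  by apply/nonincreasing_seqP => n; exact/ltW/lam_decreasing.
have /choice[a ca] : forall n, exists a, coefs a (u n).
  by move=> n; apply/F2P; have [] := hu n.
have a1 n N : \sum_(k < N) modulus (a n k) ^+ 2 * gam k <= 1.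
  have [_ h] := hu n; have := (coefs_normP ler01 (ca n)).1 h N.
  by rewrite expr1n.
have [sg [b [hs cb]]] := coefs_subsequence a1.
have b1 N : \sum_(k < N) modulus (b k) ^+ 2 * gam k <= 1.
  have := cb (fun=> 0) N; under eq_bigr do rewrite subr0.
  by move=> /cvgr_to_le; apply; apply: nearW => n; under eq_bigr do rewrite subr0.
have [h0 ch0] : exists h, coefs b h by apply: coefs_exists; exists 1.
have cTh := toeplitz_coefs beta0 ch0.
exists sg, (T h0); split=> //; first by apply/F2P; eexists; exact: cTh.
have d4 n N : \sum_(k < N) modulus (a n k - b k) ^+ 2 * gam k <= 4.
  have := lerD (ler_wpM2l (ler0n R 2) (a1 n N)) (ler_wpM2l (ler0n R 2) (b1 N)).
  rewrite !mulr_sumr -big_split/= => h; have -> : 4 = 2 * 1 + 2 * 1 :> R by ring.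
  apply: le_trans h; apply: ler_sum => k _; have := sqr_modulusB_le (a n k) (b k).
  by move=> /(ler_wpM2r (ltW (g0 k))); lra.
apply/cvgr0Pnorm_le => e e0; have L0 := l0 0%N; set L := lam nu 0 in L0.
have [M _ hM] : \forall k \near \oo, lam nu k <= e / 4.
  by apply: (cvgr_le (0 : R)); [exact: lam_cvg0|rewrite divr_gt0].
have LM : lam nu M <= e / 4 := hM M (leqnn M).
(* The head, multiplied by at most L^2, contributes e^2 / 2; the tail has lam <= e / 4 and squared
   norm at most 8, which gives the other e^2 / 2. *)
pose dl := e ^+ 2 / (2 * L ^+ 2).
have dl0 : 0 < dl.
  by apply: divr_gt0; [exact: exprn_gt0|apply: mulr_gt0 => //; exact: exprn_gt0].
have cd := cb b M; rewrite [X in _ --> X]big1 in cd; last first.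
  by move=> k _; rewrite subrr modulus0 expr0n mul0r.
near=> n.
have dM : \sum_(k < M) modulus (a (sg n) k - b k) ^+ 2 * gam k <= dl.
  by near: n; apply: (cvgr_le (0 : R)).
rewrite ger0_norm ?sqrtr_ge0//.
have cdn := coefsB (toeplitz_coefs beta0 (ca (sg n))) cTh.
apply/(coefs_normP (ltW e0) cdn) => N.
pose t k := modulus ((lam nu k)%:C * a (sg n) k - (lam nu k)%:C * b k) ^+ 2 * gam k.
have tE k : t k = lam nu k ^+ 2 * (modulus (a (sg n) k - b k) ^+ 2 * gam k).
  by rewrite /t -mulrBr modulusM exprMn modulus_real gtr0_norm// mulrA.
have d0 k : 0 <= modulus (a (sg n) k - b k) ^+ 2 * gam k by rewrite mulr_ge0 ?sqr_ge0// ltW.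
have t0 k : 0 <= t k by rewrite tE mulr_ge0 ?sqr_ge0.
have split_sum (s : nat -> R) : \sum_(k < M + N) s k = \sum_(k < M) s k + \sum_(k < N) s (M + k)%N.
  by rewrite big_split_ord.
apply: (@le_trans _ _ (\sum_(k < M + N) t k)).
  by rewrite addnC big_split_ord/= lerDl; apply: sumr_ge0 => k _; exact: t0.
rewrite split_sum (_ : e ^+ 2 = L ^+ 2 * dl + (e / 4) ^+ 2 * 8); last first.
  by rewrite /dl; field; rewrite gt_eqF.
apply: lerD.
  apply: le_trans (ler_wpM2l (sqr_ge0 L) dM); rewrite mulr_sumr; apply: ler_sum => k _.
  rewrite tE ler_wpM2r//; apply: lerXn2r; rewrite ?nnegrE; [exact: ltW|exact: ltW|exact: ldec].
have := d4 (sg n) (M + N)%N; rewrite (split_sum (fun k => modulus (a (sg n) k - b k) ^+ 2 * gam k)) => d4'.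
have S0 : 0 <= \sum_(k < M) modulus (a (sg n) k - b k) ^+ 2 * gam k.
  by apply: sumr_ge0 => k _; exact: d0.
have S8 : \sum_(k < N) modulus (a (sg n) (M + k)%N - b (M + k)%N) ^+ 2 * gam (M + k) <= 8 by lra.
apply: le_trans (ler_wpM2l (sqr_ge0 (e / 4)) S8); rewrite mulr_sumr; apply: ler_sum => k _.
rewrite tE ler_wpM2r//; apply: lerXn2r; rewrite ?nnegrE.
- exact: ltW.
- by rewrite divr_ge0// ltW.
- by apply: le_trans LM; apply: ldec; exact: leq_addr.
Unshelve. all: by end_near.
Qed.

End Compactness.

(** * The counting function along the eigenvalues *)

Lemma counting_fun_lam (R : realType) (nu : R) m : 0 < nu ->
  counting_fun (lam nu) (lam nu m) = m.
Proof.
move=> nu0; apply: card_fset_set; rewrite (_ : [set k | _] = `I_m)//.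
apply/seteqP; split=> k /=; last first.
  elim: m => [//|m ih]; rewrite ltnS leq_eqVlt => /orP[/eqP->|/ih h].
    exact: lam_decreasing.
  by apply: lt_trans h; exact: lam_decreasing.
apply: contraTT; rewrite -leqNgt -leNgt => mk.
have : {homo lam (R := R) nu : m n / (m <= n)%N >-> n <= m}.
  by apply/nonincreasing_seqP => n; exact/ltW/lam_decreasing.
exact.
Qed.

(** The asymptotic relation is evaluated at t = lam (sg k), where the counting function is exactly
    sg k; comparing with the limit l along sg determines C. *)
Lemma subseq_limit_counting (R : realType) (beta C l : R) : 0 < beta -> 0 < l ->
  (counting_fun (lam (beta / 2)) t)%:R / (C * t `^ (- (2 / beta))) @[t --> 0^'+] --> (1 : R) ->
  subseq_limit (fun k => k.+1%:R `^ (beta / 2) * lam (beta / 2) k) l ->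
  l `^ (2 / beta) = C.
Proof.
move=> b0 l0 cC [sg [hs cl]]; have nu0 := nu_gt0 b0; set nu := beta / 2 in nu0 cl cC *.
have lp k : 0 < lam nu k by exact/lam_gt0/ltW.
have sgoo : (fun k => sg k) @ \oo --> \oo.
  move=> A [N _ NA]; exists N => // k /= Nk; apply: NA => /=.
  exact: leq_trans Nk (homo_ltn_ge hs k).
have lam_right : lam nu @ \oo --> (0 : R)^'+.
  move=> A A0; have := lam_cvg0 nu0 A0; rewrite /= /nbhs/=.
  by apply: filterS => k; apply; exact: lp.
pose p := 2 / beta; have nup : nu * p = 1 by rewrite /nu /p; field; rewrite gt_eqF.
have c1 : (fun k => (sg k)%:R / (C * lam nu (sg k) `^ (- p))) @ \oo --> (1 : R).
  rewrite (_ : (fun k => _) =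
    ((fun t => (counting_fun (lam nu) t)%:R / (C * t `^ (- p))) \o lam nu) \o sg).
    by apply: cvg_comp sgoo _; exact: cvg_comp lam_right cC.
  by apply/funext => k /=; rewrite counting_fun_lam.
have c2 : (fun k => (sg k).+1%:R * lam nu (sg k) `^ p) @ \oo --> l `^ p.
  have x0 k : 0 < ((sg k).+1%:R `^ nu * lam nu (sg k)) / l.
    by apply: divr_gt0 => //; apply: mulr_gt0; [exact: powR_gt0|exact: lp].
  have cx : (fun k => ((sg k).+1%:R `^ nu * lam nu (sg k)) / l) @ \oo --> (1 : R).
    have := cvgMr_tmp (b := l^-1) cl; rewrite (divff (lt0r_neq0 l0)) => h; exact: h.
  have := cvgMl_tmp (a := l `^ p) (cvg_powR1 p x0 cx); rewrite mulr1 => h.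
  rewrite (_ : (fun k => _) = fun k =>
    l `^ p * (((sg k).+1%:R `^ nu * lam nu (sg k)) / l) `^ p); first exact: h.
  apply/funext => k; rewrite -powRM ?(ltW l0) ?(ltW (x0 _))// [l * _]mulrC divfK ?gt_eqF//.
  by rewrite powRM ?powR_ge0 ?(ltW (lp _))// -powRrM nup powRr1.
(* The counting function returns n, whereas the limit l is normalised with n + 1; the quotient tends
   to 1. *)
have c3 : (fun k => (sg k)%:R / (sg k).+1%:R) @ \oo --> (1 : R).
  rewrite (_ : (fun k => _) = fun k => 1 - (sg k).+1%:R^-1).
    rewrite -[X in _ --> X]subr0; apply: cvgB; first exact: cvg_cst.
    exact: (cvg_comp _ _ sgoo (@cvg_harmonic R)).
  by apply/funext => k; rewrite -natr1; field; rewrite natr1.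
have c4 : (fun k => (sg k)%:R / (sg k).+1%:R * ((sg k).+1%:R * lam nu (sg k) `^ p) * C^-1) @ \oo -->
    l `^ p / C.
  by have := cvgMr_tmp (b := C^-1) (cvgM c3 c2); rewrite mul1r; apply.
have e : l `^ p / C = 1.
  apply: (cvg_unique (@Rhausdorff R) c4); rewrite (_ : (fun k => _) =
    (fun k => (sg k)%:R / (C * lam nu (sg k) `^ (- p))))//.
  apply/funext => k; have s0 : (sg k).+1%:R != 0 :> R by [].
  rewrite powRN invfM invrK; move: C^-1 (lam _ _ `^ p) => D y.
  by rewrite [_ * (_ * y)]mulrA divfK//; ring.
(* For C = 0 the quotient would be 0, by the convention on division by zero. *)
have C0 : C != 0 by apply/eqP => C0; move: e; rewrite C0 invr0 mulr0 => /eqP; rewrite eq_sym oner_eq0.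
by apply: (divIf C0); rewrite e divff.
Qed.

Theorem proposition5p3 (R : realType) (beta : R) (hbeta : 0 < beta) :
  exists phi : R[i] -> R,
    [/\ smooth phi,
        radial phi,
        (forall z : R[i], loewner_le (3 / 4)%:M (hessian phi z) /\
                          loewner_le (hessian phi z) (9 / 4)%:M)
      & let T := toeplitz phi (fun z => (symbol beta z)%:C) in
        compact_op phi T /\
        exists s : nat -> R,
          [/\ singular_values phi T s,
              (exists l1 l2 : R,
                 [/\ 0 < l1, 0 < l2, l1 != l2,
                     subseq_limit (fun k => k.+1%:R `^ (beta / 2) * s k) l1
                   & subseq_limit (fun k => k.+1%:R `^ (beta / 2) * s k) l2])
            & ~ (exists C : R,
                   (counting_fun s t)%:R / (C * t `^ (- (2 / beta)))
                     @[t --> 0^'+] --> (1 : R))]].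
Proof.
have nu0 := nu_gt0 hbeta; exists (@phi R); split.
- exact: smooth_phi.
- exact: radial_phi.
- exact: hessian_bounds.
split; first exact: toeplitz_compact.
pose a (t : R) : R := 3 / 2 + sin t / 2.
have a0 t : 0 < a t by have := sin_geN1 t; rewrite /a; lra.
have lim t : 0 <= t -> subseq_limit (fun k => k.+1%:R `^ (beta / 2) * lam (beta / 2) k)
    (a t `^ (beta / 2)) by exact/lam_subseq/ltW.
have l0 t : 0 < a t `^ (beta / 2) by exact: powR_gt0.
have aK t : (a t `^ (beta / 2)) `^ (2 / beta) = a t.
  rewrite -powRrM (_ : beta / 2 * (2 / beta) = 1); last by field; rewrite gt_eqF.
  by rewrite powRr1// ltW.
have pi20 : 0 <= pi / 2 :> R by rewrite divr_ge0// pi_ge0.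
have neq : a 0 != a (pi / 2) by rewrite /a sin0 sin_pihalf; apply/eqP; lra.
exists (lam (beta / 2)); split; first exact: toeplitz_singular_values.
  exists (a 0 `^ (beta / 2)), (a (pi / 2) `^ (beta / 2)); split=> //; last 2 first.
  - exact: lim.
  - exact: lim.
  by apply: contraNneq neq => e; rewrite -(aK 0) e aK.
move=> [C cC]; case/eqP: neq; rewrite -(aK 0) -(aK (pi / 2)).
have := subseq_limit_counting hbeta (l0 0) cC (lim 0 (lexx 0)).
by have := subseq_limit_counting hbeta (l0 (pi / 2)) cC (lim (pi / 2) pi20) => -> ->.
Qed.
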